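(* Let $\mathcal{F}$ be a one-dimensional holomorphic foliation with isolated singularities on the weighted projective space $\mathbb{P}(\omega)=\mathbb{P}(\omega_0,\dots,\omega_n)$ of dimension $n$, and let $V\subset\mathbb{P}(\omega)$ be a quasi-smooth hypersurface invariant by $\mathcal{F}$. (i) If $n=2$, then $$\deg(V)\leq \deg(\mathcal{F})+\omega_0+\omega_1+\omega_2-2.$$ (ii) If $n\geq 3$ and $\deg(\mathcal{F})\geq \omega_0+\cdots+\omega_n+1$, then $$\deg(V)<\deg(\mathcal{F})+\alpha_n(\omega_0+\cdots+\omega_n)-1,$$ where, for $n$ odd, $\alpha_n$ is the positive root of $R_n(x):=x(x+1)^n-2=0$, and, for $n$ even, $\alpha_n:=\alpha_{n-1}$.
   Context: Let $\omega_0,\dots,\omega_n\geq 1$ be integers. The weighted projective space $\mathbb{P}(\omega)=\mathbb{P}(\omega_0,\dots,\omega_n)$ is the quotient of $\mathbb{C}^{n+1}\setminus\{0\}$ by the $\mathbb{C}^*$-action $\lambda\cdot(z_0,\dots,z_n)=(\lambda^{\omega_0}z_0,\dots,\lambda^{\omega_n}z_n)$, regarded as a complex orbifold of dimension $n$. For $d\in\mathbb{Z}$, $\mathcal{O}_{\mathbb{P}(\omega)}(d)$ is the line orbibundle obtained as the quotient of $(\mathbb{C}^{n+1}\setminus\{0\})\times\mathbb{C}$ by the action $\lambda\cdot(z,t)=(\lambda\cdot z,\lambda^d t)$; for $d\ge 0$ its global sections are the quasi-homogeneous polynomials of degree $d$, i.e. linear combinations of monomials $z_0^{k_0}\cdots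 z_n^{k_n}$ with $\omega_0k_0+\cdots+\omega_nk_n=d$. Hypersurfaces: a hypersurface $V$ of degree $\deg(V)=d_0$ is $V=\{f=0\}$ with $f$ a quasi-homogeneous polynomial of degree $d_0$. It is quasi-smooth if its cone $\{f=0\}\subset\mathbb{C}^{n+1}\setminus\{0\}$ is smooth. Foliations: a (singular) one-dimensional holomorphic foliation $\mathcal{F}$ of degree $\deg(\mathcal{F})=d$ on $\mathbb{P}(\omega)$ is given by an element of $\mathbb{P}\mathrm{H}^0(\mathbb{P}(\omega),T\mathbb{P}(\omega)\otimes\mathcal{O}_{\mathbb{P}(\omega)}(d-1))$, where $T\mathbb{P}(\omega)$ is the tangent orbibundle. A quasi-homogeneous polynomial vector field $X=\sum_{i=0}^nP_i\,\partial/\partial z_i$ on $\mathbb{C}^{n+1}$ of degree $d$, meaning $P_i(\lambda^{\omega_0}z_0,\dots,\lambda^{\omega_n}z_n)=\lambda^{d+\omega_i-1}P_i(z_0,\dots,z_n)$ for all $i$, induces such a foliation, and $X+gR_\omega$ defines the same foliation as $X$, where $R_\omega=\sum_i\omega_iz_i\,\partial/\partial z_i$ and $g$ is quasi-homogeneous of degree $d-1$. The singular set $\mathrm{Sing}(\mathcal{F})$ is the zero set of the section defining $\mathcal{F}$; $\mathcal{F}$ has isolated singularities if this set consists of isolated points. A hypersurface $V$ is invariant by $\mathcal{F}$ if the tangent direction of $\mathcal{F}$ at $p$ is contained in $T_pV$ for all $p\in V\setminus(\mathrm{Sing}(V)\cup\mathrm{Sing}(\mathcal{F}))$. *)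

(* Defs.v *)
From HB Require Import structures.
From mathcomp Require Import all_boot all_order all_algebra generic_quotient.
From mathcomp Require Import all_classical all_reals topology normedtype derive.
From mathcomp Require Export complex.
From mathcomp Require Import -(notations) mpoly.

Set Implicit Arguments.
Unset Strict Implicit.
Unset Printing Implicit Defensive.

Import Order.TTheory GRing.Theory Num.Theory.
Import numFieldNormedType.Exports.

Local Open Scope classical_set_scope.
Local Open Scope quotient_scope.
Local Open Scope ring_scope.

Section WeightedProjectiveSpace.
Context (C : numClosedFieldType) (n : nat) (w : 'I_n.+1 -> nat).

Definition wact (l : C) (z : 'rV[C]_n.+1) : 'rV[C]_n.+1 :=
  \row_i (l ^+ w i * z 0 i).

Definition radial (z : 'rV[C]_n.+1) : 'rV[C]_n.+1 :=
  \row_i ((w i)%:R * z 0 i).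

Definition punctured : set 'rV[C]_n.+1 := [set z | z != 0].

Definition same_orbit (x y : punctured) : bool :=
  `[< exists2 l : C, l != 0 & wact l (set_val x) = set_val y >].

Lemma wact1 z : wact 1 z = z.
Proof. by apply/rowP => i; rewrite mxE expr1n mul1r. Qed.

Lemma wactM l m z : wact l (wact m z) = wact (l * m) z.
Proof. by apply/rowP => i; rewrite !mxE exprMn mulrA. Qed.

Lemma same_orbit_equiv : equiv_class_of same_orbit.
Proof.
split.
- by move=> x; apply/asboolP; exists 1; rewrite ?oner_eq0 ?wact1.
- have sym x y : same_orbit x y -> same_orbit y x.
    move=> /asboolP[l l0 e]; apply/asboolP; exists l^-1; rewrite ?invr_eq0//.
    by rewrite -e wactM mulVf// wact1.
  by move=> x y; apply/idP/idP; exact: sym.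
- move=> y x z /asboolP[l l0 e] /asboolP[m m0 e'].
  apply/asboolP; exists (m * l); first by rewrite mulf_neq0.
  by rewrite -wactM e.
Qed.

Canonical same_orbit_rel := EquivRelPack same_orbit_equiv.

Definition wproj : topologicalType := quotient_topology {eq_quot same_orbit_rel}%qT.

Definition orbit_pt (x : punctured) : wproj := \pi_{eq_quot same_orbit_rel} x.

(* [radial z] spans the tangent line at z to the orbit of z, so that the
   tangent orbibundle of [wproj] pulls back to the punctured space as the
   trivial bundle with fibre C^(n+1), modulo the line spanned by [radial z]. *)
Definition radial_eq (z u v : 'rV[C]_n.+1) : Prop :=
  exists c : C, u - v = c *: radial z.

(* A nonzero global section of T(wproj) (x) O(d - 1): a section of the
   pulled back bundle that is invariant under
     l . (z, [v]) = (wact l z, [l ^ (d - 1) *: wact l v]).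
   Its value at z is the class of [fol_lift z] modulo [radial z], and
   [fol_lift] is an arbitrary set-theoretic choice of representatives: only the
   section, and not [fol_lift] itself, has to be holomorphic. *)
Record foliation (d : int) := Foliation {
  fol_lift : 'rV[C]_n.+1 -> 'rV[C]_n.+1;
  fol_holomorphic : forall p, p != 0 ->
    exists Y : 'rV[C]_n.+1 -> 'rV[C]_n.+1,
      \forall z \near p, differentiable Y z /\ radial_eq z (Y z) (fol_lift z);
  fol_equivariant : forall (l : C) (z : 'rV[C]_n.+1), l != 0 -> z != 0 ->
    radial_eq (wact l z) (fol_lift (wact l z))
              (l ^ (d - 1) *: wact l (fol_lift z));
  fol_neq0 : exists2 z, z != 0 & ~ radial_eq z (fol_lift z) 0
}.

Definition sing_cone d (F : foliation d) : set 'rV[C]_n.+1 :=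
  [set z | z != 0 /\ radial_eq z (fol_lift F z) 0].

Definition sing d (F : foliation d) : set wproj :=
  [set orbit_pt x | x in [set x : punctured | sing_cone F (set_val x)]].

Definition isolated_singularities d (F : foliation d) : Prop :=
  sing F `<=` isolated (sing F).

Definition eval_at (f : mpoly n.+1 C) (z : 'rV[C]_n.+1) : C :=
  meval (fun i => z 0 i) f.

Definition quasi_homogeneous (d0 : nat) (f : mpoly n.+1 C) : Prop :=
  forall m, m \in msupp f -> (\sum_i w i * m i)%N = d0.

Definition cone (f : mpoly n.+1 C) : set 'rV[C]_n.+1 :=
  [set z | z != 0 /\ eval_at f z = 0].

Definition cone_sing (f : mpoly n.+1 C) : set 'rV[C]_n.+1 :=
  [set z | cone f z /\ forall i, eval_at (mderiv i f) z = 0].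

(* Smoothness is that of the scheme {f = 0}: its equation vanishes to order one
   along the cone, so that deg f is the degree of the hypersurface. *)
Definition quasi_smooth (f : mpoly n.+1 C) : Prop := cone_sing f = set0.

(* At a smooth point of the cone this contains [radial z] (Euler's identity),
   and its quotient by that line is the tangent space of {f = 0}. *)
Definition cone_tangent (f : mpoly n.+1 C) (z : 'rV[C]_n.+1) :
    set 'rV[C]_n.+1 :=
  [set v | \sum_i v 0 i * eval_at (mderiv i f) z = 0].

Definition invariant_hypersurface d (F : foliation d) (f : mpoly n.+1 C) :
    Prop :=
  forall z, cone f z -> ~ cone_sing f z -> ~ sing_cone F z ->
    cone_tangent f z (fol_lift F z).

End WeightedProjectiveSpace.

Section Alpha.
Context (R : realType).

Definition alpha_poly (n : nat) : {poly R} := 'X * ('X + 1) ^+ n - 2%:P.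

Definition alpha_root (n : nat) : R :=
  get [set x : R | 0 < x /\ root (alpha_poly n) x].

Definition alpha (n : nat) : R :=
  if odd n then alpha_root n else alpha_root n.-1.

Lemma alpha_rootP (n : nat) : (0 < n)%N ->
  forall x : R, (0 < x /\ root (alpha_poly n) x) <-> x = alpha_root n.
Proof.
move=> n0.
have ev (x : R) : (alpha_poly n).[x] = x * (x + 1) ^+ n - 2.
  by rewrite /alpha_poly !hornerE.
have uniq (x y : R) : 0 < x -> x < y -> root (alpha_poly n) x ->
    root (alpha_poly n) y -> False.
  move=> x0 xy; rewrite !rootE !ev !subr_eq0 => /eqP ex /eqP ey.
  have : x * (x + 1) ^+ n < y * (y + 1) ^+ n.
    apply: ltr_pM => //; [exact: ltW|by rewrite exprn_ge0// addr_ge0// ltW|].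
    by rewrite ltrXn2r -?lt0n// ?nnegrE ?addr_ge0 ?ltrD2r// ltW// (lt_trans x0).
  by rewrite ex ey ltxx.
have [x /andP[x0 _] rx] : exists2 x : R, 0 <= x <= 1 & root (alpha_poly n) x.
  apply: poly_ivt => //; rewrite !ev mul0r sub0r oppr_le0 ler0n/=.
  rewrite mul1r subr_ge0 -[leLHS]expr1 (_ : 1 + 1 = 2)//.
  by rewrite ler_weXn2l// ler1n.
have {}x0 : 0 < x.
  rewrite lt_neqAle x0 andbT; apply/eqP => x0'; move: rx.
  by rewrite rootE ev -x0' mul0r sub0r oppr_eq0 pnatr_eq0.
have [ar0 ar] : 0 < alpha_root n /\ root (alpha_poly n) (alpha_root n).
  exact: (@getPex _ [set x : R | 0 < x /\ root (alpha_poly n) x] (ex_intro _ x (conj x0 rx))).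
move=> y; split => [[y0 ry]|-> //].
by case: (ltgtP y (alpha_root n)) => // h; [case: (uniq y (alpha_root n))|case: (uniq (alpha_root n) y)].
Qed.

End Alpha.

(* Main.v *)
(** Let [l = d - 1], let [r_i = w_i z_i] be the radial field and [v_i] the partial derivatives of [f].

    The coefficients [W_ij = r_i F_j - r_j F_i] of the exterior product of the radial field and the foliation do not
    depend on the lift [F]; they are holomorphic off the origin and quasi-homogeneous of degree
    [l + w_i + w_j].  Rescaling into a compact annulus bounds their growth, so by Liouville they are
    polynomial in each variable separately, hence polynomials.

    On [{f = 0}] the polynomials [sum_i W_ij v_i] vanish, by invariance; quasi-smoothness makes [f]
    reduced, so [f] divides them.  The quotients form a lift [X] with [sum_i X_i v_i = 0].  By Euler's
    identity and quasi-smoothness the [v_i] vanish simultaneously only at the origin, so they form a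
    regular sequence and [X = A v] with [A] antisymmetric, [a_ij] being quasi-homogeneous of degree
    [l + w_i + w_j - deg f].  Some [a_ij] with [i <> j] is nonzero, so [deg f <= l + w_i + w_j]: this
    is (i).

    For (ii) put [e = deg f - l], so that [a_ij = 0] unless [e <= w_i + w_j].  In the Leibniz expansion
    of a nonzero principal minor of size [rank A], each factor costs at least [e], so
    [e * rank A <= 2 sum w].  If (ii) fails, then [alpha_m (m + 1) > 2] and the parity of [rank A]
    give [rank A <= n - 1], so [A k = 0] has two independent solutions [k1], [k2].  Since [{A v = 0}]
    is the locus where [v] lies in the kernel of [A], it is then at least two-dimensional, and the
    foliation has infinitely many singular orbits.  Algebraically: isolated singularities form finitely
    many orbits (compactness), so some quasi-homogeneous [h] vanishes on none of them, [A v] and [h]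
    have only the trivial common zero, and this contradicts a dimension count. *)

From HB Require Import structures.
Require Import Defs.
From mathcomp Require Import all_boot all_order all_algebra generic_quotient.
From mathcomp Require Import all_fingroup all_field.
From mathcomp Require Import all_classical all_reals all_analysis.
From mathcomp Require Import ring lra zify.
From mathcomp Require Import -(notations) mpoly.

Set Implicit Arguments.
Unset Strict Implicit.
Unset Printing Implicit Defensive.

Import Order.TTheory GRing.Theory Num.Theory.
Import numFieldNormedType.Exports.

Local Open Scope ring_scope.

(** Two kernel vectors are needed because of a parameter count: [v = c1 k1 + c2 k2] is [n + 1]
    equations in [n + 3] unknowns, so cutting by [h] still leaves expected dimension one, while a
    single vector would leave zero and no contradiction. Parity helps for odd [n]: rank [n] is then
    impossible, and excluding [n + 1] already brings the rank to [n - 1]; for even [n], rank [n] has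
    to be excluded. So the argument works once [e] exceeds [2 sum w / (n + 1)], respectively
    [2 sum w / n], which is the pattern [alpha_n = alpha_(n-1)] for even [n]. The equation of
    [alpha_m] enters only through [alpha_m > 2 / (m + 1)], that is [(m + 3)^m < (m + 1)^(m + 1)], an
    equality for [m = 1]. The assumption on [deg F] in (ii) makes every [w_i] smaller than [deg f]
    once the bound fails, so that all partial derivatives have positive degree [deg f - w_i], as the
    count requires. Cofactors obtained from ideal membership carry no degree; they are cut down to
    homogeneous components, and the antisymmetry of [A] has to survive this. *)

Local Notation mX i := (mpolyX _ (mnm1 i)).

(** * Quasi-homogeneous polynomials *)

Section WeightedDegree.
Context (n : nat) (w : 'I_n -> nat).

Definition wdeg (m : multinom n) : nat := (\sum_i w i * m i)%N.

Lemma wdeg0 : wdeg (@mnm0 n) = 0%N.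
Proof. by rewrite /wdeg big1// => i _; rewrite mnm0E muln0. Qed.

Lemma wdegD : {morph wdeg : m1 m2 / mnm_add m1 m2 >-> (m1 + m2)%N}.
Proof.
by move=> m1 m2; rewrite /wdeg -big_split; apply: eq_bigr => i _; rewrite mnmDE mulnDr.
Qed.

HB.instance Definition _ := isMeasure.Build n wdeg wdeg0 wdegD.

Lemma wdeg1 i : wdeg (mnm1 i) = w i.
Proof.
rewrite /wdeg (bigD1 i)//= mnm1E eqxx muln1 big1 ?addn0// => j ji.
by rewrite mnm1E eq_sym (negbTE ji) muln0.
Qed.

End WeightedDegree.

Section Homogeneous.
Context (C : fieldType) (n : nat) (w : 'I_n -> nat).
Implicit Types (p q : mpoly n C).

Definition whomog d p := p \is ishomog1 d (wdeg w).
Definition wcomp d p : mpoly n C := pihomog (wdeg w) d p.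

HB.instance Definition _ d := GRing.Linear.copy (wcomp d) (pihomog (wdeg w) d).

Lemma whomogP d p : reflect (forall m, m \in msupp p -> wdeg w m = d) (whomog d p).
Proof. exact: dhomogP. Qed.

Lemma wcomp_homog d p : whomog d (wcomp d p).
Proof. exact: pihomogP. Qed.

Lemma wcomp_id d p : whomog d p -> wcomp d p = p.
Proof. exact: pihomog_dE. Qed.

Lemma wcomp_neq d e p : whomog d p -> d != e -> wcomp e p = 0.
Proof. by move=> hp de; apply: pihomog_ne0 hp. Qed.

Lemma wcomp_sum k p : (mmeasure (wdeg w) p <= k)%N -> p = \sum_(d < k) wcomp d p.
Proof. exact: pihomog_partitionE. Qed.

Lemma wcomp_large p : exists N, forall d, (N <= d)%N -> wcomp d p = 0.
Proof.
exists (mmeasure (wdeg w) p) => d hd; rewrite /wcomp pihomogE big_seq_cond big1// => m.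
by case/andP => /(@mmeasure_mnm_lt _ _ (wdeg w)) h /eqP e; move: h; rewrite e ltnNge hd.
Qed.

Lemma whomog0 d : whomog d 0. Proof. exact: dhomog0. Qed.
Lemma whomogD d p q : whomog d p -> whomog d q -> whomog d (p + q).
Proof. exact: dhomogD. Qed.
Lemma whomogN d p : whomog d p -> whomog d (- p).
Proof. by rewrite /whomog dhomogN. Qed.
Lemma whomogM d e p q : whomog d p -> whomog e q -> whomog (d + e) (p * q).
Proof. exact: dhomogM. Qed.
Lemma whomogZ d c p : whomog d p -> whomog d (c *: p).
Proof. exact: dhomogZ. Qed.
Lemma whomog_sum d I (s : seq I) (P : pred I) (F : I -> mpoly n C) :
  (forall i, P i -> whomog d (F i)) -> whomog d (\sum_(i <- s | P i) F i).
Proof.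
move=> H; elim/big_rec : _ => [|i x Pi hx]; first exact: whomog0.
by apply: whomogD => //; exact: H.
Qed.
Lemma whomogX m : whomog (wdeg w m) (mpolyX C m).
Proof. by rewrite /whomog dhomogX. Qed.
Lemma whomogX1 i : whomog (w i) (mX i : mpoly n C).
Proof. by rewrite -(wdeg1 w i); exact: whomogX. Qed.
Lemma whomogC c : whomog 0 (mpolyC n c).
Proof. by rewrite -[c]mulr1 mpolyCM mul_mpolyC; apply: whomogZ; rewrite mpolyC1; exact: dhomog1. Qed.

Lemma wcompM d e p q : whomog e q ->
  wcomp d (p * q) = if (e <= d)%N then wcomp (d - e) p * q else 0.
Proof.
move=> hq; pose k := maxn (mmeasure (wdeg w) p) (d - e).+1.
have kp : (mmeasure (wdeg w) p <= k)%N by rewrite leq_maxl.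
rewrite {1}(wcomp_sum kp) mulr_suml raddf_sum/=.
case: leqP => ed; last first.
  rewrite big1// => i _; apply: wcomp_neq (whomogM (wcomp_homog _ _) hq) _.
  by rewrite neq_ltn orbC (leq_trans ed)// leq_addl.
have dk : (d - e < k)%N by rewrite leq_max ltnSn orbT.
rewrite (bigD1 (Ordinal dk))//= big1 ?addr0.
  by rewrite wcomp_id//; have := whomogM (wcomp_homog (d - e) p) hq; rewrite subnK.
move=> i ik; apply: wcomp_neq (whomogM (wcomp_homog _ _) hq) _.
by apply: contra ik => /eqP h; rewrite -val_eqE/= -h addnK.
Qed.

(** Taking the component of degree [t] of the identity replaces each cofactor by one of its
    components. The Nullstellensatz and the Koszul argument produce cofactors without degree
    control, and this restores it; the test [D k <= t] guards the truncated subtraction. *)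
Lemma homog_cofactors (I : finType) (g : I -> mpoly n C) (D : I -> nat) t p
    (s : I -> mpoly n C) :
  (forall k, whomog (D k) (g k)) -> whomog t p -> p = \sum_k s k * g k ->
  p = \sum_k (if (D k <= t)%N then wcomp (t - D k) (s k) else 0) * g k.
Proof.
move=> hg hp e; rewrite -{1}(wcomp_id hp) e raddf_sum/=; apply: eq_bigr => k _.
by rewrite (wcompM _ _ (hg k)); case: ifP => // _; rewrite mul0r.
Qed.

End Homogeneous.

(** A matrix with more rows than columns has a left kernel vector. Serves both the Nullstellensatz
    and the dimension count. *)
Lemma linear_dependence (K : fieldType) (T J : finType) (u : J -> T -> K) :
  (#|T| < #|J|)%N ->
  exists l : J -> K, (exists i, l i != 0) /\ forall t, \sum_i l i * u i t = 0.
Proof.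
move=> TJ; pose M := \matrix_(i < #|J|, j < #|T|) u (enum_val i) (enum_val j).
have : kermx M != 0.
  rewrite kermx_eq0 /row_free; apply: contraTneq TJ => <-.
  by rewrite -leqNgt rank_leq_col.
case/rowV0Pn => v /sub_kermxP vM v0; exists (fun i => v 0 (enum_rank i)); split.
  have /existsP[i vi] : [exists i, v 0 i != 0].
    apply: contraNT v0 => /existsPn h; apply/eqP/rowP => i.
    by rewrite mxE; apply/eqP; have := h i; rewrite negbK.
  by exists (enum_val i); rewrite enum_valK.
move=> t; have /rowP/(_ (enum_rank t)) := vM.
rewrite !mxE => e; rewrite -[RHS]e.
rewrite (reindex_onto enum_rank enum_val)/=; last by move=> i _; rewrite enum_valK.
rewrite [RHS](eq_bigl predT); last by move=> i; rewrite enum_rankK eqxx.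
by apply: eq_bigr => i _; rewrite mxE !enum_rankK.
Qed.

(** * The Nullstellensatz over an uncountable field *)

Section Nullstellensatz.
Local Open Scope classical_set_scope.
Local Open Scope ring_scope.
Context (C : closedFieldType) (C_uncountable : ~ countable [set: C]) (n : nat).
Local Notation S := (mpoly n C).
Implicit Types (I J : S -> Prop) (p q : S).

Definition is_ideal I := [/\ I 0, forall p q, I p -> I q -> I (p + q) &
  forall p q, I q -> I (p * q)].

Lemma ideal_sum I (T : Type) (s : seq T) (P : pred T) (F : T -> S) : is_ideal I ->
  (forall i, P i -> I (F i)) -> I (\sum_(i <- s | P i) F i).
Proof.
move=> [I0 ID IM] H; elim/big_rec : _ => // i x Pi Ix.
by apply: ID => //; exact: H.
Qed.

(** Modulo [I] each [X_i - a] is invertible with inverse [g a], so the linear factors can be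
    cancelled one at a time. *)
Lemma ideal_factors I (g : C -> S) i x (r : seq C) : is_ideal I ->
  (forall a, I (1 - (mX i - mpolyC n a) * g a)) ->
  I (x * \prod_(b <- r) (mX i - mpolyC n b)) -> I x.
Proof.
move=> [I0 ID IM] hg; elim: r x => [|b r IH] x; first by rewrite big_nil mulr1.
rewrite big_cons mulrA => /IH h.
rewrite (_ : x = x * (1 - (mX i - mpolyC n b) * g b) + g b * (x * (mX i - mpolyC n b)));
  last by ring.
by apply: ID; apply: IM.
Qed.

(* Otherwise all [X_i - a] would be invertible modulo [I]; uncountably many of
   their inverses have bounded degree, and a linear relation between those is a
   nonzero univariate polynomial in [X_i] belonging to [I]. *)
Lemma proper_ideal_point I i : is_ideal I -> ~ I 1 ->
  exists a, ~ exists q g, I q /\ 1 = q + (mX i - mpolyC n a) * g.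
Proof.
move=> II nI1; have [I0 ID IM] := II; apply: contrapT => /forallNP H.
have {H} /choice[g hg] : forall a, exists g, I (1 - (mX i - mpolyC n a) * g).
  move=> a; have /contrapT[q [g [Iq e]]] := H a.
  by exists g; rewrite e addrK.
have [N hN] : exists N, infinite_set [set a | (msize (g a) <= N)%N].
  apply: contrapT => /forallNP H; apply: C_uncountable.
  have -> : [set: C] = \bigcup_(N in [set: nat]) [set a | (msize (g a) <= N)%N].
    by apply/seteqP; split => // a _; exists (msize (g a)) => /=.
  apply: bigcup_countable => // N _; apply: finite_set_countable.
  by have /contrapT := H N.
(* One point more than there are monomials of bounded degree, which forces the inverses [g a] to be
   linearly dependent. *)
have [B BA cB] := infinite_set_fset #|{: bmultinom n N}|.+1 hN.
pose s : seq C := finmap.enum_fset B.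
have us : uniq s := finmap.fset_uniq B.
have ss : (#|{: bmultinom n N}| < #|'I_(size s)|)%N by rewrite card_ord.
have sN a : a \in s -> (msize (g a) <= N)%N by move=> aB; apply: BA.
pose a (j : 'I_(size s)) := nth 0 s j.
have aN j : (msize (g (a j)) <= N)%N by apply: sN; rewrite mem_nth.
have a_inj : injective a.
  by move=> j k /eqP; rewrite nth_uniq// => /eqP/val_inj.
have [l [[j0 lj0] hl]] := linear_dependence (fun j (t : bmultinom n N) => mcoeff (bmnm t) (g (a j))) ss.
have lg : \sum_j l j *: g (a j) = 0.
  under eq_bigr => j _ do rewrite (mpolywE (aN j)) scaler_sumr.
  rewrite exchange_big/= big1// => t _.
  under eq_bigr => j _ do rewrite scalerA.
  by rewrite -scaler_suml hl scale0r.
pose Q : {poly C} := \sum_j l j *: \prod_(k | k != j) ('X - (a k)%:P).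
(* Evaluation at [a j0] kills every summand but the one of index [j0], whose coefficient is
   nonzero. *)
have Q0 : Q != 0.
  apply: contraNneq lj0 => /(congr1 (horner^~ (a j0))) /=.
  rewrite horner0 /Q horner_sum (bigD1 j0)//= [X in _ + X]big1 ?addr0; last first.
    move=> j jj0 /=; rewrite hornerZ horner_prod (bigD1 j0) 1?eq_sym//=.
    by rewrite hornerXsubC subrr mul0r mulr0.
  rewrite hornerZ horner_prod => /eqP; rewrite mulf_eq0 => /orP[//|].
  rewrite prodf_seq_eq0 => /hasP[k _ /andP[kj]].
  by rewrite hornerXsubC subr_eq0 => /eqP/a_inj/eqP; rewrite eq_sym (negbTE kj).
pose phi (q : {poly C}) : S := (map_poly (@mpolyC n C) q).[mX i].
have phiXC b : phi ('X - b%:P) = mX i - mpolyC n b.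
  by rewrite /phi rmorphB/= map_polyX map_polyC/= hornerXsubC.
have IQ : I (phi Q).
  (* The factor [X_i - a_j] completes each product to the full one, so the terms in [g] add up to a
     multiple of the vanishing sum [lg]. *)
  have -> : phi Q = \sum_j l j *: (\prod_(k | k != j) (mX i - mpolyC n (a k)) *
      (1 - (mX i - mpolyC n (a j)) * g (a j))).
    under [RHS]eq_bigr => j _ do rewrite mulrBr mulr1 scalerBr.
    rewrite sumrB [X in _ - X](_ : _ = 0) ?subr0; last first.
      transitivity (\prod_k (mX i - mpolyC n (a k)) * \sum_j l j *: g (a j)).
        rewrite mulr_sumr; apply: eq_bigr => j _.
        rewrite [in RHS](bigD1 j)//= -scalerAr mulrA.
        by rewrite [X in X * g _]mulrC.
      by rewrite lg mulr0.
    rewrite /phi /Q raddf_sum/= horner_sum; apply: eq_bigr => j _.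
    rewrite map_polyZ hornerZ/= mul_mpolyC rmorph_prod/= horner_prod; congr (_ *: _).
    by apply: eq_bigr => k _; exact: phiXC.
  apply: ideal_sum => // j _; rewrite -mul_mpolyC.
  by apply: (IM); exact: IM.
have [r Qr] := closed_field_poly_normal Q.
have : I (mpolyC n (lead_coef Q) * \prod_(b <- r) (mX i - mpolyC n b)).
  rewrite mul_mpolyC; move: IQ; rewrite [in phi Q]Qr /phi map_polyZ hornerZ/= mul_mpolyC.
  rewrite rmorph_prod/= horner_prod.
  by under eq_bigr => b _ do rewrite -/(phi _) phiXC.
move/(ideal_factors II hg) => Ic; apply: nI1.
rewrite -mpolyC1 -(mulVf (x := lead_coef Q)) ?lead_coef_eq0// mpolyCM.
exact: IM.
Qed.

(** Coordinates are adjoined one at a time, each [X_i - a_i] keeping the ideal proper by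
    [proper_ideal_point]. The resulting [J] contains all [X_i - z_i], so every [p] is congruent
    modulo [J] to the constant [p(z)]; a nonzero one would put [1] into [J]. *)
Theorem weak_nullstellensatz I : is_ideal I -> ~ I 1 ->
  exists z : 'I_n -> C, forall p, I p -> meval z p = 0.
Proof.
move=> II nI1.
have [J [[JJ nJ1 IJ] hJ]] : exists J, [/\ is_ideal J, ~ J 1 & forall p, I p -> J p] /\
    forall i, i \in enum 'I_n -> exists a, J (mX i - mpolyC n a).
  elim: (enum 'I_n) => [|i s [J [[JJ nJ1 IJ] hJ]]]; first by exists I.
  have [a ha] := proper_ideal_point i JJ nJ1; have [J0 JD JM] := JJ.
  exists (fun p => exists q g, J q /\ p = q + (mX i - mpolyC n a) * g); split.
    split.
    - split; first by exists 0, 0; rewrite mulr0 addr0.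
        move=> _ _ [q [g [Jq ->]]] [q' [g' [Jq' ->]]].
        by exists (q + q'), (g + g'); split; [exact: JD|ring].
      move=> p _ [q [g [Jq ->]]]; exists (p * q), (p * g).
      by split; [exact: JM|ring].
    - by move=> [q [g ?]]; apply: ha; exists q, g.
    - by move=> p /IJ Jp; exists p, 0; rewrite mulr0 addr0.
  move=> k; rewrite inE => /orP[/eqP ->|/hJ[b hb]].
    by exists a, 0, 1; rewrite mulr1 add0r.
  by exists b, (mX k - mpolyC n b), 0; rewrite mulr0 addr0.
have [J0 JD JM] := JJ.
have /choice[z hz] : forall i, exists a, J (mX i - mpolyC n a).
  by move=> i; apply: hJ; rewrite mem_enum.
exists z => p /IJ Jp.
pose K q := J (q - mpolyC n (meval z q)).
have KM q q' : K q -> K q' -> K (q * q').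
  move=> Kq Kq'; rewrite /K mevalM mpolyCM.
  rewrite (_ : _ - _ = q * (q' - mpolyC n (meval z q')) +
    mpolyC n (meval z q') * (q - mpolyC n (meval z q))); last by ring.
  by apply: JD; apply: JM.
have K1 : K 1 by rewrite /K meval1 mpolyC1 subrr.
have KD q q' : K q -> K q' -> K (q + q').
  move=> Kq Kq'; rewrite /K mevalD mpolyCD.
  by rewrite opprD addrACA; apply: JD.
have KX m : K (mpolyX C m).
  rewrite mpolyXE_id; elim/big_ind : _ => // i _.
  elim: (m i) => [|k IH]; first by rewrite expr0.
  by rewrite exprS; apply: KM => //; rewrite /K mevalXU.
have KZ c q : K q -> K (c *: q).
  by rewrite /K mevalZ -!mul_mpolyC mpolyCM -mulrBr; exact: JM.
have Kp : K p.
  rewrite [p]mpolyE; elim/big_ind : _ => //.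
  - by rewrite /K meval0 mpolyC0 subrr.
  - by move=> m _; apply: KZ.
have Jc : J (mpolyC n (meval z p)).
  rewrite -[X in J X](subKr p); apply: JD => //.
  by rewrite -mulN1r; apply: JM.
apply/eqP; apply/negPn/negP => c0; apply: nJ1.
by rewrite -mpolyC1 -(mulVf c0) mpolyCM; exact: JM.
Qed.

(** With [X_i - 1] adjoined the [g k] have no common zero left, so [1 = q + G (X_i - 1)] with [q] in
    their ideal. Homogeneity then trades the auxiliary equation for a power of [X_i]. *)
Theorem homog_nullstellensatz (w : 'I_n -> nat) (T : finType) (g : T -> S) (D : T -> nat) :
  (forall i, (0 < w i)%N) -> (forall k, whomog w (D k) (g k)) ->
  (forall z : 'I_n -> C, (forall k, meval z (g k) = 0) -> forall i, z i = 0) ->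
  forall i, exists N (s : T -> S), mX i ^+ N = \sum_k s k * g k.
Proof.
move=> w0 hg g0 i.
pose Ig p := exists s : T -> S, p = \sum_k s k * g k.
have [Ig0 IgD IgM] : is_ideal Ig.
  split; first by exists (fun=> 0); rewrite big1// => k _; rewrite mul0r.
    move=> _ _ [s ->] [s' ->]; exists (fun k => s k + s' k); rewrite -big_split.
    by apply: eq_bigr => k _; rewrite mulrDl.
  move=> p _ [s ->]; exists (fun k => p * s k); rewrite mulr_sumr.
  by apply: eq_bigr => k _; rewrite mulrA.
pose J p := exists q G, Ig q /\ p = q + G * (mX i - 1).
have [q [G [Igq e1]]] : J 1.
  apply: contrapT => nJ1; have [|z hz] := @weak_nullstellensatz J _ nJ1.
    split; first by exists 0, 0; rewrite mul0r addr0.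
      move=> _ _ [q [G [Iq ->]]] [q' [G' [Iq' ->]]].
      by exists (q + q'), (G + G'); split; [exact: IgD|ring].
    move=> p _ [q [G [Iq ->]]]; exists (p * q), (p * G).
    by split; [exact: IgM|ring].
  have zi : z i = 0.
    apply: g0 => k; apply: hz; exists (g k), 0; rewrite mul0r addr0; split=> //.
    exists (fun j => (j == k)%:R); rewrite (bigD1 k)//= eqxx mul1r big1 ?addr0// => j jk.
    by rewrite (negbTE jk) mul0r.
  have : meval z (mX i - 1) = 0 by apply: hz; exists 0, 1; rewrite mul1r add0r.
  by rewrite mevalB mevalXU zi meval1 sub0r => /eqP; rewrite oppr_eq0 oner_eq0.
have Igc t p : Ig p -> Ig (wcomp w t p).
  move=> [s ->]; rewrite raddf_sum/=.
  exists (fun k => if (D k <= t)%N then wcomp w (t - D k) (s k) else 0).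
  by apply: eq_bigr => k _; rewrite (wcompM _ _ (hg k)); case: ifP; rewrite ?mul0r.
(* In degree [w_i (j + 1)] the identity says that [G_(w_i (j+1))] is [X_i G_(w_i j)] modulo the
   ideal, and in degree [0] that [G_0] is [-1]. So [X_i^j + G_(w_i j)] lies in the ideal, and for
   large [j] the second term is zero. *)
have main j : Ig (mX i ^+ j + wcomp w (w i * j) G).
  elim: j => [|j IH].
    rewrite expr0 muln0.
    have := congr1 (wcomp w 0) e1; rewrite raddfD/= mulrBr mulr1 raddfB/=.
    rewrite (wcompM _ _ (whomogX1 _ _ _)) leqNgt w0/= sub0r.
    have -> : wcomp w 0 1 = (1 : S) by apply: wcomp_id; rewrite -mpolyC1; exact: whomogC.
    by move=> ->; rewrite subrK; exact: Igc.
  have := congr1 (wcomp w (w i * j.+1)) e1; rewrite raddfD/= mulrBr mulr1 raddfB/=.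
  rewrite (wcompM _ _ (whomogX1 _ _ _)) mulnS leq_addr addKn.
  have -> : wcomp w (w i + w i * j) 1 = (0 : S).
    apply: (@wcomp_neq _ _ _ 0%N); first by rewrite -mpolyC1; exact: whomogC.
    by rewrite eq_sym -lt0n addn_gt0 w0.
  move=> e; rewrite (_ : _ + _ = mX i * (mX i ^+ j + wcomp w (w i * j) G) +
    wcomp w (w i + w i * j) q).
    by apply: IgD; [exact: IgM|exact: Igc].
  rewrite exprS mulrDr -addrA; congr (_ + _).
  by rewrite -[LHS]addr0 [X in _ + X = _]e; ring.
have [N hN] := wcomp_large w G.
exists N; have := main N; rewrite hN ?addr0//.
by rewrite leq_pmull.
Qed.

End Nullstellensatz.

(** * Koszul syzygies *)

Section Koszul.
Context (S : comNzRingType).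

(* The exterior algebra of the free module with basis e_0, ..., e_(m-1), where
   (x, y) stands for x + e_m /\ y. *)
Fixpoint ext (m : nat) : lmodType S :=
  if m is m'.+1 then GRing.Lmodule.clone S (ext m' * ext m')%type _
  else GRing.Lmodule.clone S S^o _.

(** Contraction with [v], the Koszul differential sending [e_i] to [v_i]; the minus sign comes from
    moving it past [e_m]. *)
Fixpoint koszul (v : nat -> S) m : ext m -> ext m :=
  if m is m'.+1 then fun x => (koszul v x.1 + v m' *: x.2, - koszul v x.2) else fun=> 0.

(** Left exterior multiplication by [b_0 e_0 + ... + b_(m-1) e_(m-1)]. *)
Fixpoint wedge (b : nat -> S) m : ext m -> ext m :=
  if m is m'.+1 then fun x => (wedge b x.1, b m' *: x.1 - wedge b x.2) else fun=> 0.

Fixpoint ext_deg m p : ext m -> Prop :=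
  if m is m'.+1 then fun x => ext_deg p x.1 /\ (if p is p'.+1 then ext_deg p' x.2 else x.2 = 0)
  else fun x => if p is 0 then True else x = 0.

Fixpoint ext_in (I : S -> Prop) m : ext m -> Prop :=
  if m is m'.+1 then fun x => ext_in I x.1 /\ ext_in I x.2 else fun x => I x.

Lemma koszulD v m (x y : ext m) : koszul v (x + y) = koszul v x + koszul v y.
Proof.
elim: m x y => [|m IH] x y /=; first by rewrite addr0.
congr (_, _); rewrite /= !IH; first by rewrite scalerDr addrACA.
by rewrite opprD.
Qed.

Lemma koszulZ v m c (x : ext m) : koszul v (c *: x) = c *: koszul v x.
Proof.
elim: m x => [|m IH] x /=; first by rewrite scaler0.
congr (_, _); rewrite /= !IH; last by rewrite scalerN.
by rewrite scalerDr !scalerA mulrC.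
Qed.

Lemma koszulN v m (x : ext m) : koszul v (- x) = - koszul v x.
Proof. by rewrite -!scaleN1r koszulZ. Qed.

Lemma koszul0 v m : koszul v (0 : ext m) = 0.
Proof. by have := koszulZ v 0 (0 : ext m); rewrite !scale0r. Qed.

Lemma koszulK v m (x : ext m) : koszul v (koszul v x) = 0.
Proof.
elim: m x => [|m IH] x //=; congr (_, _); rewrite /=.
  by rewrite koszulD koszulZ IH add0r scalerN subrr.
by rewrite koszulN IH !oppr0.
Qed.

Lemma wedgeD b m (x y : ext m) : wedge b (x + y) = wedge b x + wedge b y.
Proof.
elim: m x y => [|m IH] x y /=; first by rewrite addr0.
by congr (_, _); rewrite /= !IH// scalerDr opprD addrACA.
Qed.

Lemma wedgeZ b m c (x : ext m) : wedge b (c *: x) = c *: wedge b x.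
Proof.
elim: m x => [|m IH] x /=; first by rewrite scaler0.
by congr (_, _); rewrite /= !IH// scalerBr !scalerA mulrC.
Qed.

(** Multiplication by [b] is a homotopy between zero and the scalar [sum b_i v_i]; this is why the
    ideal generated by [v] annihilates Koszul homology. *)
Lemma koszul_wedge v b m (x : ext m) :
  koszul v (wedge b x) + wedge b (koszul v x) = (\sum_(i < m) b i * v i) *: x.
Proof.
elim: m x => [|m IH] x /=; first by rewrite big_ord0 scale0r addr0.
rewrite big_ord_recr/=; case: x => x y; congr (_, _); rewrite /=.
  rewrite wedgeD wedgeZ scalerDl -IH scalerBr scalerA [v m * b m]mulrC.
  by rewrite addrACA subrK.
rewrite koszulD koszulN koszulZ opprB -[- koszul v y]scaleN1r wedgeZ scaleN1r opprK.
rewrite scalerDr scalerA -[X in _ + X]addrA [LHS]addrA subrK addrCA IH -scalerDl.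
by rewrite addrC.
Qed.

Section Membership.
Context (I : S -> Prop) (I0 : I 0) (ID : forall x y, I x -> I y -> I (x + y))
  (IM : forall a x, I x -> I (a * x)).

Lemma ext_in0 m : ext_in I (0 : ext m).
Proof. by elim: m => [|m IH] /=. Qed.

Lemma ext_inD m (x y : ext m) : ext_in I x -> ext_in I y -> ext_in I (x + y).
Proof.
elim: m x y => [|m IH] x y /=; first exact: ID.
by move=> [x1 x2] [y1 y2]; split; exact: IH.
Qed.

Lemma ext_inZ m a (x : ext m) : ext_in I x -> ext_in I (a *: x).
Proof.
elim: m x => [|m IH] x /=; first exact: IM.
by move=> [x1 x2]; split; exact: IH.
Qed.

Lemma ext_inN m (x : ext m) : ext_in I x -> ext_in I (- x).
Proof. by rewrite -scaleN1r; exact: ext_inZ. Qed.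

Lemma ext_in_koszul v m (x : ext m) : ext_in I x -> ext_in I (koszul v x).
Proof.
elim: m x => [|m IH] x //= [x1 x2]; split; last by apply: ext_inN; exact: IH.
by apply: ext_inD; [exact: IH|exact: ext_inZ].
Qed.

Lemma ext_in_wedge b m (x : ext m) : ext_in I x -> ext_in I (wedge b x).
Proof.
elim: m x => [|m IH] x //= [x1 x2]; split; first exact: IH.
by apply: ext_inD; [exact: ext_inZ|apply: ext_inN; exact: IH].
Qed.

Lemma ext_inZl m a (x : ext m) : I a -> ext_in I (a *: x).
Proof.
move=> Ia; elim: m x => [|m IH] x /=; last by split; exact: IH.
by rewrite /GRing.scale/= mulrC; exact: IM.
Qed.

End Membership.

Lemma ext_in_eq0 (I : S -> Prop) m (x : ext m) : (forall y, I y -> y = 0) ->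
  ext_in I x -> x = 0.
Proof.
move=> I0; elim: m x => [|m IH] x /=; first exact: I0.
by case: x => x y /= [/IH -> /IH ->].
Qed.

Lemma ext_deg0 m p : ext_deg p (0 : ext m).
Proof. by elim: m p => [|m IH] [|p] //=; split. Qed.

Lemma ext_degD m p (x y : ext m) : ext_deg p x -> ext_deg p y -> ext_deg p (x + y).
Proof.
elim: m p x y => [|m IH] p x y /=.
  by case: p => // p -> ->; rewrite addr0.
move=> [x1 x2] [y1 y2]; split; first exact: IH.
by case: p x1 x2 y1 y2 => [|p] x1 x2 y1 y2; [rewrite x2 y2 addr0|exact: IH].
Qed.

Lemma ext_degZ m p a (x : ext m) : ext_deg p x -> ext_deg p (a *: x).
Proof.
elim: m p x => [|m IH] p x /=.
  by case: p => // p ->; rewrite scaler0.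
move=> [x1 x2]; split; first exact: IH.
by case: p x1 x2 => [|p] x1 x2; [rewrite x2 scaler0|exact: IH].
Qed.

Lemma ext_degN m p (x : ext m) : ext_deg p x -> ext_deg p (- x).
Proof. by rewrite -scaleN1r; exact: ext_degZ. Qed.

Lemma koszul_deg0 v m (x : ext m) : ext_deg 0 x -> koszul v x = 0.
Proof.
elim: m x => [|m IH] //= x [x1 ->].
by rewrite koszul0 oppr0 scaler0 addr0 IH.
Qed.

Lemma ext_deg_koszul v m p (x : ext m) : ext_deg p.+1 x -> ext_deg p (koszul v x).
Proof.
elim: m p x => [|m IH] p x /=; first by case: p.
move=> [x1 x2]; split.
  by apply: ext_degD; [exact: IH|exact: ext_degZ].
case: p x1 x2 => [|p] x1 x2; last by apply: ext_degN; exact: IH.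
by rewrite (koszul_deg0 _ x2) oppr0.
Qed.

Lemma ext_deg_wedge b m p (x : ext m) : ext_deg p x -> ext_deg p.+1 (wedge b x).
Proof.
elim: m p x => [|m IH] p x //= [x1 x2]; split; first exact: IH.
apply: ext_degD; first exact: ext_degZ.
apply: ext_degN; case: p x1 x2 => [|p] x1 x2; last exact: IH.
by rewrite x2 -(scale0r 0) wedgeZ scale0r; exact: ext_deg0.
Qed.

Lemma ext_deg_large m p (x : ext m) : (m < p)%N -> ext_deg p x -> x = 0.
Proof.
elim: m p x => [|m IH] [|p] //= [x y] /= mp [x1 x2].
by congr (_, _); [apply: IH x1|apply: IH x2] => //; exact: ltnW.
Qed.

Lemma ext_in_split (I J : S -> Prop) g m p (x : ext m) :
  I 0 -> (forall y, J y -> exists z, I (y - g * z)) ->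
  ext_in J x -> ext_deg p x -> exists2 y, ext_deg p y & ext_in I (x - g *: y).
Proof.
move=> I0 IJ; elim: m p x => [|m IH] p x /=.
  case: p => [|p]; first by move=> /IJ[z hz] _; exists z.
  by move=> _ ->; exists 0; rewrite // scaler0 subr0.
move=> [x1 x2] [d1 d2].
have [y1 y1p h1] := IH _ _ x1 d1.
case: p d2 {d1} y1p => [|p] d2 y1p.
  exists (y1, 0); split => //=; rewrite d2 scaler0 subr0; exact: ext_in0.
by have [y2 y2p h2] := IH _ _ x2 d2; exists (y1, y2).
Qed.

(* [H_p(v; S / I_j) = 0] for [j < p]: an element [g j] of the ideal generated by
   [v] acts on Koszul homology as zero, and it is regular modulo [I_j], so the
   homology modulo [I_j] in degree [p] embeds into that modulo [I_(j+1)] in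
   degree [p+1]; there is none in degrees above [m]. *)
Lemma koszul_exact (m : nat) (v g : nat -> S) (I : nat -> S -> Prop) :
  (forall j, [/\ I j 0, forall x y, I j x -> I j y -> I j (x + y) &
     forall a x, I j x -> I j (a * x)]) ->
  (forall j x, I j x -> I j.+1 x) -> (forall j, (j < m)%N -> I j.+1 (g j)) ->
  (forall j x, (j < m)%N -> I j.+1 x -> exists y, I j (x - g j * y)) ->
  (forall j x, (j < m)%N -> I j (g j * x) -> I j x) ->
  (forall j, (j < m)%N -> exists b : nat -> S, g j = \sum_(i < m) b i * v i) ->
  forall k j p (c : ext m), (j + k)%N = m -> (j < p)%N -> ext_deg p c ->
  ext_in (I j) (koszul v c) ->
  exists2 e, ext_deg p.+1 e & ext_in (I j) (c - koszul v e).
Proof.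
move=> II IS Ig Isplit Ireg Imem; elim=> [|k IH] j p c jkm jp dc kc.
  rewrite addn0 in jkm; rewrite (ext_deg_large _ dc) -?jkm//.
  exists 0; first exact: ext_deg0.
  by rewrite koszul0 subr0; apply: ext_in0; have [] := II j.
have jm : (j < m)%N by rewrite -jkm -addSnnS leq_addr.
have [b gb] := Imem j jm.
have [I0 ID IM] := II j; have [J0 JD JM] := II j.+1.
have kw := koszul_wedge v b c; rewrite -gb in kw.
have IJ m' (x : ext m') : ext_in (I j) x -> ext_in (I j.+1) x.
  by elim: m' x => [|m' IHm] x /=; [exact: IS|move=> [x1 x2]; split; exact: IHm].
(* Since [c] is a cycle modulo [I j] and [g j] lies in [I j.+1], [wedge b c] is a cycle modulo
   [I j.+1] in the next exterior degree, where the induction hypothesis makes it a boundary. *)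
have kwE : koszul v (wedge b c) = g j *: c - wedge b (koszul v c) by rewrite -kw addrK.
have kwJ : ext_in (I j.+1) (koszul v (wedge b c)).
  rewrite kwE; apply: ext_inD => //; first exact: ext_inZl (Ig j jm).
  by apply: ext_inN => //; apply: ext_in_wedge => //; exact: IJ.
have [|//|e de he] := IH j.+1 p.+1 _ _ _ (ext_deg_wedge b dc) kwJ.
  by rewrite addSnnS.
(* Modulo [I j] the defect [wedge b c - koszul v e] is [g j *: y]. Applying the differential puts
   [g j *: (c - koszul v y)] into [I j], and regularity cancels [g j]. *)
have [y dy hy] := ext_in_split I0 (fun x => @Isplit j x jm) he
  (ext_degD (ext_deg_wedge b dc) (ext_degN (ext_deg_koszul v de))).
exists y => //.
have : ext_in (I j) (g j *: (c - koszul v y)).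
  have -> : g j *: (c - koszul v y) =
      koszul v (wedge b c - koszul v e - g j *: y) + wedge b (koszul v c).
    rewrite !koszulD !koszulN koszulK koszulZ kwE oppr0 addr0 scalerBr.
    by rewrite addrAC subrK.
  by apply: ext_inD => //; [exact: ext_in_koszul|exact: ext_in_wedge].
have {}Ireg x := @Ireg j x jm.
move: (c - koszul v y) => u; clear -Ireg; elim: m u => [|m IHm] u /=.
  exact: Ireg.
by move=> [u1 u2]; split; exact: IHm.
Qed.

Fixpoint ext_scal (s : S) m : ext m := if m is m'.+1 then (ext_scal s m', 0) else s.

Fixpoint ext_vec (X : nat -> S) m : ext m :=
  if m is m'.+1 then (ext_vec X m', ext_scal (X m') m') else 0.

Lemma ext_scal_add s t m : ext_scal (s + t) m = ext_scal s m + ext_scal t m.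
Proof. by elim: m => [|m IH] //=; congr (_, _); rewrite /= ?addr0. Qed.

Lemma ext_scal_scale a s m : ext_scal (a * s) m = a *: ext_scal s m.
Proof. by elim: m => [|m IH] //=; congr (_, _); rewrite /= ?scaler0. Qed.

Lemma ext_scal0 m : ext_scal 0 m = 0.
Proof. by elim: m => [|m IH] //=; rewrite IH. Qed.

Lemma ext_scal_inj m : injective (fun s => ext_scal s m).
Proof. by elim: m => [|m IH] s t //= [/IH]. Qed.

Lemma koszul_scal v s m : koszul v (ext_scal s m) = 0.
Proof.
by elim: m => [|m IH] //=; rewrite IH koszul0 scaler0 addr0 oppr0.
Qed.

Lemma koszul_vec v X m :
  koszul v (ext_vec X m) = ext_scal (\sum_(i < m) X i * v i) m.
Proof.
elim: m => [|m IH] /=; first by rewrite big_ord0.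
rewrite koszul_scal oppr0 IH big_ord_recr/= [X m * _]mulrC ext_scal_add.
by rewrite ext_scal_scale.
Qed.

Lemma ext_deg_scal s m : ext_deg 0 (ext_scal s m).
Proof. by elim: m => [|m IH]. Qed.

Lemma ext_deg_vec X m : ext_deg 1 (ext_vec X m).
Proof.
by elim: m => [|m IH] //=; split => //; exact: ext_deg_scal.
Qed.

Lemma ext_deg0P m (x : ext m) : ext_deg 0 x -> exists s, x = ext_scal s m.
Proof.
elim: m x => [|m IH] x /=; first by exists x.
by case: x => x y [/IH[s /= ->] /= ->]; exists s.
Qed.

Lemma eq_ext_vec X Y m : (forall i, (i < m)%N -> X i = Y i) -> ext_vec X m = ext_vec Y m.
Proof.
elim: m => [|m IH] //= XY; rewrite XY// IH// => i im.
by apply: XY; exact: ltnW.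
Qed.

Lemma ext_deg1P m (x : ext m) : ext_deg 1 x -> exists X, x = ext_vec X m.
Proof.
elim: m x => [|m IH] x /=; first by exists (fun=> 0).
case: x => x y [/IH[X /= ->] /ext_deg0P[s /= ->]].
exists (fun i => if i == m then s else X i); rewrite eqxx; congr (_, _).
by apply: eq_ext_vec => i im; rewrite ltn_eqF.
Qed.

Lemma ext_vec_inj X Y m : ext_vec X m = ext_vec Y m -> forall i, (i < m)%N -> X i = Y i.
Proof.
elim: m => [|m IH] //= [/IH XY /ext_scal_inj e] i.
by rewrite ltnS leq_eqVlt => /predU1P[->|/XY].
Qed.

Lemma ext_vec_add X Y m : ext_vec (fun i => X i + Y i) m = ext_vec X m + ext_vec Y m.
Proof.
elim: m => [|m IH] /=; first by rewrite addr0.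
by rewrite IH ext_scal_add.
Qed.

Lemma ext_vec_scale a X m : ext_vec (fun i => a * X i) m = a *: ext_vec X m.
Proof.
elim: m => [|m IH] /=; first by rewrite scaler0.
by rewrite IH ext_scal_scale.
Qed.

(** A bivector is an antisymmetric matrix, and contracting it with [v] applies the matrix to [v];
    the vector [Y] of the top component becomes the last column and, negated, the last row. The zero
    diagonal is stated apart because [S] may have characteristic two. *)
Lemma koszul_deg2 v m (e : ext m) : ext_deg 2 e ->
  exists A : nat -> nat -> S, [/\ forall i j, A i j = - A j i, forall i, A i i = 0 &
    koszul v e = ext_vec (fun i => \sum_(j < m) A i j * v j) m].
Proof.
elim: m e => [|m IH] e /=.
  by move=> _; exists (fun _ _ => 0); split => // i; rewrite oppr0.
case: e => x y [/IH[A [anti diag /= kx]] /ext_deg1P[Y /= ->]].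
exists (fun i j => if i == m then (if j == m then 0 else - Y j)
  else if j == m then Y i else A i j); split.
- move=> i j; case: (eqVneq i m) => [_|im]; case: (eqVneq j m) => [_|jm];
    by rewrite ?oppr0 ?opprK.
- by move=> i; case: eqP.
rewrite kx koszul_vec; congr (_, _).
  rewrite -ext_vec_scale -ext_vec_add; apply: eq_ext_vec => i im.
  rewrite big_ord_recr/= eqxx ltn_eqF// [v m * _]mulrC; congr (_ + _).
  by apply: eq_bigr => j _; rewrite ltn_eqF.
rewrite eqxx big_ord_recr/= eqxx mul0r addr0.
under [in RHS]eq_bigr => j _ do rewrite ltn_eqF// mulNr.
by rewrite sumrN -[RHS]/(ext_scal _ m) -scaleN1r -ext_scal_scale mulN1r.
Qed.

End Koszul.

Section SyzygiesOfHomogeneousParameters.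
Context (C : fieldType) (n : nat).
Local Notation S := (mpoly n C).

(* The ideal generated by [X_i ^ N], [i < j]. *)
Definition pow_ideal N j (p : S) :=
  forall m, m \in msupp p -> exists2 i : 'I_n, (i < j)%N & (N <= m i)%N.

Lemma pow_idealE N j p : pow_ideal N j p <->
  forall m : multinom n, (forall i : 'I_n, (i < j)%N -> (m i < N)%N) -> mcoeff m p = 0.
Proof.
split=> [H m hm|H m].
  apply/memN_msupp_eq0/negP => /H[i ij]; by rewrite leqNgt hm.
rewrite mcoeff_msupp => h; apply: contrapT => /forall2NP hN; move/eqP: h; apply.
by apply: H => i ij; have [//|/negP] := hN i; rewrite -ltnNge.
Qed.

(** The powers [X_i ^ N] lie in the ideal of [v] and form a regular sequence, so [koszul_exact]
    applies to the ideals they generate. At [j = 0], [p = 1] it says that the cycle [X] is a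
    boundary. *)
Lemma antisym_syzygy (v : 'I_n -> S) (X : 'I_n -> S) :
  (forall i, exists N (s : 'I_n -> S), (mpolyX C (mnm1 i)) ^+ N = \sum_k s k * v k) ->
  \sum_i X i * v i = 0 ->
  exists A : 'I_n -> 'I_n -> S, [/\ forall i j, A i j = - A j i, forall i, A i i = 0 &
    forall i, X i = \sum_j A i j * v j].
Proof.
move=> hN Xv.
have [N hv] : exists N, forall i, exists s : 'I_n -> S,
    (mpolyX C (mnm1 i)) ^+ N = \sum_k s k * v k.
  have /choice[f hf] := hN; exists (\max_i f i) => i.
  have [s hs] := hf i; exists (fun k => (mpolyX C (mnm1 i)) ^+ (\max_i f i - f i) * s k).
  rewrite -{1}(subnK (leq_bigmax i : (f i <= \max_i f i)%N)) exprD hs mulr_sumr.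
  by apply: eq_bigr => k _; rewrite mulrA.
(* The Koszul complex is indexed by natural numbers; families over ['I_n] are padded by a default
   value. *)
pose ext_fun T (f : 'I_n -> T) (t : T) (i : nat) := if insub i is Some k then f k else t.
have ext_funE T (f : 'I_n -> T) t (i : 'I_n) : ext_fun T f t i = f i.
  by rewrite /ext_fun valK.
pose v' := ext_fun S v 0; pose X' := ext_fun S X 0.
pose g := ext_fun S (fun i => (mpolyX C (mnm1 i)) ^+ N : S) 0.
have gE (i : 'I_n) : g i = mpolyX C (mnm_muln (mnm1 i) N) by rewrite /g ext_funE mpolyXn.
have lt_ord j (jn : (j < n)%N) : exists i : 'I_n, j = i by exists (Ordinal jn).
have reg (i : 'I_n) p : pow_ideal N i (g i * p) -> pow_ideal N i p.
  move=> /pow_idealE H; apply/pow_idealE => m hm.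
  have <- : mcoeff (mnm_add (mnm_muln (mnm1 i) N) m) (g i * p) = mcoeff m p.
    by rewrite gE mulrC mcoeffMX.
  apply: H => k ki; rewrite mnmDE mulmnE mnm1E eq_sym -val_eqE ltn_eqF//= mul0n add0n.
  exact: hm.
(* The quotient collects the monomials of [p] divisible by [X_i ^ N]; those left over lie in the
   smaller ideal. *)
have split (i : 'I_n) p : pow_ideal N i.+1 p -> exists q, pow_ideal N i (p - g i * q).
  move=> H; exists (\sum_(m <- msupp p | (N <= m i)%N)
    mcoeff m p *: mpolyX C (mnm_sub m (mnm_muln (mnm1 i) N))).
  rewrite mulr_sumr {1}[p]mpolyE (bigID (fun m : multinom n => (N <= m i)%N))/=.
  rewrite (eq_bigr (fun m => g i * (mcoeff m p *: mpolyX C (mnm_sub m (mnm_muln (mnm1 i) N))))); last first.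
    move=> m Nm; rewrite gE -scalerAr -mpolyXD addmC submK//.
    apply/mnm_lepP => k; rewrite mulmnE mnm1E; case: eqP => [<-|]; rewrite ?mul1n ?mul0n//.
  rewrite addrC addrK => m /msupp_sum_le/flattenP[/= s /mapP[/= m']].
  rewrite mem_filter => /andP[Nm' mp ->] /msuppZ_le; rewrite msuppX inE => /eqP ->.
  have [k] := H _ mp; rewrite ltnS leq_eqVlt => /predU1P[/val_inj ->|ki Nk]; last by exists k.
  by rewrite (negbTE Nm').
have II j : [/\ pow_ideal N j 0, forall x y, pow_ideal N j x -> pow_ideal N j y -> pow_ideal N j (x + y) &
     forall a x, pow_ideal N j x -> pow_ideal N j (a * x)].
  split; first by move=> m; rewrite msupp0.
    by move=> x y hx hy m /msuppD_le; rewrite mem_cat => /orP[/hx|/hy].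
  move=> a x hx m /msuppM_le/allpairsP[[m1 m2] [/= _ /hx[i ij Ni] ->]].
  by exists i => //; rewrite mnmDE (leq_trans Ni)// leq_addl.
have mono j x : pow_ideal N j x -> pow_ideal N j.+1 x.
  by move=> hx m /hx[i ij Ni]; exists i => //; exact: ltnW.
have [e de he] : exists2 e : ext S n, ext_deg 2 e &
    ext_in (pow_ideal N 0) (ext_vec X' n - koszul v' e).
  apply: (@koszul_exact S n v' g (pow_ideal N) _ _ _ _ _ _ n) => //.
  - move=> j /lt_ord[i ->] m; rewrite gE msuppX inE => /eqP ->.
    by exists i => //; rewrite mulmnE mnm1E eqxx mul1n.
  - by move=> j x /lt_ord[i ->]; exact: split.
  - by move=> j x /lt_ord[i ->]; exact: reg.
  - move=> j /lt_ord[i ->]; have [s hs] := hv i; exists (ext_fun S s 0).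
    by rewrite /g ext_funE hs; apply: eq_bigr => k _; rewrite /v' !ext_funE.
  - exact: ext_deg_vec.
  rewrite koszul_vec (_ : \sum_(i < n) _ = 0); last first.
    by rewrite -[RHS]Xv; apply: eq_bigr => i _; rewrite /X' /v' !ext_funE.
  by rewrite ext_scal0; apply: ext_in0; have [] := II 0%N.
have eX : ext_vec X' n = koszul v' e.
  apply/eqP; rewrite -subr_eq0; apply/eqP; apply: ext_in_eq0 he => x h.
  apply/msuppnil0; move: h; rewrite /pow_ideal; case: (msupp x) => // m s h.
  by have [|i] := h m; rewrite ?inE ?eqxx ?ltn0.
have [A [anti diag]] := koszul_deg2 v' de; rewrite -eX => /ext_vec_inj XA.
exists (fun i j => A i j); split => [i j|i|i]; [exact: anti|exact: diag|].
have := XA i (ltn_ord i); rewrite /X' ext_funE => ->.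
by apply: eq_bigr => j _; rewrite /v' ext_funE.
Qed.

End SyzygiesOfHomogeneousParameters.

(** * A dimension count *)

Lemma card_bmultinom n k : (#|{: bmultinom n k}| <= k ^ n)%N.
Proof.
case: k => [|k].
  by rewrite (_ : #|_| = 0%N)//; apply: eq_card0 => -[m hm]; have := hm; rewrite ltn0.
have lt_k (m : bmultinom n k.+1) (i : 'I_n) : (bmnm m i < k.+1)%N.
  by apply: leq_ltn_trans (bmdeg m); rewrite mdegE (bigD1 i)//= leq_addr.
pose f (m : bmultinom n k.+1) := [ffun i => Ordinal (lt_k m i)].
have <- : #|{ffun 'I_n -> 'I_k.+1}| = (k.+1 ^ n)%N by rewrite card_ffun !card_ord.
apply: (leq_card f) => m m' /ffunP e; apply/val_inj/mnmP => i.
by have := e i; rewrite !ffunE => -[].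
Qed.

(* Let [x = c1 k1 + c2 k2] with new variables [c1], [c2], and [theta = x - v].  If [A v] and [h] had
   only the trivial common zero, all monomials in [z], [c1 mu], [c2 mu] would lie in the span of the
   [theta^m h^k z^p] with [p] bounded, because [A v = - A theta]: this is of the order of [T^(n+1)]
   elements, against [T^(n+2)] independent ones. *)
Section Counting.
Context (C : fieldType) (n : nat) (w : 'I_n -> nat) (w_gt0 : forall i, (0 < w i)%N).
Local Notation S := (mpoly n C).
Context (A : 'I_n -> 'I_n -> S) (v : 'I_n -> S) (h : S) (k1 k2 : 'I_n -> S).
Context (dv db : 'I_n -> nat) (dh : nat).
Hypothesis dv_gt0 : forall i, (0 < dv i)%N.
Hypothesis dh_gt0 : (0 < dh)%N.
Hypothesis v_homog : forall i, whomog w (dv i) (v i).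
Hypothesis h_homog : whomog w dh h.
Hypothesis A_homog : forall i j, if (dv j <= db i)%N then is_true (whomog w (db i - dv j) (A i j))
  else A i j = 0.
Hypothesis k1_ker : forall i, \sum_j A i j * k1 j = 0.
Hypothesis k2_ker : forall i, \sum_j A i j * k2 j = 0.
Context (a b : 'I_n).
Let mu := k1 a * k2 b - k1 b * k2 a.
Hypothesis mu_neq0 : mu != 0.
Let Av i := \sum_j A i j * v j.
Hypothesis nilp : forall k, exists M (s : 'I_n -> S) (s' : S),
  mX k ^+ M = \sum_i s i * Av i + s' * h.

Context (E : comNzRingType) (iota : {rmorphism S -> E}) (c1 c2 : E).
Hypothesis c_indep : forall q (F : 'I_q -> 'I_q -> S),
  \sum_i \sum_j iota (F i j) * c1 ^+ i * c2 ^+ j = 0 -> forall i j, F i j = 0.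

Let x i : E := c1 * iota (k1 i) + c2 * iota (k2 i).
Let theta i := x i - iota (v i).

Let iotaD p q : iota (p + q) = iota p + iota q. Proof. exact: rmorphD. Qed.
Let iotaM p q : iota (p * q) = iota p * iota q. Proof. exact: rmorphM. Qed.
Let iotaN p : iota (- p) = - iota p. Proof. exact: rmorphN. Qed.
Let iota0 : iota 0 = 0. Proof. exact: rmorph0. Qed.
Let iota_sum I (s : seq I) (P : pred I) (F : I -> S) :
  iota (\sum_(i <- s | P i) F i) = \sum_(i <- s | P i) iota (F i).
Proof. by rewrite (big_morph _ iotaD iota0). Qed.

Let Ax i : \sum_j iota (A i j) * x j = 0.
Proof.
transitivity (c1 * iota (\sum_j A i j * k1 j) + c2 * iota (\sum_j A i j * k2 j)).
  rewrite !iota_sum !mulr_sumr -big_split/=; apply: eq_bigr => j _.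
  by rewrite !iotaM /x; ring.
by rewrite k1_ker k2_ker iota0 !mulr0 addr0.
Qed.

Let iota_Av i : iota (Av i) = - \sum_j iota (A i j) * theta j.
Proof.
rewrite -[RHS]add0r -[X in _ = X - _](Ax i) -sumrB /Av iota_sum; apply: eq_bigr => j _.
by rewrite iotaM /theta; ring.
Qed.

Definition wle t (p : S) := forall m, m \in msupp p -> (wdeg w m <= t)%N.

Let wle_homog t p : whomog w t p -> wle t p.
Proof. by move=> /whomogP H m /H ->. Qed.

Let wleM s t p q : wle s p -> wle t q -> wle (s + t) (p * q).
Proof.
move=> hp hq m /msuppM_le/allpairsP[[m1 m2] /= [/hp h1 /hq h2 ->]].
by rewrite wdegD leq_add.
Qed.

(** Pigeonhole: a weight above [sum w_i M_i] forces [m i >= M i] for some [i], and the monomial is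
    then a multiple of [X_i ^ M i]. *)
Let homog_expr : exists T0, forall m : multinom n, (T0 <= wdeg w m)%N ->
  exists (s : 'I_n -> S) (s' : S), mpolyX C m = \sum_i s i * Av i + s' * h.
Proof.
have /choice[M hM] := nilp.
exists (\sum_i w i * M i).+1 => m hm.
have [i Mi] : exists i, (M i <= m i)%N.
  apply/existsP; apply: contraTT hm => /existsPn H; rewrite -leqNgt.
  by apply: leq_sum => i _; rewrite leq_mul2l ltnW ?orbT// ltnNge; exact: H.
have [s [s' e]] := hM i.
have mE : mpolyX C m = mpolyX C (mnm_sub m (mnm_muln (mnm1 i) (M i))) * mX i ^+ M i.
  rewrite mpolyXn -mpolyXD submK//; apply/mnm_lepP => k.
  by rewrite mulmnE mnm1E; case: eqP => [<-|]; rewrite ?mul1n ?mul0n.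
set q := mpolyX _ (mnm_sub _ _) in mE.
exists (fun k => q * s k), (q * s'); rewrite mE e mulrDr mulr_sumr mulrA; congr (_ + _).
by apply: eq_bigr => k _; rewrite mulrA.
Qed.

Let Av_homog i : whomog w (db i) (Av i).
Proof.
apply: whomog_sum => j _; have := A_homog i j; case: ifP => [ij hA|_ ->].
  by have := whomogM hA (v_homog j); rewrite subnK.
by rewrite mul0r; exact: whomog0.
Qed.

Section Span.
Context (T0 : nat) (hT0 : forall m : multinom n, (T0 <= wdeg w m)%N ->
  exists (s : 'I_n -> S) (s' : S), mpolyX C m = \sum_i s i * Av i + s' * h).

(** The products [theta^m h^k z^p] with [p] of weight below [T0], filtered by weight: [theta i]
    counts [dv i] and [h] counts [dh]. The filtration is what turns a spanning statement into a
    bound on dimension. *)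
Inductive span : nat -> E -> Prop :=
| span0 t : span t 0
| spanD t e e' : span t e -> span t e' -> span t (e + e')
| span_base t p : (forall m, m \in msupp p -> (wdeg w m < T0)%N) -> wle t p -> span t (iota p)
| span_theta t i e : span t e -> span (t + dv i) (theta i * e)
| span_h t e : span t e -> span (t + dh) (iota h * e)
| spanW t t' e : (t <= t')%N -> span t e -> span t' e.

Let span_sum t I (s : seq I) (P : pred I) (F : I -> E) :
  (forall i, P i -> span t (F i)) -> span t (\sum_(i <- s | P i) F i).
Proof.
move=> H; elim/big_rec : _ => [|i y Pi hy]; first exact: span0.
by apply: spanD => //; exact: H.
Qed.

(** Induction on the weight. A monomial of weight at least [T0] is a combination of the [Av i] and
    [h]; under [iota] each [Av i] becomes a combination of the [theta j], and the positive weights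
    of [theta j] and [h] leave cofactors of smaller weight. *)
Let span_iota t p : wle t p -> span t (iota p).
Proof.
elim/ltn_ind: t p => t IH p hp.
rewrite [p]mpolyE iota_sum big_seq; apply: span_sum => m mp.
have mt := hp m mp; move: (mcoeff m p) => c.
have [mT|Tm] := ltnP (wdeg w m) T0.
  by apply: span_base => m' /msuppZ_le; rewrite msuppX inE => /eqP ->.
have [s [s' e]] := hT0 Tm.
pose g (k : option 'I_n) := if k is Some i then Av i else h.
pose D (k : option 'I_n) := if k is Some i then db i else dh.
pose S' (k : option 'I_n) := if k is Some i then s i else s'.
have gD k : whomog w (D k) (g k) by case: k => [i|] /=; [exact: Av_homog|exact: h_homog].
have {}e : mpolyX C m = \sum_k S' k * g k.
  rewrite e (bigD1 None)//= addrC; congr (_ + _).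
  rewrite (reindex_onto Some (fun k => odflt a k))/=; last by case.
  by apply: eq_big => // i; rewrite eqxx.
have := homog_cofactors gD (whomogX C w m) e.
set f := fun k => if (D k <= wdeg w m)%N then wcomp w (wdeg w m - D k) (S' k) else 0.
move=> {}e.
have fh k : if (D k <= wdeg w m)%N then is_true (whomog w (wdeg w m - D k) (f k)) else f k = 0.
  by rewrite /f; case: (D k <= wdeg w m)%N => //; exact: wcomp_homog.
have -> : iota (c *: mpolyX C m) = \sum_j theta j * iota (- (c *: \sum_i f (Some i) * A i j))
    + iota h * iota (c *: f None).
  rewrite {1}e (bigD1 None)//= addrC -mul_mpolyC mulrDr iotaD; congr (_ + _); last first.
    by rewrite -mul_mpolyC !iotaM; ring.
  rewrite (reindex_onto Some (fun k => odflt a k))/=; last by case.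
  rewrite (eq_bigl predT); last by move=> i; rewrite eqxx.
  under [RHS]eq_bigr => j _ do rewrite -mul_mpolyC iotaN iotaM iota_sum mulrN !mulr_sumr.
  rewrite sumrN exchange_big/= mulr_sumr iota_sum -sumrN; apply: eq_bigr => i _.
  rewrite !iotaM iota_Av mulrN mulrN; congr (- _); rewrite !mulr_sumr.
  by apply: eq_bigr => j _; rewrite iotaM; ring.
apply: spanD.
  apply: span_sum => j _.
  set r := - _.
  have hr : if (dv j <= wdeg w m)%N then is_true (whomog w (wdeg w m - dv j) r) else r = 0.
    have H i : if (dv j <= wdeg w m)%N then is_true (whomog w (wdeg w m - dv j) (f (Some i) * A i j))
       else f (Some i) * A i j = 0.
      have [A0|A0] := eqVneq (A i j) 0; first by rewrite A0 mulr0 whomog0; case: ifP.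
      have [f0|f0] := eqVneq (f (Some i)) 0; first by rewrite f0 mul0r whomog0; case: ifP.
      have := A_homog i j; case: leqP => [h1 hA|_ e0]; last by rewrite e0 eqxx in A0.
      have := fh (Some i); rewrite /=; case: leqP => [h2 hf|_ e0]; last by rewrite e0 eqxx in f0.
      have := whomogM hf hA; rewrite (leq_trans h1 h2).
      by rewrite (_ : (_ - _ + _)%N = (wdeg w m - dv j)%N)//; lia.
    move: H; rewrite /r; case: ifP => h1 H.
      by apply/whomogN/whomogZ/whomog_sum.
    by rewrite big1 ?scaler0 ?oppr0.
  move: hr; case: ifP => [h1 hr|_ ->]; last by rewrite iota0 mulr0; exact: span0.
  apply: (@spanW (wdeg w m - dv j + dv j)); first by rewrite subnK.
  apply: span_theta; apply: IH; last exact: wle_homog.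
  by rewrite (leq_trans _ mt)// -{2}(subnK h1) -addn1 leq_add2l.
have := fh None => /=; case: ifP => [h1 hr|_ ->]; last first.
  by rewrite scaler0 iota0 mulr0; exact: span0.
apply: (@spanW (wdeg w m - dh + dh)); first by rewrite subnK.
apply: span_h; apply: IH; last by apply: wle_homog; exact: whomogZ.
by rewrite (leq_trans _ mt)// -{2}(subnK h1) -addn1 leq_add2l.
Qed.

Let span_mul s t p e : wle s p -> span t e -> span (s + t) (iota p * e).
Proof.
move=> hp; elim => {t e} [t|t e e' _ IH _ IH'|t q _ hq|t i e _ IH|t e _ IH|t t' e tt' _ IH].
- by rewrite mulr0; exact: span0.
- by rewrite mulrDr; exact: spanD.
- by rewrite -iotaM; apply: span_iota; exact: wleM.
- by rewrite mulrCA addnA; exact: span_theta.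
- by rewrite mulrCA addnA; exact: span_h.
- by apply: spanW IH; rewrite leq_add2l.
Qed.

Let span_x t i e : span t e -> span (t + dv i) (x i * e).
Proof.
move=> he; rewrite (_ : x i = theta i + iota (v i)); last by rewrite /theta subrK.
rewrite mulrDl; apply: spanD; first exact: span_theta.
by rewrite addnC; apply: span_mul => //; exact: wle_homog.
Qed.

Let y1 : E := c1 * iota mu.
Let y2 : E := c2 * iota mu.

(** Cramer's rule in the rows [a] and [b]: [mu c1] and [mu c2] are combinations of [x a] and [x b]
    with entries of [k1] and [k2] as coefficients. The loss [D] is independent of [t]. *)
Let span_y : exists D, forall t e, span t e ->
  span (t + D) (y1 * e) /\ span (t + D) (y2 * e).
Proof.
have [B hB] : exists B, [/\ wle B (k1 a), wle B (k1 b), wle B (k2 a) & wle B (k2 b)].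
  have wle_ex p : exists B, wle B p.
    exists (\max_(m <- msupp p) wdeg w m)%N => m mp.
    by rewrite (bigD1_seq m)//= ?msupp_uniq// leq_maxl.
  have wleS B B' p : (B <= B')%N -> wle B p -> wle B' p.
    by move=> BB hB m /hB h1; exact: leq_trans h1 BB.
  have [B1 h1] := wle_ex (k1 a); have [B2 h2] := wle_ex (k1 b).
  have [B3 h3] := wle_ex (k2 a); have [B4 h4] := wle_ex (k2 b).
  by exists (B1 + B2 + B3 + B4)%N; split; [apply: wleS h1|apply: wleS h2|apply: wleS h3|apply: wleS h4]; lia.
have [Ba Bb Ca Cb] := hB.
exists (B + dv a + dv b)%N => t e he.
have wleN p : wle B p -> wle B (- p) by move=> H m; rewrite (perm_mem (msuppN p)); exact: H.
split.
  have -> : y1 * e = iota (k2 b) * (x a * e) + iota (- k2 a) * (x b * e).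
    by rewrite /y1 /mu /x iotaD iotaN !iotaM iotaN; ring.
  apply: spanD.
    by apply: spanW (span_mul Cb (span_x a he)); lia.
  by apply: spanW (span_mul (wleN _ Ca) (span_x b he)); lia.
have -> : y2 * e = iota (k1 a) * (x b * e) + iota (- k1 b) * (x a * e).
  by rewrite /y2 /mu /x iotaD iotaN !iotaM iotaN; ring.
apply: spanD.
  by apply: spanW (span_mul Ba (span_x b he)); lia.
by apply: spanW (span_mul (wleN _ Bb) (span_x a he)); lia.
Qed.

Let gen (k : 'I_n.+1) : E := if unlift ord0 k is Some i then theta i else iota h.
Let cst : {rmorphism C -> E} := iota \o @mpolyC n C.
Let ev (q : mpoly n.+1 C) : E := mmap cst gen q.

(** All of [dv i] and [dh] are at least one, so the filtration index bounds the ordinary degree in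
    the [n + 1] elements [gen], while the monomials [z^r] come from a fixed finite set. *)
Let span_repr t e : span t e -> exists Q : bmultinom n T0 -> mpoly n.+1 C,
  (forall r, (msize (Q r) <= t.+1)%N) /\ e = \sum_r ev (Q r) * iota (mpolyX C (bmnm r)).
Proof.
have mulX t' k (Q : bmultinom n T0 -> mpoly n.+1 C) d : (0 < d)%N ->
    (forall r, (msize (Q r) <= t'.+1)%N) ->
    (forall r, (msize (Q r * mX k) <= (t' + d).+1)%N) /\
    gen k * \sum_r ev (Q r) * iota (mpolyX C (bmnm r)) =
    \sum_r ev (Q r * mX k) * iota (mpolyX C (bmnm r)).
  move=> d0 hQ; split=> [r|].
    have [->|Q0] := eqVneq (Q r) 0; first by rewrite mul0r msize0.
    rewrite msizeM//; last by rewrite -msize_poly_eq0 msizeX.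
    by rewrite msizeX mdeg1 addn2/= ltnS (leq_trans (hQ r))// -addn1 leq_add2l.
  rewrite mulr_sumr; apply: eq_bigr => r _.
  by rewrite /ev rmorphM/= mmapX mmap1U; ring.
elim => {t e} [t|t e e' _ [Q [hQ ->]] _ [Q' [hQ' ->]]|t p pT pt|t i e _ [Q [hQ ->]]|t e _ [Q [hQ ->]]|t t' e tt' _ [Q [hQ ->]]].
- exists (fun=> 0); split=> [r|]; first by rewrite msize0.
  by rewrite big1// => r _; rewrite /ev mmap0 mul0r.
- exists (fun r => Q r + Q' r); split=> [r|].
    by rewrite (leq_trans (msizeD_le _ _))// geq_max hQ hQ'.
  rewrite -big_split/=; apply: eq_bigr => r _.
  by rewrite /ev mmapD mulrDl.
- exists (fun r => mpolyC _ (mcoeff (bmnm r) p)); split=> [r|].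
    by rewrite msizeC; case: (_ == _).
  have hp : (msize p <= T0)%N.
    rewrite msizeE big_seq; elim/big_rec : _ => // m i mp hi.
    rewrite geq_max hi andbT (leq_ltn_trans _ (pT m mp))// mdegE.
    by apply: leq_sum => j _; rewrite leq_pmull.
  rewrite {1}(mpolywE hp) iota_sum; apply: eq_bigr => r _.
  by rewrite /ev mmapC -mul_mpolyC iotaM.
- exists (fun r => Q r * mX (lift ord0 i)).
  have [h1 h2] := mulX t (lift ord0 i) Q (dv i) (dv_gt0 i) hQ.
  by split => //; rewrite -h2 /gen liftK.
- exists (fun r => Q r * mX ord0).
  have [h1 h2] := mulX t ord0 Q dh dh_gt0 hQ.
  by split => //; rewrite -h2 /gen unlift_none.
- by exists Q; split => // r; rewrite (leq_trans (hQ r)).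
Qed.

(** The products of a monomial in [z] with powers of [y1] and [y2], all [n + 2] exponents below [q],
    number [q ^ n.+2]. They lie in filtration degree [q W], whose dimension is at most a constant
    times [q ^ n.+1]. *)
Lemma counting_contradiction : False.
Proof.
have [D hD] := span_y.
pose W := (\sum_i w i + D + D)%N.
pose K0 := #|{: bmultinom n T0}|.
(* One more than the constant in front of [q ^ n.+1], so that [q ^ n.+2] wins. *)
pose q := (K0 * W.+1 ^ n.+1).+1.
pose t := (q * W)%N.
pose J := ({ffun 'I_n -> 'I_q} * ('I_q * 'I_q))%type.
pose mon (f : {ffun 'I_n -> 'I_q}) : multinom n := Multinom [tuple nat_of_ord (f i) | i < n].
have monE f i : mon f i = f i by rewrite multinomE tnth_mktuple.
pose u (j : J) : E := iota (mpolyX C (mon j.1)) * (y1 ^+ j.2.1 * y2 ^+ j.2.2).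
have span_u j : span t (u j).
  have s1 : span 0 1.
    by rewrite (_ : 1 = iota 1); [apply: span_iota => m; rewrite msupp1 inE => /eqP ->; rewrite wdeg0|rewrite rmorph1].
  have s2 c : span (c * D) (y2 ^+ c).
    elim: c => [|c IH]; first by rewrite expr0.
    by rewrite exprS mulSn addnC; have [] := hD _ _ IH.
  have s3 c c' : span (c * D + c' * D) (y1 ^+ c * y2 ^+ c').
    elim: c => [|c IH]; first by rewrite expr0 mul1r add0n.
    by rewrite exprS -mulrA mulSn -addnA addnC; have [] := hD _ _ IH.
  have s4 := span_mul (wle_homog (whomogX C w (mon j.1))) (s3 j.2.1 j.2.2).
  apply: spanW s4; rewrite /t /W !mulnDr -addnA; apply: leq_add; last first.
    by apply: leq_add; rewrite leq_mul2r ltnW ?orbT.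
  rewrite /wdeg big_distrr/=; apply: leq_sum => i _.
  by rewrite monE mulnC leq_mul2r ltnW ?orbT.
have /choice[Q hQ] := fun j => span_repr (span_u j).
have card_lt : (#|{: bmultinom n T0 * bmultinom n.+1 t.+1}| < #|{: J}|)%N.
  have -> : #|{: J}| = (q ^ n.+2)%N by rewrite !card_prod card_ffun !card_ord !expnSr mulnA.
  rewrite card_prod.
  apply: (@leq_ltn_trans (K0 * (q * W.+1) ^ n.+1)).
    rewrite leq_mul2l (leq_trans (card_bmultinom _ _)) ?orbT//.
    by rewrite leq_exp2r// /t mulnS addnC -addn1 leq_add2l.
  rewrite expnMn mulnCA [(q ^ n.+2)%N]expnSr ltn_mul2l expn_gt0/=.
  by rewrite /q ltnS.
have [l [[j0 lj0] hl]] := linear_dependence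
  (fun (j : J) (r : bmultinom n T0 * bmultinom n.+1 t.+1) => mcoeff (bmnm r.2) (Q j r.1)) card_lt.
have lu : \sum_j cst (l j) * u j = 0.
  under eq_bigr => j _ do rewrite (hQ j).2 mulr_sumr.
  rewrite exchange_big/= big1// => r _.
  have lQ : \sum_j l j *: Q j r = 0.
    apply/mpolyP => m; rewrite mcoeff0 raddf_sum/=.
    have [mt|tm] := ltnP (mdeg m) t.+1.
      rewrite -[RHS](hl (r, BMultinom mt)); apply: eq_bigr => j _.
      by rewrite mcoeffZ.
    rewrite big1// => j _; rewrite mcoeffZ memN_msupp_eq0 ?mulr0//.
    by apply: msize_mdeg_ge; rewrite (leq_trans ((hQ j).1 r)).
  transitivity (ev (\sum_j l j *: Q j r) * iota (mpolyX C (bmnm r))).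
    rewrite /ev raddf_sum/= mulr_suml; apply: eq_bigr => j _.
    by rewrite mmapZ mulrA.
  by rewrite lQ /ev mmap0 mul0r.
have uE j : cst (l j) * u j =
    iota (l j *: mpolyX C (mon j.1) * mu ^+ (j.2.1 + j.2.2)) * c1 ^+ j.2.1 * c2 ^+ j.2.2.
  rewrite /u /y1 /y2 -mul_mpolyC /cst/= !exprMn exprD !iotaM !rmorphXn/=.
  by rewrite mulrACA -!mulrA; congr (_ * (_ * _)); rewrite mulrA [LHS]mulrC !mulrA.
pose F (c c' : 'I_q) := \sum_(f : {ffun 'I_n -> 'I_q})
  l (f, (c, c')) *: mpolyX C (mon f) * mu ^+ (c + c').
(* Independence of [c1] and [c2] splits the relation by the exponents of [y1] and [y2]; cancelling
   the power of [mu] leaves a linear relation between distinct monomials. *)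
have /c_indep/(_ j0.2.1 j0.2.2) : \sum_c \sum_c' iota (F c c') * c1 ^+ c * c2 ^+ c' = 0.
  have luE : \sum_f \sum_cc cst (l (f, cc)) * u (f, cc) = 0.
    by rewrite pair_bigA -[RHS]lu; apply: eq_bigr => -[].
  rewrite -[RHS]luE pair_bigA/= exchange_big/=.
  apply: eq_bigr => -[c c'] _ /=; rewrite /F iota_sum !mulr_suml.
  by apply: eq_bigr => f _; rewrite uE.
rewrite /F -surjective_pairing -mulr_suml.
move/eqP; rewrite mulf_eq0 expf_eq0 (negbTE mu_neq0) andbF orbF => /eqP/mpolyP/(_ (mon j0.1)).
rewrite mcoeff0 raddf_sum/= (bigD1 j0.1)//= mcoeffZ mcoeffX eqxx mulr1 big1.
  by rewrite addr0 -surjective_pairing => e0; rewrite e0 eqxx in lj0.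
move=> f fj; rewrite mcoeffZ mcoeffX; case: eqVneq; last by rewrite mulr0.
move=> /mnmP e'; case/eqP: fj; apply/ffunP => i; apply: val_inj.
by have := e' i; rewrite !monE.
Qed.

End Span.

Lemma counting_indep : False.
Proof. by have [T0 hT0] := homog_expr; exact: counting_contradiction hT0. Qed.

End Counting.

Theorem infinite_zero_locus (C : fieldType) (n : nat) (w : 'I_n -> nat)
    (A : 'I_n -> 'I_n -> mpoly n C) (v k1 k2 : 'I_n -> mpoly n C) (h : mpoly n C)
    (dv db : 'I_n -> nat) (dh : nat) (a b : 'I_n) :
  (forall i, (0 < w i)%N) -> (forall i, (0 < dv i)%N) -> (0 < dh)%N ->
  (forall i, whomog w (dv i) (v i)) -> whomog w dh h ->
  (forall i j, if (dv j <= db i)%N then is_true (whomog w (db i - dv j) (A i j))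
    else A i j = 0) ->
  (forall i, \sum_j A i j * k1 j = 0) -> (forall i, \sum_j A i j * k2 j = 0) ->
  k1 a * k2 b - k1 b * k2 a != 0 ->
  ~ forall k, exists M (s : 'I_n -> mpoly n C) (s' : mpoly n C),
    mX k ^+ M = \sum_i s i * (\sum_j A i j * v j) + s' * h.
Proof.
move=> w0 dv0 dh0 hv hh hA hk1 hk2 mu0 nil.
pose iota : {rmorphism mpoly n C -> {poly {poly mpoly n C}}} := polyC \o polyC.
apply: (@counting_indep C n w w0 A v h k1 k2 dv db dh dv0 dh0 hv hh hA hk1 hk2 a b mu0 nil
  {poly {poly mpoly n C}} iota 'X 'X%:P) => q F e i j.
have : (\sum_i \sum_j iota (F i j) * 'X ^+ i * 'X%:P ^+ j)`_i`_j = 0 by rewrite e !coef0.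
rewrite !coef_sum (bigD1 i)//= !coef_sum (bigD1 j)//=.
have E i' j' : (iota (F i' j') * 'X^i' * 'X%:P ^+ j')`_i`_j =
    F i' j' *+ (nat_of_ord j == j') *+ (nat_of_ord i == i').
  rewrite mulrAC -polyC_exp/= -polyCM coefCM coefXn mulr_natr coefMn.
  by rewrite coefCM coefXn mulr_natr.
rewrite E !eqxx !mulr1n !big1 ?addr0//.
  move=> i' ii'; rewrite !coef_sum big1// => j' _.
  by rewrite E !val_eqE [i == _]eq_sym (negbTE ii') mulr0n.
by move=> j' jj'; rewrite E !val_eqE [j == _]eq_sym (negbTE jj') mulr0n mul0rn.
Qed.

(** * Kernels of antisymmetric matrices *)

Lemma fraction_repr (S : idomainType) (x : {fraction S}) :
  exists a b : S, b != 0 /\ x = FracField.tofrac a / FracField.tofrac b.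
Proof.
elim/quotW: x => r; exists (frac r).1, (frac r).2.
have d0 := denom_ratioP r; split => //.
apply: (canRL (mulfK _)); first by rewrite tofrac_eq0.
unlock FracField.tofrac; rewrite -[LHS]FracField.pi_mul.
apply/eqmodP; rewrite /= FracField.equivfE /FracField.mulf.
by rewrite !numden_Ratio ?mulf_neq0 ?oner_neq0// !mulr1 mulrC.
Qed.

Lemma clear_denominators (S : idomainType) (I : finType) (x : I -> {fraction S}) :
  exists (d : S) (y : I -> S), d != 0 /\ forall i, FracField.tofrac (y i) = FracField.tofrac d * x i.
Proof.
have /choice[f hf] : forall i, exists ab : S * S,
    ab.2 != 0 /\ x i = FracField.tofrac ab.1 / FracField.tofrac ab.2.
  by move=> i; have [a [b [b0 e]]] := fraction_repr (x i); exists (a, b).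
exists (\prod_i (f i).2), (fun i => (f i).1 * \prod_(j | j != i) (f j).2); split.
  by apply/prodf_neq0 => i _; have [] := hf i.
move=> i; have [b0 ->] := hf i; rewrite (bigD1 i (P := predT))// !tofracM.
have {}b0 : FracField.tofrac (f i).2 != 0 by rewrite tofrac_eq0.
by rewrite mulrAC mulrCA divff// mulr1.
Qed.

Section AntisymmetricRank.
Context (K : fieldType) (N : nat) (A : 'M[K]_N).
Hypothesis A_antisym : A^T = - A.

(** By antisymmetry the columns with the indices of a row basis span the column space, so passing to
    those rows and then to those columns loses no rank. *)
Lemma principal_minor_unit : mxsub (maxrankfun A) (maxrankfun A) A \in unitmx.
Proof.
set f := maxrankfun A.
have /submxP[X eX] : (A <= rowsub f A)%MS by rewrite (eq_maxrowsub A).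
have e : rowsub f A = mxsub f f A *m X^T.
  have -> : mxsub f f A = rowsub f (colsub f A) by apply/matrixP => i j; rewrite !mxE.
  rewrite mul_rowsub_mx (_ : colsub f A *m X^T = A)//.
  have -> : colsub f A = - (rowsub f A)^T.
    apply/matrixP => i j; rewrite !mxE; have /matrixP/(_ (f j) i) := A_antisym.
    by rewrite !mxE.
  by rewrite mulNmx -trmx_mul -eX A_antisym opprK.
have : row_free (mxsub f f A).
  rewrite /row_free eqn_leq rank_leq_row/=.
  have /eqP rk := maxrowsub_free A.
  by apply: (@leq_trans (\rank (rowsub f A))); [rewrite rk|rewrite e mxrankM_maxl].
by rewrite row_free_unit.
Qed.

Hypothesis char2 : (2 : K) != 0.

(** An antisymmetric matrix of odd size has determinant equal to its own negative; this is applied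
    to the invertible principal minor. *)
Lemma antisym_rank_even : ~~ odd (\rank A).
Proof.
have := principal_minor_unit; set f := maxrankfun A; rewrite unitmxE unitfE.
apply: contra => odd_r.
have e : \det (mxsub f f A) = - \det (mxsub f f A).
  rewrite -{1}det_tr -[RHS]mulN1r.
  have <- : (-1) ^+ \rank A = -1 :> K by rewrite -signr_odd odd_r expr1.
  rewrite -detZ; congr (\det _); apply/matrixP => i j; rewrite !mxE mulN1r.
  by have /matrixP/(_ (f i) (f j)) := A_antisym; rewrite !mxE.
have : 2 * \det (mxsub f f A) = 0 by rewrite mulr_natl mulr2n {1}e addNr.
by move/eqP; rewrite mulf_eq0 (negbTE char2).
Qed.

(* A nonzero term of the Leibniz expansion of a principal minor of size [\rank A] uses each row
   weight and each column weight at most once. *)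
Lemma weighted_rank_bound (w : 'I_N -> nat) (e : nat) :
  (forall i j, A i j != 0 -> (e <= w i + w j)%N) -> (\rank A * e <= 2 * \sum_i w i)%N.
Proof.
move=> hA; have := principal_minor_unit; set f := maxrankfun A; rewrite unitmxE unitfE.
have sum_f : (\sum_i w (f i) <= \sum_i w i)%N.
  rewrite -(big_imset w (A := predT) (h := f))/=; last by move=> i j _ _; exact: maxrankfun_inj.
  by rewrite [leqRHS](bigID (mem (f @: predT)))/= leq_addr.
have [//|lt] := leqP (\rank A * e) (2 * \sum_i w i); rewrite /determinant big1 ?eqxx// => s _.
have [i /eqP h0] : exists i, mxsub f f A i (s i) == 0.
  apply/existsP; apply: contraLR lt => /existsPn H; rewrite -leqNgt.
  apply: (@leq_trans (\sum_(i < \rank A) (w (f i) + w (f (s i))))).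
    rewrite -{1}(card_ord (\rank A)) -sum_nat_const; apply: leq_sum => i _.
    by apply: hA; have := H i; rewrite !mxE.
  rewrite big_split/= mul2n -addnn leq_add//.
  by rewrite (reindex_inj (@perm_inj _ s^-1%g))/= (eq_bigr (fun i => w (f i)))// => i _; rewrite permKV.
by rewrite (bigD1 i)//= h0 mul0r mulr0.
Qed.

End AntisymmetricRank.

(** The rank is taken over the fraction field. The inequality puts it below [n + 1] for odd [n],
    where parity also excludes [n], and below [n] for even [n]. So the kernel has dimension at least
    two, and clearing denominators brings two independent vectors back to [S]. *)
Lemma antisym_kernel (S : idomainType) (n : nat) (w : 'I_n.+1 -> nat) (e : nat)
    (A : 'I_n.+1 -> 'I_n.+1 -> S) :
  (2 : S) != 0 -> (forall i j, A i j = - A j i) ->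
  (forall i j, A i j != 0 -> (e <= w i + w j)%N) ->
  (2 * \sum_i w i < (if odd n then n.+1 else n) * e)%N ->
  exists (k1 k2 : 'I_n.+1 -> S) (a b : 'I_n.+1),
    [/\ forall i, \sum_j A i j * k1 j = 0, forall i, \sum_j A i j * k2 j = 0 &
      k1 a * k2 b - k1 b * k2 a != 0].
Proof.
move=> S2 antisym hA lt.
pose tof := @FracField.tofrac S.
pose M : 'M[{fraction S}]_n.+1 := \matrix_(i, j) tof (A i j).
have M_antisym : M^T = - M.
  by apply/matrixP => i j; rewrite !mxE antisym /tof tofracN.
have F2 : (2 : {fraction S}) != 0.
  by rewrite -[2](rmorph_nat (@FracField.tofrac S)) tofrac_eq0.
have rk : (\rank M <= n.-1)%N.
  have ev := antisym_rank_even M_antisym F2.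
  have hM : forall i j, M i j != 0 -> (e <= w i + w j)%N.
    by move=> i j; rewrite mxE tofrac_eq0; exact: hA.
  have bound := weighted_rank_bound M_antisym hM.
  have le := rank_leq_row M.
  have : (\rank M < if odd n then n.+1 else n)%N.
    by have := leq_ltn_trans bound lt; rewrite ltn_mul2r => /andP[].
  move: ev le; move: (\rank M) => r ev le; case: ifP => on rn; last by lia.
  have : r != n by apply: contraNneq ev => ->.
  by lia.
have n0 : (0 < n)%N.
  by have := leq_ltn_trans (leq0n _) lt; case: (n).
have Bk : (1 < \rank (kermx M))%N by rewrite mxrank_ker; lia.
pose i0 := Ordinal (ltnW Bk); pose i1 := Ordinal Bk.
have [B Bfree Bker] : exists2 B : 'M[{fraction S}]_(\rank (kermx M), n.+1), row_free B &
    forall i, row i B *m M = 0.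
  exists (row_base (kermx M)) => [|i]; first exact: row_base_free.
  by apply/sub_kermxP; rewrite -(eq_row_base (kermx M)) row_sub.
have indep (c0 c1 : {fraction S}) : c0 *: row i0 B + c1 *: row i1 B = 0 -> c0 = 0 /\ c1 = 0.
  rewrite !rowE !scalemxAl -mulmxDl -[RHS](mul0mx _ B) => /(row_free_inj Bfree)/rowP e'.
  by have := e' i0; have := e' i1; rewrite !mxE /= !mulr0 !mulr1 addr0 add0r.
have [a ha] : exists a, B i0 a != 0.
  apply/existsP; apply: contraT => /existsPn H.
  have [] := indep 1 0; last by move/eqP; rewrite oner_eq0.
  rewrite scale0r addr0 scale1r; apply/rowP => j; rewrite !mxE.
  by have := H j; rewrite negbK => /eqP.
have [b hb] : exists b, B i0 a * B i1 b - B i0 b * B i1 a != 0.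
  apply/existsP; apply: contraT => /existsPn H.
  have [] := indep (- B i1 a) (B i0 a); last by move=> _ /eqP; rewrite (negbTE ha).
  apply/rowP => j; rewrite !mxE; have := H j; rewrite negbK => /eqP <-.
  by ring.
have [d1 [y1 [d10 hy1]]] := clear_denominators (B i0).
have [d2 [y2 [d20 hy2]]] := clear_denominators (B i1).
have ker (d : S) (y : 'I_n.+1 -> S) k : (forall i, tof (y i) = tof d * B k i) ->
    forall i, \sum_j A i j * y j = 0.
  move=> hy i; apply/eqP; rewrite -tofrac_eq0 rmorph_sum/=; apply/eqP.
  transitivity (- tof d * (row k B *m M) 0 i); last by rewrite Bker mxE mulr0.
  rewrite mxE mulr_sumr; apply: eq_bigr => j _.
  by rewrite tofracM -/tof hy antisym /tof tofracN !mxE; ring.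
exists y1, y2, a, b; split; [exact: ker hy1|exact: ker hy2|].
rewrite /tof in hy1 hy2; rewrite -tofrac_eq0 tofracB !tofracM !hy1 !hy2.
rewrite (_ : _ - _ = FracField.tofrac d1 * FracField.tofrac d2 * (B i0 a * B i1 b - B i0 b * B i1 a)); last by ring.
by rewrite !mulf_neq0// tofrac_eq0.
Qed.

(** * Evaluation of polynomials *)

Section NonVanishing.
Context (C : numFieldType) (n : nat).
Local Notation S := (mpoly n C).

Lemma poly_eq0_of_vanish (q : {poly C}) : (forall x, x != 0 -> q.[x] = 0) -> q = 0.
Proof.
move=> H; apply/eqP; apply: contraT => q0.
have := @max_poly_roots C q [seq k.+1%:R | k <- iota 0 (size q)] q0.
rewrite size_map size_iota ltnn; apply.
  by apply/allP => _ /mapP[k _ ->]; apply/rootP/H; rewrite pnatr_eq0.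
by rewrite map_inj_uniq ?iota_uniq// => i j /eqP; rewrite eqr_nat => /eqP[].
Qed.

Lemma meval_whomog (w : 'I_n -> nat) (l : C) (z : 'I_n -> C) t (q : S) :
  whomog w t q -> meval (fun i => l ^+ w i * z i) q = l ^+ t * meval z q.
Proof.
move=> /whomogP hq; rewrite !mevalE mulr_sumr big_seq [RHS]big_seq.
apply: eq_bigr => m mq; rewrite mulrCA; congr (_ * _).
rewrite -(hq m mq) /wdeg -prodrXr -big_split/=; apply: eq_bigr => i _.
by rewrite exprMn exprM.
Qed.

Lemma meval_wact (w : 'I_n -> nat) (l : C) (z : 'I_n -> C) (p : S) K :
  (mmeasure (wdeg w) p <= K)%N ->
  meval (fun i => l ^+ w i * z i) p = \sum_(t < K) l ^+ t * meval z (wcomp w t p).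
Proof.
move=> pK; rewrite {1}(wcomp_sum pK) raddf_sum/=; apply: eq_bigr => t _.
exact/meval_whomog/wcomp_homog.
Qed.

Lemma mcoeff_wcomp (w : 'I_n -> nat) t (p : S) m :
  mcoeff m (wcomp w t p) = if wdeg w m == t then mcoeff m p else 0.
Proof.
rewrite /wcomp pihomogE raddf_sum/= big_mkcond/= [in RHS](mpolyE p) raddf_sum/=.
case: ifP => wm.
  apply: eq_bigr => m' _; rewrite !mcoeffZ !mcoeffX; case: ifP => // wm'.
  by case: eqP => [e|]; rewrite ?mulr0//; rewrite e wm in wm'.
rewrite big1// => m' _; case: ifP => // wm'; rewrite mcoeffZ mcoeffX.
by case: eqP => [e|]; rewrite ?mulr0//; rewrite e wm in wm'.
Qed.

(** Along the orbit of [z] the value of [p] is a polynomial in [l] whose coefficients are the values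
    at [z] of the components; it vanishes for all nonzero [l]. *)
Lemma vanish_wcomp (w : 'I_n -> nat) (p : S) :
  (forall z : 'I_n -> C, (forall i, z i != 0) -> meval z p = 0) ->
  forall t z, (forall i, z i != 0) -> meval z (wcomp w t p) = 0.
Proof.
move=> H t z z0; pose K := maxn (mmeasure (wdeg w) p) t.+1.
pose Q := \poly_(s < K) meval z (wcomp w s p).
have tK : (t < K)%N by rewrite leq_max ltnSn orbT.
have -> : meval z (wcomp w t p) = Q`_t by rewrite coef_poly tK.
rewrite (_ : Q = 0) ?coef0//; apply: poly_eq0_of_vanish => l l0.
rewrite horner_poly; under eq_bigr => s _ do rewrite mulrC.
rewrite -meval_wact ?leq_maxl//; apply: H => i.
by rewrite mulf_neq0// expf_neq0.
Qed.

(** Weights concentrated on one variable at a time cut a vanishing [p] down, by [vanish_wcomp], to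
    its single term at an exponent [m], whose value at [(1, ..., 1)] is a nonzero coefficient. *)
Lemma mpoly_nonvanishing (p : S) : p != 0 ->
  exists z : 'I_n -> C, (forall i, z i != 0) /\ meval z p != 0.
Proof.
move=> p0; apply: contrapT => /forallNP H.
have {}H z : (forall i, z i != 0) -> meval z p = 0.
  by move=> z0; apply/eqP; apply: contraT => pz; case: (H z).
have [m mp] : exists m, mcoeff m p != 0.
  by exists (mlead p); rewrite mleadc_eq0.
have [q [qm qsupp Hq]] : exists q : S, [/\ mcoeff m q = mcoeff m p,
    forall m' : multinom n, m' \in msupp q -> forall i, i \in enum 'I_n -> m' i = m i &
    forall z, (forall i, z i != 0) -> meval z q = 0].
  elim: (enum 'I_n) => [|i s [q [qm qsupp Hq]]]; first by exists p.
  pose w (j : 'I_n) : nat := (j == i).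
  have wE m' : wdeg w m' = m' i.
    rewrite /wdeg (bigD1 i)//= /w eqxx mul1n big1 ?addn0// => j /negbTE ->.
    by rewrite mul0n.
  exists (wcomp w (m i) q); split; first by rewrite mcoeff_wcomp wE eqxx.
    move=> m'; rewrite mcoeff_msupp mcoeff_wcomp wE; case: (eqVneq (m' i) (m i)) => [e|_]; last by rewrite eqxx.
    rewrite -mcoeff_msupp => m'q j; rewrite inE => /orP[/eqP ->//|js].
    exact: qsupp.
  exact: vanish_wcomp.
have : meval (fun=> 1) q = 0 by apply: Hq => i; rewrite oner_neq0.
rewrite mevalE (bigD1_seq m)/=; last 2 first.
- by rewrite mcoeff_msupp qm.
- exact: msupp_uniq.
rewrite [X in _ + X]big1_seq; last first.
  move=> m' /andP[mm' m'q]; case/negP: mm'; apply/eqP/mnmP => i.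
  by apply: qsupp => //; rewrite mem_enum.
rewrite addr0 qm big1 ?mulr1; last by move=> i _; rewrite expr1n.
by move/eqP; rewrite (negbTE mp).
Qed.

End NonVanishing.

(** * Divisibility by the equation of a quasi-smooth hypersurface *)

Section Shift.
Context (C : numClosedFieldType) (n : nat).
Local Notation S := (mpoly n C).
Implicit Types (p q : S).

(* [p (X + t c)], as a polynomial in [t]. *)
Definition shift_dir (c : 'I_n -> C) : S -> {poly S} :=
  mmap (polyC \o @mpolyC n C) (fun i => (mX i)%:P + (mpolyC n (c i))%:P * 'X).

Definition translate (a : 'I_n -> C) : S -> S :=
  mmap (@mpolyC n C) (fun i => mX i + mpolyC n (a i)).

HB.instance Definition _ c := GRing.RMorphism.on (shift_dir c).
HB.instance Definition _ a := GRing.RMorphism.on (translate a).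

Lemma shift_dir_horner c p (t : C) :
  (shift_dir c p).[mpolyC n t] = translate (fun i => c i * t) p.
Proof.
rewrite [p]mpolyE !raddf_sum/= horner_sum; apply: eq_bigr => m _.
rewrite /shift_dir /translate !mmapZ !mmapX hornerM/= hornerC; congr (_ * _).
rewrite /mmap1 horner_prod; apply: eq_bigr => i _.
by rewrite horner_exp !hornerE mpolyCM.
Qed.

Lemma meval_translate a p z : meval z (translate a p) = meval (fun i => z i + a i) p.
Proof.
rewrite [p]mpolyE [translate _ _]raddf_sum/= raddf_sum [RHS]raddf_sum/=; apply: eq_bigr => m _.
rewrite /translate mmapZ mmapX mevalM mevalC mevalZ; congr (_ * _).
rewrite mevalX /mmap1 rmorph_prod/=; apply: eq_bigr => i _.
by rewrite rmorphXn/= mevalD mevalXU mevalC.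
Qed.

Lemma translate0 p : translate (fun=> 0) p = p.
Proof.
rewrite {1}(mpolyE p) raddf_sum/= [RHS]mpolyE; apply: eq_bigr => m _.
rewrite /translate mmapZ mmapX mul_mpolyC; congr (_ *: _).
rewrite mpolyXE_id /mmap1; apply: eq_bigr => i _.
by rewrite mpolyC0 addr0.
Qed.

Lemma mderiv_translate i a p : mderiv i (translate a p) = translate a (mderiv i p).
Proof.
have key q q' : mderiv i (translate a q) = translate a (mderiv i q) ->
    mderiv i (translate a q') = translate a (mderiv i q') ->
    mderiv i (translate a (q * q')) = translate a (mderiv i (q * q')).
  by move=> h h'; rewrite rmorphM/= !mderivM h h' rmorphD/= !rmorphM.
have key1 : mderiv i (translate a 1) = translate a (mderiv i 1).
  by rewrite rmorph1 -mpolyC1 mderivC raddf0.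
have keyX m : mderiv i (translate a (mpolyX C m)) = translate a (mderiv i (mpolyX C m)).
  rewrite mpolyXE_id; elim/big_rec : _ => // j q _ hq; apply: (key) => //.
  elim: (m j) => [|k IH]; first by rewrite expr0.
  rewrite exprS; apply: (key) => //.
  rewrite /translate mmapX mmap1U mderivD mderivC addr0 !mderivX mmapZ mmapX.
  rewrite mnm1E; case: eqP => [->|_]; last by rewrite mulr0n ?mpolyC0 ?scale0r ?mul0r ?raddf0.
  have -> : mnm_sub (mnm1 i) (mnm1 i) = @mnm0 n.
    by apply/mnmP => k'; rewrite mnmBE subnn mnm0E.
  by rewrite mmap11 mpolyX0 mulr1 -mul_mpolyC mulr1.
have keyZ c m : mderiv i (translate a (c *: mpolyX C m)) = translate a (mderiv i (c *: mpolyX C m)).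
  by rewrite -mul_mpolyC; apply: (key) => //; rewrite mderivC raddf0 /translate mmapC mderivC.
rewrite [p]mpolyE; elim/big_rec : _ => [|m q _ hq]; first by rewrite !raddf0.
by rewrite raddfD/= mderivD keyZ hq mderivD raddfD.
Qed.

Let top (d : nat) (P : {poly S}) (a : C) := (size P <= d.+1)%N /\ P`_d = mpolyC n a.

Let topM d e P Q a b : top d P a -> top e Q b -> top (d + e) (P * Q) (a * b).
Proof.
move=> [sP cP] [sQ cQ]; split.
  rewrite (leq_trans (size_polyMleq _ _))//.
  by move: sP sQ; lia.
rewrite coefM (bigD1 (inord d))//= inordK ?ltnS ?leq_addr// addKn cP cQ mpolyCM.
rewrite big1 ?addr0// => i id.
have {}id : i != d :> nat.
  by apply: contraNneq id => id; apply/eqP/val_inj; rewrite /= inordK ?ltnS ?leq_addr.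
have [di|] := ltnP d i; first by rewrite nth_default ?mul0r// (leq_trans sP).
move=> id'; rewrite [X in _ * X]nth_default ?mulr0//.
by rewrite (leq_trans sQ)//; move: id id'; lia.
Qed.

Let top_mono c m : top (mdeg m) (shift_dir c (mpolyX C m)) (\prod_i c i ^+ m i).
Proof.
rewrite /shift_dir mmapX /mmap1 mdegE.
elim/big_rec3 : _ => [|i a P d _ h]; first by split; rewrite ?size_poly1 ?coef1.
rewrite mulrC [c i ^+ _ * _]mulrC addnC; apply: topM => //.
elim: (m i) => [|k IH]; first by split; rewrite ?size_poly1 ?coef1.
rewrite !exprSr -addn1; apply: topM => //; split; last first.
  by rewrite coefD coefC/= add0r coefMX coefC.
rewrite (leq_trans (size_polyD _ _))// geq_max (leq_trans (size_polyC_leq1 _))//=.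
by rewrite (leq_trans (size_polyMleq _ _))// size_polyX addn2/= ltnS size_polyC_leq1.
Qed.

(** A direction at which the top homogeneous part of [p] does not vanish makes [p (X + t c)] monic
    in [t] up to a constant, as in Noether normalisation. *)
Lemma shift_dir_lead p : p != 0 -> exists (c : 'I_n -> C) (k : C),
  [/\ forall i, c i != 0, k != 0 & size (shift_dir c p) = msize p /\
    lead_coef (shift_dir c p) = mpolyC n k].
Proof.
move=> p0; pose D := (msize p).-1.
have pD : msize p = D.+1 by rewrite /D prednK// lt0n msize_poly_eq0.
pose q := wcomp (fun=> 1%N) D p.
have wm m : wdeg (fun=> 1%N) m = mdeg m :> nat.
  by rewrite /wdeg mdegE; apply: eq_bigr => i _; rewrite mul1n.
have q0 : q != 0.
  apply: contraNneq (p0) => q0.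
  rewrite -mleadc_eq0; have <- : mcoeff (mlead p) q = mcoeff (mlead p) p.
    by rewrite mcoeff_wcomp wm /D -mlead_deg //= eqxx.
  by rewrite q0 mcoeff0.
have [c [c0 qc]] := mpoly_nonvanishing q0.
have sP : top D (shift_dir c p) (meval c q).
  have -> : meval c q = \sum_(m <- msupp p) if mdeg m == D then mcoeff m p * \prod_i c i ^+ m i else 0.
    rewrite /q /wcomp pihomogE raddf_sum/= big_mkcond/=; apply: eq_bigr => m _.
    by rewrite wm; case: eqP => // _; rewrite mevalZ mevalX.
  rewrite {1}[p]mpolyE raddf_sum/= !big_seq.
  elim/big_rec2 : _ => [|m a P mp h]; first by split; rewrite ?size_poly0 ?coef0.
  have [s1 c1] := top_mono c m; have [s2 c2] := h.
  have md : (mdeg m <= D)%N by rewrite -ltnS -pD; exact: msize_mdeg_lt.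
  have E : shift_dir c (mcoeff m p *: mpolyX C m) = (mpolyC n (mcoeff m p))%:P * shift_dir c (mpolyX C m).
    by rewrite /shift_dir mmapZ.
  have sD : (size (shift_dir c (mcoeff m p *: mpolyX C m)) <= D.+1)%N.
    rewrite E mul_polyC (leq_trans (size_scale_leq _ _))// (leq_trans s1)//.
  split; first by rewrite (leq_trans (size_polyD _ _))// geq_max sD.
  rewrite coefD c2 mpolyCD; congr (_ + _); rewrite E coefCM.
  case: eqP => [<-|/eqP nD]; first by rewrite c1 mpolyCM.
  by rewrite nth_default ?mulr0 ?mpolyC0// (leq_trans s1)// ltn_neqAle nD.
have [sz cD] := sP.
have sz' : size (shift_dir c p) = D.+1.
  apply/eqP; rewrite eqn_leq sz ltnNge; apply/negP => /leq_sizeP/(_ D (leqnn _)).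
  by rewrite cD => /eqP; rewrite mpolyC_eq0 (negbTE qc).
exists c, (meval c q); split => //; split; first by rewrite sz' pD.
by rewrite /lead_coef sz' /= cD.
Qed.
End Shift.

Section Divide.
Context (C : numClosedFieldType) (n : nat).
Local Notation S := (mpoly n C).
Implicit Types (p q f u : S).


Lemma spec_shift_dir c p z t :
  (map_poly (meval z) (shift_dir c p)).[t] = meval (fun i => z i + c i * t) p.
Proof.
by rewrite -[X in _.[X]](mevalC z t) (horner_map (meval z)) shift_dir_horner/= meval_translate .
Qed.

(** A line in direction [c] through a point not proportional to [c] misses the origin, the only
    point where smoothness of the cone says nothing. *)
Lemma translate_neq0 (c z : 'I_n -> C) (i j : 'I_n) t :
  c j * z i - c i * z j != 0 -> exists k, z k + c k * t != 0.
Proof.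
move=> H; apply: contrapT => /forallNP H'.
have E k : z k = - (c k * t) by apply/eqP; rewrite -addr_eq0; apply/negPn/negP/H'.
by move/eqP: H; apply; rewrite (E i) (E j); ring.
Qed.

Lemma minor_neq0 (c : 'I_n -> C) (i0 i1 : 'I_n) : i0 != i1 -> (forall i, c i != 0) ->
  mpolyC n (c i1) * mX i0 - mpolyC n (c i0) * mX i1 != 0 :> S.
Proof.
move=> i01 c0; apply: contraNneq (c0 i1) => /(congr1 (mcoeff (mnm1 i0))).
rewrite mcoeff0 mcoeffB !mcoeffCM !mcoeffX eqxx mulr1.
have -> : (mnm1 i1 == mnm1 i0) = false.
  apply/negP => /eqP/(congr1 (fun m : multinom n => m i1)).
  by rewrite !mnm1E eqxx (negbTE i01).
by rewrite mulr0 subr0 => ->.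
Qed.

(** If a square [u ^ 2] divides [f (X + t c)], specialise [X] to a generic [z] and [t] to a root of
    the specialised [u]: there [f] vanishes together with its partial derivatives, against
    smoothness. *)
Lemma shift_dir_separable c f (i0 i1 : 'I_n) : i0 != i1 -> (forall i, c i != 0) ->
  f != 0 -> lead_coef (shift_dir c f) = 1 ->
  (forall z, (exists i, z i != 0) -> meval z f = 0 -> exists i, meval z (mderiv i f) != 0) ->
  separable_poly (shift_dir c f).
Proof.
move=> i01 c0 f0 Gm fsm; set G := shift_dir c f.
have G0 : G != 0 by rewrite -lead_coef_eq0 Gm oner_eq0.
have delta0 := minor_neq0 i01 c0.
apply/separable_polyP; split; last first.
  move=> u uG u1; have : (0 < (size u).-1)%N by move: u1; lia.
  move=> su; apply/eqP => u'0.
  have : u^`()`_(size u).-2 = 0 by rewrite u'0 coef0.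
  rewrite coef_deriv; have -> : (size u).-2.+1 = (size u).-1 by rewrite prednK.
  move=> /eqP; rewrite -mulr_natr mulf_eq0 -lead_coefE lead_coef_eq0.
  rewrite -size_poly_eq0; have -> : (size u == 0)%N = false by move: u1; lia.
  rewrite -mpolyC_nat mpolyC_eq0 pnatr_eq0; move: su; lia.
apply/poly_square_freeP => u u1; apply/negP => /Pdiv.Idomain.dvdpP[[a Q] /= a0 aG].
have u0 : u != 0.
  apply: contraNneq a0 => u0; move/eqP: aG.
  by rewrite u0 expr0n/= mulr0 -mul_polyC mulf_eq0 polyC_eq0 (negbTE G0) orbF.
have lu0 : lead_coef u != 0 by rewrite lead_coef_eq0.
(* This [z] keeps the degree of [u], does not kill the scalar [a] of the pseudo-divisibility, and is
   not proportional to [c]. *)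
have [z [_ zP]] := mpoly_nonvanishing (mulf_neq0 (mulf_neq0 a0 lu0) delta0).
move: zP; rewrite !mevalM !mulf_eq0 !negb_or => /andP[/andP[az uz]].
rewrite mevalB !mevalM !mevalC !mevalXU => dz.
have su : size (map_poly (meval z) u) != 1%N by rewrite size_map_poly_id0.
have [t /rootP ut] := closed_rootP _ su.
pose T := translate (fun i => c i * t).
have E : a * T f = Q.[mpolyC n t] * (u.[mpolyC n t] * u.[mpolyC n t]).
  have := congr1 (fun P => P.[mpolyC n t]) aG.
  by rewrite hornerZ hornerM expr2 hornerM shift_dir_horner.
have ut0 : meval z u.[mpolyC n t] = 0 by rewrite -ut -(horner_map (meval z))/= mevalC.
have [k zk] := translate_neq0 t dz.
have fT p : meval z (T p) = meval (fun i => z i + c i * t) p by rewrite meval_translate.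
have fy : meval z (T f) = 0.
  have := congr1 (meval z) E; rewrite !mevalM ut0 !mulr0 => /eqP.
  by rewrite mulf_eq0 (negbTE az) => /eqP.
have [//||i] := fsm (fun i => z i + c i * t); first by exists k.
  by rewrite -fT.
have := congr1 (meval z \o mderiv i) E; rewrite /= !mderivM !(mevalD, mevalM) fy ut0.
rewrite !(mulr0, mul0r, addr0, add0r) mderiv_translate fT => /eqP.
by rewrite mulf_eq0 (negbTE az)/= => /eqP ->; rewrite eqxx.
Qed.

(** Divide by the monic polynomial [f (X + t c)] in [t]. The Bezout relation that certifies
    separability survives at a generic [z], where a nonzero remainder would have more roots than its
    degree allows. So the remainder is zero, and [t = 0] gives the quotient. *)
Lemma monic_division c f u (i0 i1 : 'I_n) : i0 != i1 -> (forall i, c i != 0) ->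
  f != 0 -> lead_coef (shift_dir c f) = 1 ->
  (forall z, (exists i, z i != 0) -> meval z f = 0 -> exists i, meval z (mderiv i f) != 0) ->
  (forall z, (exists i, z i != 0) -> meval z f = 0 -> meval z u = 0) ->
  exists q, u = q * f.
Proof.
move=> i01 c0 f0 Gm fsm fu.
have := shift_dir_separable i01 c0 f0 Gm fsm; rewrite unlock.
move: Gm; set G := shift_dir c f => Gm Gsep.
have GE : G = shift_dir c f by []; clearbody G.
have Gmon : G \is monic by exact/eqP.
have delta0 := minor_neq0 i01 c0.
move: Gsep => /Bezout_coprimepP[[A B]] /eqpP[[a b]] /= /andP[a0 b0] AB.
have [Q [r [UE rs]]] : exists Q r, shift_dir c u = Q * G + r /\ (size r < size G)%N.
  exists (Pdiv.Ring.rdivp (shift_dir c u) G), (Pdiv.Ring.rmodp (shift_dir c u) G).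
  by split; [exact: Pdiv.RingMonic.rdivp_eq|rewrite Pdiv.Ring.ltn_rmodp monic_neq0].
have UEz z t : (map_poly (meval z) (shift_dir c u)).[t] =
    (map_poly (meval z) Q).[t] * (map_poly (meval z) G).[t] + (map_poly (meval z) r).[t].
  by rewrite UE rmorphD rmorphM/= hornerD hornerM.
suff r0 : r = 0.
  have tE p : (shift_dir c p).[mpolyC n 0] = p.
    rewrite shift_dir_horner -[RHS]translate0; congr translate.
    by apply/funext => i; rewrite mulr0.
  by exists Q.[mpolyC n 0]; rewrite -[u in LHS]tE UE r0 addr0 hornerM GE tE.
apply/polyP => k; rewrite coef0; apply: contrapT => /eqP rk0.
have [z [_ zP]] := mpoly_nonvanishing (mulf_neq0 (mulf_neq0 b0 rk0) delta0).
move: zP; rewrite !mevalM !mulf_eq0 !negb_or => /andP[/andP[bz rkz]].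
rewrite mevalB !mevalM !mevalC !mevalXU => dz.
pose Gz := map_poly (meval z) G; pose rz := map_poly (meval z) r.
have sGz : size Gz = size G by rewrite size_map_poly_id0// Gm meval1 oner_eq0.
have Gz1 : lead_coef Gz = 1 by rewrite lead_coef_map_id0 ?Gm ?meval1 ?oner_eq0 ?meval0.
have sep : separable_poly Gz.
  rewrite unlock; apply/Bezout_coprimepP; exists (map_poly (meval z) (a *: A), map_poly (meval z) (a *: B)).
  rewrite /= /Gz deriv_map -!rmorphM -rmorphD -!scalerAl -scalerDr AB.
  rewrite /= map_polyZ rmorph1/=; apply/eqpP; exists (1, meval z b) => /=.
    by rewrite oner_eq0.
  by rewrite scale1r.
have [s sE] := closed_field_poly_normal Gz.
rewrite Gz1 scale1r in sE; rewrite sE separable_prod_XsubC in sep.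
have rz0 : rz != 0.
  by apply: contraNneq rkz => /polyP/(_ k); rewrite coef_map coef0 => /= ->.
have := @max_poly_roots _ rz s rz0 _ sep.
have ss : size s = (size G).-1 by rewrite -sGz sE size_prod_XsubC.
rewrite ss => H.
have : ((size G).-1 < size rz)%N.
  apply: H; apply/allP => t ts.
  have [j zj] := translate_neq0 t dz.
  have Gt : Gz.[t] = 0 by apply/rootP; rewrite sE root_prod_XsubC.
  have := UEz z t; rewrite -/Gz Gt mulr0 add0r spec_shift_dir => ur.
  rewrite rootE -/rz -ur; apply/eqP/fu; first by exists j.
  by rewrite -spec_shift_dir -GE.
rewrite ltnNge (leq_trans (size_poly _ _))// -ltnS prednK//.
exact: leq_ltn_trans rs.
Qed.

Theorem divides_of_vanish f u (i0 i1 : 'I_n) : i0 != i1 -> f != 0 ->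
  (forall z, (exists i, z i != 0) -> meval z f = 0 -> exists i, meval z (mderiv i f) != 0) ->
  (forall z, (exists i, z i != 0) -> meval z f = 0 -> meval z u = 0) ->
  exists q, u = q * f.
Proof.
move=> i01 f0 fsm fu; have [c [k [c0 k0 [_ lk]]]] := shift_dir_lead f0.
have kV0 : k^-1 != 0 by rewrite invr_eq0.
have fE z : (meval z (k^-1 *: f) = 0) -> meval z f = 0.
  by rewrite mevalZ => /eqP; rewrite mulf_eq0 (negbTE kV0) => /eqP.
have [||||q qE] := @monic_division c (k^-1 *: f) u i0 i1 i01 c0.
- by rewrite scaler_eq0 negb_or kV0.
- have -> : shift_dir c (k^-1 *: f) = (mpolyC n k^-1)%:P * shift_dir c f.
    by rewrite /shift_dir mmapZ.
  by rewrite lead_coefM lead_coefC lk -mpolyCM mulVf.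
- move=> z z0 /fE fz; have [i iz] := fsm z z0 fz; exists i.
  by rewrite mderivZ mevalZ mulf_neq0.
- by move=> z z0 /fE; exact: fu.
by exists (k^-1 *: q); rewrite qE -scalerAr scalerAl.
Qed.

End Divide.

(** * Integer degrees and the Euler identity *)

Section IntegerDegree.
Context (C : numFieldType) (n : nat) (w : 'I_n -> nat).
Implicit Types (p q : mpoly n C) (k : int).

(** Integer degrees, because [d - 1] may be negative; the zero polynomial has every degree. *)
Definition whomogz k p := forall m : multinom n, m \in msupp p -> (wdeg w m)%:Z = k.

Lemma whomogz_nat d p : whomogz d%:Z p <-> whomog w d p.
Proof.
split=> [H|/whomogP H m mp]; first by apply/whomogP => m /H[].
by rewrite H.
Qed.

Lemma whomogz_ge0 k p : p != 0 -> whomogz k p -> exists d : nat, k = d%:Z.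
Proof. by move=> p0 H; exists (wdeg w (mlead p)); rewrite H// mlead_supp. Qed.

Lemma whomogz_sum k I (s : seq I) (P : pred I) (F : I -> mpoly n C) :
  (forall i, P i -> whomogz k (F i)) -> whomogz k (\sum_(i <- s | P i) F i).
Proof.
move=> H; elim/big_rec : _ => [|i x Pi hx]; first by move=> m; rewrite msupp0.
by move=> m /msuppD_le; rewrite mem_cat => /orP[/(H i Pi)|/hx].
Qed.

Lemma whomogzM k d p q : whomogz k p -> whomog w d q -> whomogz (k + d%:Z) (p * q).
Proof.
move=> hp hq; have [->|p0] := eqVneq p 0; first by move=> m; rewrite mul0r msupp0.
have [e ke] := whomogz_ge0 p0 hp; move: hp; rewrite ke => /whomogz_nat hp.
by rewrite -PoszD; apply/whomogz_nat; exact: whomogM.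
Qed.

Lemma whomogzZ k c p : whomogz k p -> whomogz k (c *: p).
Proof. by move=> hp m /msuppZ_le/hp. Qed.

Lemma whomogz_factor k d p q : p != 0 -> whomog w d p ->
  whomogz (k + d%:Z) (q * p) -> whomogz k q.
Proof.
move=> p0 hp hqp m mq.
have c0 : wcomp w (wdeg w m) q != 0.
  apply: contraTneq mq => /(congr1 (mcoeff m)); rewrite mcoeff_wcomp eqxx mcoeff0.
  by move=> h; rewrite mcoeff_msupp h eqxx.
have : wcomp w (wdeg w m + d) (q * p) != 0.
  by rewrite (wcompM _ _ hp) leq_addl addnK mulf_neq0.
have qp0 : q * p != 0 by rewrite mulf_neq0//; apply: contraTneq mq => ->; rewrite msupp0.
have [e ke] := whomogz_ge0 qp0 hqp; move: hqp; rewrite ke => /whomogz_nat hqp.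
have [de _|de] := eqVneq e (wdeg w m + d)%N; last by rewrite (wcomp_neq hqp de) eqxx.
by move: ke; rewrite de PoszD => /addIr.
Qed.

Lemma whomog_deriv d p i : whomog w d p -> whomog w (d - w i) (mderiv i p).
Proof.
move=> /whomogP hp; apply/whomogP => m; rewrite mcoeff_msupp mcoeff_deriv => h.
have mp : mnm_add m (mnm1 i) \in msupp p.
  by rewrite mcoeff_msupp; apply: contra h => /eqP ->; rewrite mul0rn.
by rewrite -(hp _ mp) wdegD wdeg1 addnK.
Qed.

(** Complements [whomog_deriv], whose degree [d - w i] is truncated: below weight [w i] no monomial
    contains [X_i]. *)
Lemma mderiv_small d p i : whomog w d p -> (d < w i)%N -> mderiv i p = 0.
Proof.
move=> /whomogP hp dw; apply/mpolyP => m; rewrite mcoeff0 mcoeff_deriv.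
have [mp|mp] := boolP (mnm_add m (mnm1 i) \in msupp p).
  by move: dw; rewrite -(hp _ mp) wdegD wdeg1 ltnNge leq_addl.
by rewrite (memN_msupp_eq0 mp) mul0rn.
Qed.

Lemma weighted_euler d p : whomog w d p ->
  \sum_i (mX i *+ w i) * mderiv i p = p *+ d.
Proof.
move=> /whomogP hp; have EX c m : \sum_i (mX i *+ w i) * mderiv i (c *: mpolyX C m) = c *: mpolyX C m *+ wdeg w m.
  rewrite /wdeg -sumrMnr; apply: eq_bigr => i _.
  rewrite mderivZ mderivX mulrnAl -!scalerAr mulnC mulrnA; congr (_ *+ _).
  case: (posnP (m i)) => [->|mi]; first by rewrite !mulr0n scale0r scaler0.
  rewrite -mpolyXD scaler_nat -scalerMnr; congr (_ *: mpolyX _ _ *+ _).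
  apply/mnmP => j; rewrite mnmDE mnmBE mnm1E; case: eqP => [<-|_]; last by rewrite subn0.
  by rewrite add1n subn1 prednK.
suff H (s : seq (multinom n)) (cf : multinom n -> C) : {subset s <= msupp p} ->
    \sum_i (mX i *+ w i) * mderiv i (\sum_(m <- s) cf m *: mpolyX C m) =
    (\sum_(m <- s) cf m *: mpolyX C m) *+ d.
  by have := H (msupp p) (fun m => mcoeff m p) (fun _ h => h); rewrite -mpolyE.
elim: s => [_|m s IH ss].
  by rewrite !big_nil mul0rn big1// => i _; rewrite raddf0 mulr0.
rewrite !big_cons mulrnDl -[in RHS]IH => [|m' ms]; last by rewrite ss// inE ms orbT.
rewrite -[in RHS](hp m) ?ss ?mem_head// -EX -big_split/=; apply: eq_bigr => i _.
by rewrite mderivD mulrDr.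
Qed.

(** On an orbit [l ^ k p(z)] and [sum l ^ t p_t(z)] agree for all nonzero [l]. Writing [k = b - a]
    clears negative powers, and comparing coefficients in [l] leaves only the component of degree
    [k]. *)
Lemma whomogz_of_wact k p :
  (forall l (z : 'I_n -> C), l != 0 -> (forall i, z i != 0) ->
    meval (fun i => l ^+ w i * z i) p = l ^ k * meval z p) -> whomogz k p.
Proof.
move=> H m mp; apply: contrapT => /eqP mk.
have [|z [z0]] := @mpoly_nonvanishing C n (wcomp w (wdeg w m) p).
  apply: contraTneq mp => /(congr1 (mcoeff m)); rewrite mcoeff_wcomp eqxx mcoeff0.
  by move=> h; rewrite mcoeff_msupp h eqxx.
case/eqP; pose K := maxn (mmeasure (wdeg w) p) (wdeg w m).+1.
pose c t := meval z (wcomp w t p).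
have mK : (wdeg w m < K)%N by rewrite leq_max ltnSn orbT.
have [a [b kab]] : exists a b : nat, k = b%:Z - a%:Z.
  by case: (k) => b; [exists 0%N, b; rewrite subr0|exists b.+1, 0%N; rewrite NegzE sub0r].
pose P := \sum_(t < K) c t *: 'X^(t + a) - (meval z p) *: 'X^b.
have P0 : P = 0.
  apply: poly_eq0_of_vanish => l l0; rewrite /P hornerD hornerN hornerZ hornerXn.
  rewrite horner_sum (_ : \sum_(t < K) _ = l ^+ a * \sum_(t < K) l ^+ t * c t); last first.
    by rewrite mulr_sumr; apply: eq_bigr => t _; rewrite hornerZ hornerXn exprD; ring.
  rewrite -meval_wact ?leq_maxl// H// kab expfzDr// -exprnN -exprnP mulrA mulrCA mulfV ?expf_neq0//.
  by rewrite mulr1 mulrC subrr.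
have := congr1 (fun P : {poly C} => P`_(wdeg w m + a)) P0.
rewrite /P coef0 coefD coefN coefZ coefXn coef_sum (bigD1 (Ordinal mK))//= coefZ coefXn eqxx mulr1.
rewrite big1 ?addr0 => [|t tm]; last first.
  rewrite coefZ coefXn eqn_add2r; case: eqP => [e|]; rewrite ?mulr0//.
  by case/eqP: tm; apply: val_inj.
case: eqP => [e|_]; last by rewrite mulr0 subr0.
by case/eqP: mk; rewrite kab -e PoszD addrK.
Qed.

End IntegerDegree.

(** * Foliations given by polynomials *)

Section InvariantHypersurface.
Local Open Scope classical_set_scope.
Local Open Scope ring_scope.
Context (C : numClosedFieldType) (C_uncountable : ~ countable [set: C]).
Context (n : nat) (w : 'I_n.+1 -> nat) (w_gt0 : forall i, (0 < w i)%N) (n_gt0 : (0 < n)%N).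
Local Notation S := (mpoly n.+1 C).
Context (l : int) (d0 : nat) (f : S) (W : 'I_n.+1 -> 'I_n.+1 -> S).
Context (F : ('I_n.+1 -> C) -> 'I_n.+1 -> C).
Let nz (z : 'I_n.+1 -> C) := exists i, z i != 0.
Hypothesis f_neq0 : f != 0.
Hypothesis f_homog : whomog w d0 f.
Hypothesis f_smooth : forall z, nz z -> meval z f = 0 -> exists i, meval z (mderiv i f) != 0.
Hypothesis W_eval : forall z i j, nz z ->
  meval z (W i j) = (w i)%:R * z i * F z j - (w j)%:R * z j * F z i.
Hypothesis W_homog : forall i j, whomogz w (l + (w i + w j)%N%:Z) (W i j).
Hypothesis W_invariant : forall z, nz z -> meval z f = 0 ->
  (exists i j, meval z (W i j) != 0) -> \sum_i F z i * meval z (mderiv i f) = 0.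
Hypothesis W_neq0 : exists i j, W i j != 0.

Let r i : S := mX i *+ w i.
Let v i : S := mderiv i f.

Let mpoly_ext (p q : S) : (forall z, nz z -> meval z p = meval z q) -> p = q.
Proof.
move=> H; apply/eqP; rewrite -subr_eq0; apply/negPn/negP.
move=> /mpoly_nonvanishing[z [z0]]; rewrite mevalB H ?subrr ?eqxx//.
by exists ord0.
Qed.

Let reval z i : meval z (r i) = (w i)%:R * z i.
Proof. by rewrite /r mevalMn mevalXU mulr_natl. Qed.

Let W_antisym i j : W i j = - W j i.
Proof. by apply: mpoly_ext => z z0; rewrite mevalN !W_eval// opprB. Qed.

(** The Pluecker relation of the decomposable bivector spanned by the radial field and the
    foliation; contracted with [v] it recovers [W] from [X]. *)
Let W_plucker i j k : r i * W k j - r j * W k i = r k * W i j.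
Proof.
apply: mpoly_ext => z z0; rewrite mevalB !mevalM !reval !W_eval//; ring.
Qed.

Let euler : \sum_i r i * v i = f *+ d0.
Proof. exact: weighted_euler. Qed.

Section PositiveDegree.
Hypothesis d0_gt0 : (0 < d0)%N.

Let fd : f *+ d0 != 0.
Proof. by rewrite -mulr_natr mulf_neq0// -mpolyC_nat mpolyC_eq0 pnatr_eq0 -lt0n. Qed.

(* [X] is the lift of the foliation that annihilates [f]. *)
Lemma tangent_lift : exists X : 'I_n.+1 -> S,
  [/\ forall i j, W i j = r i * X j - r j * X i, \sum_i X i * v i = 0 &
    forall i, whomogz w (l + (w i)%:Z) (X i)].
Proof.
have H j : exists q, \sum_i W i j * v i = q * f.
  have i01 : ord0 != ord_max :> 'I_n.+1 by rewrite -val_eqE/= eq_sym -lt0n.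
  apply: (divides_of_vanish i01 f_neq0 f_smooth) => z z0 fz.
  rewrite raddf_sum/=.
  have [/forallNP Wz|/contrapT Wz] := pselect (~ exists i j, meval z (W i j) != 0).
    rewrite big1// => i _; have /forallNP/(_ j)/negP := Wz i.
    by rewrite negbK mevalM => /eqP ->; rewrite mul0r.
  have e1 : \sum_i meval z (r i) * meval z (v i) = 0.
    transitivity (meval z (\sum_i r i * v i)); last by rewrite euler mevalMn fz mul0rn.
    by rewrite raddf_sum; apply: eq_bigr => i _; rewrite -mevalM.
  have e2 := W_invariant z0 fz Wz.
  rewrite (_ : \sum_i _ = F z j * (\sum_i meval z (r i) * meval z (v i)) -
      meval z (r j) * \sum_i F z i * meval z (v i)); first by rewrite e1 e2 !mulr0 subr0.
  rewrite !mulr_sumr -sumrB; apply: eq_bigr => i _.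
  by rewrite mevalM W_eval// !reval; ring.
have /choice[q qE] := H.
(* Euler's identity produces [f *+ d0] rather than [f], so the quotients are divided by [d0]. *)
pose c : S := mpolyC n.+1 d0%:R^-1; pose X j := c * q j.
have cd : c * d0%:R = 1.
  by rewrite /c -[d0%:R in X in _ * X]mpolyC_nat -mpolyCM mulVf// pnatr_eq0 -lt0n.
have XE j : (f *+ d0) * X j = \sum_i W i j * v i.
  by rewrite qE /X -mulr_natr mulrA -[f * _ * c]mulrA [d0%:R * c]mulrC cd mulr1 mulrC.
exists X; split => [i j||j].
- apply: (mulfI fd); rewrite -{1}euler mulr_suml mulrBr !mulrA.
  rewrite [_ * r i]mulrC [_ * r j]mulrC -!mulrA !XE !mulr_sumr -sumrB.
  apply: eq_bigr => k _; rewrite !mulrA -mulrBl W_plucker; ring.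
(* Up to the factor [f *+ d0] the sum is [W] contracted twice with [v], which antisymmetry makes
   zero. *)
- apply: (mulfI fd); rewrite mulr0 mulr_sumr.
  rewrite (eq_bigr (fun j => \sum_i W i j * v i * v j)); last first.
    by move=> j _; rewrite mulrA XE mulr_suml.
  have : \sum_j \sum_i W i j * v i * v j = - \sum_j \sum_i W i j * v i * v j.
    rewrite {1}exchange_big/= -sumrN; apply: eq_bigr => i _.
    by rewrite -sumrN; apply: eq_bigr => j _; rewrite W_antisym; ring.
  move/eqP; rewrite -addr_eq0 -mulr2n -mulr_natr mulf_eq0 -mpolyC_nat mpolyC_eq0 pnatr_eq0 orbF.
  by move/eqP.
- rewrite /X /c mul_mpolyC; apply: whomogzZ.
  apply: (whomogz_factor f_neq0 f_homog); rewrite -qE; apply: whomogz_sum => i _.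
  have [iw|wi] := ltnP d0 (w i).
    by rewrite /v (mderiv_small f_homog iw) mulr0 => m; rewrite msupp0.
  have := whomogzM (@W_homog i j) (whomog_deriv i f_homog).
  rewrite (_ : l + _ + _ = l + (w j)%:Z + d0%:Z)//; lia.
Qed.

Lemma deriv_nilpotent i : exists N (s : 'I_n.+1 -> S), mX i ^+ N = \sum_k s k * v k.
Proof.
apply: (homog_nullstellensatz C_uncountable w_gt0 (fun k => whomog_deriv k f_homog)) => z vz k.
apply/eqP; apply: contraT => zk; have z0 : nz z by exists k.
have fz : meval z f = 0.
  have := congr1 (meval z) euler; rewrite mevalMn raddf_sum/= big1 => [|j _].
    by move=> /esym/eqP; rewrite mulrn_eq0 gtn_eqF// => /eqP.
  by rewrite mevalM vz mulr0.
by have [j] := f_smooth z0 fz; rewrite vz eqxx.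
Qed.

End PositiveDegree.

Theorem degree_le_pair : exists i j, i != j /\ d0%:Z <= l + (w i + w j)%N%:Z.
Proof.
have Wne i j : W i j != 0 -> i != j.
  apply: contraNneq => ->; have := W_antisym j j => /eqP; rewrite -addr_eq0 -mulr2n.
  by rewrite -mulr_natr mulf_eq0 -mpolyC_nat mpolyC_eq0 pnatr_eq0 orbF.
(* Degree zero is treated apart since the lift divides by [d0]; there any nonzero [W i j] has degree
   [l + w_i + w_j], which is then nonnegative. *)
have [d00|d0_gt0] := posnP d0.
  have [i [j Wij]] := W_neq0; exists i, j; split; first exact: Wne.
  by have [k ->] := whomogz_ge0 Wij (@W_homog i j); rewrite d00.
have [X [WX Xv Xh]] := tangent_lift d0_gt0.
have [A [_ A0 XA]] := antisym_syzygy (deriv_nilpotent d0_gt0) Xv.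
have [i Xi] : exists i, X i != 0.
  have [i [j Wij]] := W_neq0; apply: contrapT => /forallNP X0; case/eqP: Wij.
  have X0' k : X k = 0 by apply/eqP; apply: contraT => h; case: (X0 k).
  by rewrite WX !X0' !mulr0 subrr.
have [t tE] := whomogz_ge0 Xi (Xh i).
have := Xh i; rewrite tE => /whomogz_nat hX.
have XA' := homog_cofactors (fun k => whomog_deriv k f_homog) hX (XA i).
have [j] : exists j, (if (d0 - w j <= t)%N then wcomp w (t - (d0 - w j)) (A i j) else 0) * v j != 0.
  apply: contrapT => /forallNP H; case/eqP: Xi; rewrite XA' big1// => j _.
  by apply/eqP; apply: contraT => h; case: (H j).
rewrite mulf_eq0 negb_or => /andP[Aij vj]; exists i, j; split.
  apply: contraNneq Aij => <-; rewrite A0; case: ifP => // _.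
  by rewrite raddf0.
have wj : (w j <= d0)%N.
  by rewrite leqNgt; apply: contra vj => /(mderiv_small f_homog) h; rewrite /v h.
by move: Aij tE; case: ifP => [h _|_]; rewrite ?eqxx//; lia.
Qed.

(** Isolated singularities enter through [h], whose zero locus misses the singular cone. The
    numerical inequality gives two kernel vectors by [antisym_kernel], and [infinite_zero_locus]
    then forbids such an [h]. *)
Theorem degree_lt_of_isolated (h : S) (dh e : nat) : (0 < dh)%N -> whomog w dh h ->
  (forall z, nz z -> (forall i j, meval z (W i j) = 0) -> meval z h != 0) ->
  (\sum_i w i)%N%:Z <= l -> d0%:Z = l + e%:Z ->
  ~ (2 * \sum_i w i < (if odd n then n.+1 else n) * e)%N.
Proof.
move=> dh0 hh hW Sl d0E lt.
have [l' lE] : exists l' : nat, l = l'%:Z by case: l Sl => // k; exists k.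
have wS i : (w i <= \sum_i w i)%N by rewrite (bigD1 i)//= leq_addr.
have e0 : (0 < e)%N by case: e lt {d0E} => //; rewrite muln0.
have dw i : (w i < d0)%N by have := wS i; lia.
have d0_gt0 : (0 < d0)%N by exact: leq_ltn_trans (dw ord0).
have [X [WX Xv Xh]] := tangent_lift d0_gt0.
have [A [Aanti A0 XA]] := antisym_syzygy (deriv_nilpotent d0_gt0) Xv.
have hX i : whomog w (l' + w i) (X i) by apply/whomogz_nat; rewrite PoszD -lE.
pose B i j := if (d0 - w j <= l' + w i)%N then wcomp w (l' + w i - (d0 - w j)) (A i j) else 0.
have XB i : X i = \sum_j B i j * v j.
  exact: homog_cofactors (fun k => whomog_deriv k f_homog) (hX i) (XA i).
(* This condition is symmetric in [i] and [j], and so is the degree of the component kept, because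
   [w i < d0] makes the subtractions exact. Hence [B] inherits antisymmetry from [A]. *)
have BE i j : (d0 - w j <= l' + w i)%N = (e <= w i + w j)%N.
  by have := dw i; have := dw j; lia.
have Banti i j : B i j = - B j i.
  rewrite /B !BE addnC; case: ifP => // _; last by rewrite oppr0.
  rewrite Aanti raddfN/=; congr (- wcomp w _ _).
  by have := dw i; have := dw j; lia.
have Be i j : B i j != 0 -> (e <= w i + w j)%N.
  by rewrite /B BE; case: ifP => //; rewrite eqxx.
have S2 : (2 : S) != 0 by rewrite -mpolyC_nat mpolyC_eq0 pnatr_eq0.
have [k1 [k2 [a [b [hk1 hk2 mu]]]]] := antisym_kernel S2 Banti Be lt.
apply: (@infinite_zero_locus C n.+1 w B v k1 k2 h (fun i => d0 - w i)%N (fun i => l' + w i)%N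
  dh a b) => //.
- by move=> i; rewrite subn_gt0.
- by move=> i; exact: whomog_deriv.
- by move=> i j; rewrite /B; case: (d0 - w j <= l' + w i)%N => //; exact: wcomp_homog.
pose g (k : option 'I_n.+1) := if k is Some i then X i else h.
pose D (k : option 'I_n.+1) := if k is Some i then (l' + w i)%N else dh.
move=> k; have [|z gz i|M [s sE]] := @homog_nullstellensatz C C_uncountable n.+1 w _ g D w_gt0 _ _ k.
- by case.
- apply/eqP; apply: contraT => zi; have z0 : nz z by exists i.
  have : meval z h != 0; last by rewrite (gz None) eqxx.
  apply: hW z0 _ => i' j'; rewrite WX mevalB !mevalM (gz (Some i')) (gz (Some j')).
  by rewrite !mulr0 subrr.
exists M, (fun i => s (Some i)), (s None); rewrite sE.
rewrite [LHS](bigD1 None)//= addrC; congr (_ + _).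
rewrite (reindex_omap Some id)/=; last by case.
by apply: eq_big => [i|i _]; rewrite ?eqxx// XB.
Qed.

End InvariantHypersurface.

(** * Interpolation *)

Section Interpolation.
Context (C : numFieldType) (n : nat).
Implicit Types (z y : 'I_n -> C) (i k : 'I_n).

Definition set_coord z k t : 'I_n -> C := fun i => if i == k then t else z i.

(** Nonzero nodes, so that substituting them keeps all coordinates of a point nonzero. *)
Lemma lagrange_interpolation K : exists (L : 'I_K.+1 -> {poly C}) (x : 'I_K.+1 -> C),
  (forall a, x a != 0) /\
  (forall P : {poly C}, (size P <= K.+1)%N -> P = \sum_a P.[x a] *: L a).
Proof.
pose x (a : nat) : C := a.+1%:R.
have xinj : injective x by move=> a b /eqP; rewrite eqr_nat => /eqP[].
exists (fun a => tnth (lagrange K.+1 x) a), x; split => [a|P sP].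
  by rewrite pnatr_eq0.
rewrite {1}(lagrange_gen _ xinj sP)//; apply: eq_bigr => a _.
by rewrite mul_polyC.
Qed.

Lemma meval_set_coord z k (q : mpoly n C) :
  exists Q : {poly C}, forall t, Q.[t] = meval (set_coord z k t) q.
Proof.
exists (mmap (@polyC C) (fun i => if i == k then 'X else (z i)%:P) q) => t.
rewrite /mmap mevalE horner_sum; apply: eq_bigr => m _.
rewrite hornerM hornerC; congr (_ * _); rewrite /mmap1 horner_prod.
apply: eq_bigr => i _; rewrite horner_exp /set_coord.
by case: eqP; rewrite ?hornerX ?hornerC.
Qed.

(** Interpolating variable by variable expresses [g] through its values at finitely many points,
    with polynomial coefficients. The hypothesis covers only coordinate lines missing the origin;
    since [1 < n], these include all coordinate lines through points without zero coordinate. *)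
Lemma mpoly_of_separately_poly (g : ('I_n -> C) -> C) K : (1 < n)%N ->
  (forall z k, (exists2 i, i != k & z i != 0) ->
    exists2 P : {poly C}, (size P <= K.+1)%N & forall t, g (set_coord z k t) = P.[t]) ->
  exists q : mpoly n C, forall z, (exists i, z i != 0) -> g z = meval z q.
Proof.
move=> n1 gP; have [L [x [x0 Lx]]] := lagrange_interpolation K.
have other k : exists i : 'I_n, i != k.
  have [->|] := eqVneq k (Ordinal (ltnW n1)); first by exists (Ordinal n1).
  by rewrite eq_sym => h; exists (Ordinal (ltnW n1)).
have poly1 z k : (forall i, z i != 0) ->
    g z = \sum_a (L a).[z k] * g (set_coord z k (x a)).
  move=> z0; have [i ik] := other k.
  have [P sP PE] := gP z k (ex_intro2 _ _ i ik (z0 i)).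
  have -> : g z = P.[z k].
    rewrite -PE; congr g; apply/funext => j; rewrite /set_coord.
    by case: eqP => [->|].
  rewrite {1}(Lx P sP) horner_sum; apply: eq_bigr => a _.
  by rewrite hornerZ mulrC PE.
have [J [Q [y [y0 gE]]]] : exists (J : finType) (Q : J -> mpoly n C) (y : J -> 'I_n -> C),
    (forall j i, y j i != 0) /\ (forall z, (forall i, z i != 0) ->
      g z = \sum_j meval z (Q j) * g (fun i => if i \in enum 'I_n then y j i else z i)).
  elim: (enum 'I_n) (enum_uniq 'I_n) => [_|k s IH /= /andP[ks /IH [J [Q [y [y0 gE]]]]]].
    exists unit, (fun=> 1), (fun _ _ => 1); split => [_ _|z _]; first exact: oner_neq0.
    by rewrite (bigD1 tt)//= big1 ?addr0 ?meval1 ?mul1r// => -[].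
  exists (J * 'I_K.+1)%type, (fun ja => (map_poly (@mpolyC n C) (L ja.2)).[mX k] * Q ja.1),
    (fun ja => set_coord (y ja.1) k (x ja.2)); split.
    by move=> [j a] i; rewrite /set_coord; case: (i == k); [exact: x0|exact: y0].
  move=> z z0; rewrite gE// -(pair_bigA _ (fun j a => meval z ((map_poly (@mpolyC n C) (L a)).[mX k] * Q j) *
    g (fun i => if i \in k :: s then set_coord (y j) k (x a) i else z i)))/=.
  apply: eq_bigr => j _; rewrite (poly1 _ k); last first.
    by move=> i; case: ifP => _; [exact: y0|exact: z0].
  rewrite (negbTE ks) mulr_sumr; apply: eq_bigr => a _.
  rewrite mulrA; congr (_ * _).
    rewrite mevalM mulrC; congr (_ * _).
    rewrite -[RHS](horner_map (meval z))/= mevalXU -map_poly_comp.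
    by rewrite map_poly_id// => c _ /=; rewrite mevalC.
  congr g; apply/funext => i; rewrite /set_coord inE.
  by case: eqP.
pose q := \sum_j g (y j) *: Q j; exists q.
have gq z : (forall i, z i != 0) -> g z = meval z q.
  move=> z0; rewrite gE// /q raddf_sum/=; apply: eq_bigr => j _.
  rewrite mevalZ mulrC; congr (g _ * _); apply/funext => i.
  by rewrite mem_enum.
(* Induction on the number of zero coordinates: along a line that leaves a coordinate hyperplane and
   misses the origin, two polynomials agree off [0], hence also at [0]. *)
move=> z; move: {2}#|[set k | z k == 0]| (erefl #|[set k | z k == 0]|) => N.
elim: N z => [|N IH] z.
  move=> /eqP; rewrite cards_eq0 => /eqP zE _; apply: gq => i.
  have /negbT : (i \in [set k | z k == 0]) = false by rewrite zE inE.
  by rewrite inE.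
move=> cz [i zi].
have [k] : exists k, k \in [set k | z k == 0] by apply/card_gt0P; rewrite cz.
rewrite inE => zk.
have ik : i != k by apply: contraNneq zi => ->.
have [P sP PE] := gP z k (ex_intro2 _ _ i ik zi).
have [Q' QE'] := meval_set_coord z k q.
have zE : z = set_coord z k 0.
  by apply/funext => j; rewrite /set_coord; case: eqP => [->|//]; exact/eqP.
suff PQ : P = Q' by rewrite zE PE PQ QE'.
apply/eqP; rewrite -subr_eq0; apply/eqP/poly_eq0_of_vanish => t t0.
rewrite hornerD hornerN -PE QE' (IH (set_coord z k t)) ?subrr//; last first.
  by exists i; rewrite /set_coord (negbTE ik).
move: cz; rewrite (cardsD1 k) inE zk add1n => -[<-].
apply: eq_card => j; rewrite !inE /set_coord.
by case: (j == k); rewrite // (negbTE t0).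
Qed.
End Interpolation.

(** * Liouville theorem *)

Local Open Scope complex_scope.
Local Notation ReC := (@complex.Re _).
Local Notation ImC := (@complex.Im _).

Section ComplexModulus.
Context {R : realType}.
Implicit Types z : R[i].

(** A modulus with values in [R]: the norm of [R[i]] takes its values in [R[i]], whose order is
    partial. *)
Definition nm z : R := ReC `|z|.

Lemma nmE z : (nm z)%:C = `|z|.
Proof. by rewrite /nm normc_def. Qed.

Lemma nm0 : nm 0 = 0. Proof. by rewrite /nm normr0. Qed.
Lemma nm1 : nm 1 = 1. Proof. by rewrite /nm normr1. Qed.
Lemma nm_ge0 z : 0 <= nm z. Proof. by rewrite -ler0c nmE. Qed.
Lemma nm_eq0 z : (nm z == 0) = (z == 0).
Proof. by rewrite -(inj_eq (@complexI R)) nmE normr_eq0. Qed.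
Lemma nm_gt0 z : (0 < nm z) = (z != 0).
Proof. by rewrite lt_def nm_ge0 andbT nm_eq0. Qed.
Lemma nmM z1 z2 : nm (z1 * z2) = nm z1 * nm z2.
Proof. by apply: complexI; rewrite rmorphM/= !nmE normrM. Qed.
Lemma nmV z : nm z^-1 = (nm z)^-1.
Proof. by apply: complexI; rewrite fmorphV/= !nmE normfV. Qed.
Lemma nmX z n : nm (z ^+ n) = nm z ^+ n.
Proof. by apply: complexI; rewrite rmorphXn/= !nmE normrX. Qed.
Lemma nmN z : nm (- z) = nm z. Proof. by rewrite /nm normrN. Qed.
Lemma nmB z1 z2 : nm (z1 - z2) = nm (z2 - z1). Proof. by rewrite -nmN opprB. Qed.
Lemma nmD z1 z2 : nm (z1 + z2) <= nm z1 + nm z2.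
Proof. by rewrite -lecR rmorphD/= !nmE ler_normD. Qed.
Lemma nm_real (x : R) : nm x%:C = `|x|.
Proof. by apply: complexI; rewrite nmE normc_def/= expr0n/= addr0 sqrtr_sqr. Qed.
Lemma nm_i : nm 'i = 1.
Proof. by apply: complexI; rewrite nmE normc_def/= expr0n/= add0r expr1n sqrtr1. Qed.
Lemma Re_le_nm z : `|ReC z| <= nm z.
Proof. by rewrite -lecR nmE normc_ge_Re. Qed.
Lemma Im_le_nm z : `|ImC z| <= nm z.
Proof.
have := Re_le_nm (z * 'i); rewrite nmM nm_i mulr1.
by case: z => a b /=; rewrite mulr0 mulr1 sub0r normrN.
Qed.
Lemma nm_le_ReIm z : nm z <= `|ReC z| + `|ImC z|.
Proof.
rewrite {1}[z]complexE (le_trans (nmD _ _))// nmM nm_i mul1r.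
by rewrite !nm_real.
Qed.

End ComplexModulus.

(** * Integrals of continuous functions over a segment *)

Section SegmentIntegral.
Context {R : realType}.
Implicit Types (a b m : R) (u v : R -> R).
Let mu := @lebesgue_measure R.

(** Continuity relative to the segment, hence one-sided at its end points; the distance is a
    parameter so as to cover real and complex values. *)
Definition cts_seg (E : Type) (d : E -> E -> R) (g : R -> E) a b :=
  forall x, a <= x <= b -> forall e, 0 < e -> exists2 t, 0 < t &
    forall y, a <= y <= b -> `|y - x| < t -> d (g y) (g x) < e.

Let dR (x y : R) := `|x - y|.

Definition rint u a b : R := (\int[mu]_(x in `[a, b]) u x)%R.

Lemma cts_seg_integrable u a b :
  cts_seg dR u a b -> mu.-integrable `[a, b]%classic (EFin \o u).
Proof.
move=> cu; apply: continuous_compact_integrable; first exact: segment_compact.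
apply/subspace_continuousP => x /=; rewrite in_itv/= => xab.
apply/cvgrPdist_lt => e e0; have [t t0 ht] := cu x xab e e0.
rewrite near_withinE; apply/nbhs_ballP; exists t => //= y.
rewrite /ball/= distrC => xy; rewrite in_itv/= => yab.
by rewrite distrC; exact: ht.
Qed.

Lemma rintD u v a b : cts_seg dR u a b -> cts_seg dR v a b ->
  rint (fun x => u x + v x) a b = rint u a b + rint v a b.
Proof. by move=> cu cv; rewrite /rint RintegralD//; exact: cts_seg_integrable. Qed.

Lemma rintZ c u a b : cts_seg dR u a b ->
  rint (fun x => c * u x) a b = c * rint u a b.
Proof. by move=> cu; rewrite /rint RintegralZl//; exact: cts_seg_integrable. Qed.

Lemma eq_rint u v a b : (forall x, a <= x <= b -> u x = v x) ->
  rint u a b = rint v a b.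
Proof.
by move=> uv; apply: eq_Rintegral => x; rewrite inE/= in_itv/=; exact: uv.
Qed.

Lemma rint_split u a b m : a <= m -> m <= b -> cts_seg dR u a b ->
  rint u a b = rint u a m + rint u m b.
Proof.
move=> am mb cu; have iu := cts_seg_integrable cu.
have := @Rintegral_itvB R u (BLeft a) (BRight b) m iu.
rewrite !bnd_simp => /(_ am mb) /eqP; rewrite subr_eq => /eqP.
rewrite -[LHS]/(rint u a b) => ->; rewrite addrC; congr (_ + _).
rewrite Rintegral_itv_obnd_cbnd//.
apply: integrableS iu => //; apply: subset_itvr.
by rewrite bnd_simp.
Qed.

Lemma rint_cst c a b : a <= b -> rint (fun=> c) a b = c * (b - a).
Proof.
move=> ab; rewrite /rint Rintegral_cst//= /mu/= lebesgue_measure_itv//= lte_fin.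
by congr (_ * _); case: ltgtP ab => // ->; rewrite subrr.
Qed.

Lemma cts_cst c a b : cts_seg dR (fun=> c) a b.
Proof. by move=> x _ e e0; exists 1 => // y _ _; rewrite /dR subrr normr0. Qed.

Lemma le_rint u v a b : cts_seg dR u a b -> cts_seg dR v a b ->
  (forall x, a <= x <= b -> u x <= v x) -> rint u a b <= rint v a b.
Proof.
move=> cu cv uv; apply: le_Rintegral => //; exact: cts_seg_integrable.
Qed.

Lemma rint_bound u a b M : a <= b -> cts_seg dR u a b ->
  (forall x, a <= x <= b -> `|u x| <= M) -> `|rint u a b| <= M * (b - a).
Proof.
move=> ab cu uM; rewrite ler_norml -mulNr -!rint_cst//; apply/andP; split.
  by apply: le_rint => [||x /uM]; [exact: cts_cst|by []|rewrite ler_norml => /andP[]].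
by apply: le_rint => [||x /uM]; [by []|exact: cts_cst|rewrite ler_norml => /andP[]].
Qed.

Implicit Types g h : R -> R[i].

Definition dC (z w : R[i]) : R := nm (z - w).
Definition cts g a b := cts_seg dC g a b.

Definition cint g a b : R[i] :=
  rint (ReC \o g) a b +i* rint (ImC \o g) a b.

Lemma cts_Re g a b : cts g a b -> cts_seg dR (ReC \o g) a b.
Proof.
move=> cg x xab e e0; have [t t0 ht] := cg x xab e e0; exists t => // y yab yx.
apply: le_lt_trans (ht y yab yx); rewrite /dR /dC (le_trans _ (Re_le_nm _))//=.
by case: (g y) (g x) => ? ? [].
Qed.

Lemma cts_Im g a b : cts g a b -> cts_seg dR (ImC \o g) a b.
Proof.
move=> cg x xab e e0; have [t t0 ht] := cg x xab e e0; exists t => // y yab yx.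
apply: le_lt_trans (ht y yab yx); rewrite /dR /dC (le_trans _ (Im_le_nm _))//=.
by case: (g y) (g x) => ? ? [].
Qed.

Lemma cintD g h a b : cts g a b -> cts h a b ->
  cint (fun x => g x + h x) a b = cint g a b + cint h a b.
Proof.
move=> cg ch; rewrite /cint.
rewrite (@eq_rint _ (fun x => (ReC \o g) x + (ReC \o h) x)); last first.
  by move=> x _ /=; case: (g x) (h x) => ? ? [].
rewrite (@eq_rint (ImC \o _) (fun x => (ImC \o g) x + (ImC \o h) x)); last first.
  by move=> x _ /=; case: (g x) (h x) => ? ? [].
by rewrite !rintD//; [exact: cts_Im..|exact: cts_Re|exact: cts_Re].
Qed.

Lemma cts_segZ c u a b : cts_seg dR u a b -> cts_seg dR (fun x => c * u x) a b.
Proof.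
move=> cu x xab e e0.
have c0 : 0 < `|c| + 1 by rewrite ltr_wpDl.
have [|t t0 ht] := cu x xab (e / (`|c| + 1)); first by rewrite divr_gt0.
exists t => // y yab /(ht y yab); rewrite /dR ltr_pdivlMr// -mulrBr normrM.
by apply: le_lt_trans; rewrite mulrC ler_wpM2l// lerDl.
Qed.

Lemma cintZ (c : R[i]) g a b : cts g a b ->
  cint (fun x => c * g x) a b = c * cint g a b.
Proof.
move=> cg; rewrite /cint; case: c => p q.
have cR := cts_Re cg; have cI := cts_Im cg.
rewrite (@eq_rint _ (fun x => p * (ReC \o g) x + (- q) * (ImC \o g) x)); last first.
  by move=> x _ /=; case: (g x) => ? ? /=; rewrite mulNr.
rewrite (@eq_rint (ImC \o _) (fun x => p * (ImC \o g) x + q * (ReC \o g) x)); last first.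
  by move=> x _ /=; case: (g x) => ? ? /=.
rewrite !rintD ?rintZ//; try exact: cts_segZ.
by apply/eqP; rewrite eq_complex/= mulNr !eqxx.
Qed.

Lemma eq_cint g h a b : (forall x, a <= x <= b -> g x = h x) ->
  cint g a b = cint h a b.
Proof.
by move=> gh; congr (_ +i* _); apply: eq_rint => x /gh/= ->.
Qed.

Lemma cint_split g a b m : a <= m -> m <= b -> cts g a b ->
  cint g a b = cint g a m + cint g m b.
Proof.
move=> am mb cg; rewrite /cint (rint_split am mb (cts_Re cg)).
by rewrite (rint_split am mb (cts_Im cg)).
Qed.

(** The factor [2] comes from bounding real and imaginary parts separately. *)
Lemma cint_bound g a b M : a <= b -> cts g a b ->
  (forall x, a <= x <= b -> nm (g x) <= M) -> nm (cint g a b) <= 2 * M * (b - a).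
Proof.
move=> ab cg gM; apply: le_trans (nm_le_ReIm _) _; rewrite /cint/= -mulrA mulr_natl mulr2n.
apply: lerD; apply: rint_bound => //; try first [exact: cts_Im|exact: cts_Re].
  by move=> x xab; rewrite (le_trans _ (gM _ xab))//= Re_le_nm.
by move=> x xab; rewrite (le_trans _ (gM _ xab))//= Im_le_nm.
Qed.

Lemma cint_cst c a b : a <= b -> cint (fun=> c) a b = c * (b - a)%:C.
Proof.
move=> ab; rewrite /cint !rint_cst//; case: c => p q /=.
by apply/eqP; rewrite eq_complex/= !mulr0 subr0 add0r !eqxx.
Qed.

End SegmentIntegral.

Section Hol.
Context {K : numFieldType}.
Implicit Types (g h : K -> K) (z p : K).

(* A wrapper, so that [done] does not unfold derivability into filters. *)
Variant hol g z : Prop := Hol of derivable (g : K^o -> K^o) z 1.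

Lemma hol_id z : hol (fun x => x) z.
Proof. split; exact: derivable_id. Qed.

Lemma hol_cst (k : K) z : hol (fun=> k) z.
Proof. split; exact: derivable_cst. Qed.

Lemma hol_add g h z : hol g z -> hol h z -> hol (fun x => g x + h x) z.
Proof. move=> [dg] [dh]; split; exact: derivableD. Qed.

Lemma hol_mul g h z : hol g z -> hol h z -> hol (fun x => g x * h x) z.
Proof. move=> [dg] [dh]; split; exact: derivableM. Qed.

Lemma hol_inv g z : hol g z -> g z != 0 -> hol (fun x => (g x)^-1) z.
Proof. move=> [dg] gz; split; exact: derivableV. Qed.

Lemma hol_subC p z : hol (fun x => x - p) z.
Proof. exact: hol_add (hol_id z) (hol_cst _ z). Qed.

Lemma hol_div g h z : hol g z -> hol h z -> h z != 0 -> hol (fun x => g x / h x) z.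
Proof. by move=> hg hh hz; apply: hol_mul => //; exact: hol_inv. Qed.

Lemma hol_exp n z : hol (fun x => x ^+ n) z.
Proof.
elim: n => [|n IH].
  have -> : (fun x : K => x ^+ 0) = fun=> 1 by apply/funext => x; rewrite expr0.
  exact: hol_cst.
have -> : (fun x : K => x ^+ n.+1) = fun x => x * x ^+ n.
  by apply/funext => x; rewrite exprS.
exact: hol_mul (hol_id z) IH.
Qed.

End Hol.

(** * Goursat's theorem for rectangles *)

Section Goursat.
Context {R : realType}.
Local Notation C := (complex_complex__canonical__Num_NumField (reals_Real__to__Num_RealClosedField R)).
Implicit Types (g h : C -> C) (z w p : C) (a b c d m : R).

Lemma hol_approx g z : hol g z ->
  exists D : C, forall e : R, 0 < e -> exists2 t : R, 0 < t &
    forall w, nm (w - z) < t -> nm (g w - g z - D * (w - z)) <= e * nm (w - z).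
Proof.
move=> [dg]; exists ('D_1 (g : C^o -> C^o) z) => e e0.
have /cvgrPdist_lt /(_ e%:C) := dg; rewrite ltcR => /(_ e0).
rewrite near_withinE => /nbhs_ballP [[t ti]].
rewrite /= ltcE/= => /andP[/eqP ti0 t0] H.
have {}ti0 : ti = 0 by [].
rewrite {}ti0 in H.
exists t => // w wt.
have [->|wz] := eqVneq w z; first by rewrite !subrr mulr0 subr0 nm0 mulr0.
have := H (w - z).
rewrite /ball/= sub0r normrN -nmE ltcR => /(_ wt).
rewrite subr_eq0 => /(_ wz).
rewrite -nmE ltcR [in _%:A]/GRing.scale/= mulr1 subrK => h.
have -> : g w - g z - 'D_1 (g : C^o -> C^o) z * (w - z) =
  - ('D_1 (g : C^o -> C^o) z - (w - z)^-1 * (g w - g z)) * (w - z).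
  by field; rewrite subr_eq0.
by rewrite nmM nmN ler_wpM2r ?nm_ge0// ltW.
Qed.

Definition contAt g z := forall e : R, 0 < e -> exists2 t : R, 0 < t &
  forall w, nm (w - z) < t -> nm (g w - g z) < e.

Lemma hol_contAt g z : hol g z -> contAt g z.
Proof.
move=> [/derivable1_diffP/differentiable_continuous].
move=> /cvgrPdist_lt h e e0.
have := h e%:C; rewrite ltcR => /(_ e0) /nbhs_ballP [[t ti]].
rewrite /= ltcE/= => /andP[/eqP ti0 t0] H.
have {}ti0 : ti = 0 by [].
rewrite {}ti0 in H.
exists t => // w wt.
have := H w; rewrite /ball/= -nmE ltcR nmB => /(_ wt).
by rewrite -nmE ltcR nmB.
Qed.

Lemma nm_complex (x y : R) : nm (x +i* y) <= `|x| + `|y|.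
Proof. exact: nm_le_ReIm. Qed.

Lemma complexB (x y x' y' : R) : (x +i* y) - (x' +i* y') = (x - x') +i* (y - y').
Proof. by []. Qed.

Lemma nm_hor (x x' y : R) : nm ((x +i* y) - (x' +i* y)) = `|x - x'|.
Proof. by rewrite complexB subrr complexr0 nm_real. Qed.

Lemma nm_ver (x y y' : R) : nm ((x +i* y) - (x +i* y')) = `|y - y'|.
Proof.
rewrite complexB subrr -nm_real -[RHS]mul1r -nm_i -nmM; congr nm.
by apply/eqP; rewrite eq_complex/= !(mul0r,mulr0,mul1r,subrr,addr0,add0r,oppr0) !eqxx.
Qed.

Lemma ctsB (u v : R -> R[i]) a b : cts u a b -> cts v a b ->
  cts (fun x => u x - v x) a b.
Proof.
move=> cu cv x xab e e0.
have e20 : 0 < e / 2 by rewrite divr_gt0.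
have [t t0 ht] := cu x xab _ e20; have [s s0 hs] := cv x xab _ e20.
exists (Num.min t s); first by rewrite lt_min t0.
move=> y yab; rewrite lt_min => /andP[yt ys].
have := ht y yab yt; have := hs y yab ys; rewrite /dC => h1 h2.
rewrite (_ : _ - _ - _ = (u y - u x) + (v x - v y)); last by ring.
by rewrite (le_lt_trans (nmD _ _))// [ltRHS]splitr ltrD// nmB.
Qed.

Lemma cts_hor g c a b : (forall x, a <= x <= b -> contAt g (x +i* c)) ->
  cts (fun x => g (x +i* c)) a b.
Proof.
move=> cg x xab e e0; have [t t0 ht] := cg x xab e e0.
by exists t => // y yab yx; apply: ht; rewrite nm_hor.
Qed.

Lemma cts_ver g a c d : (forall y, c <= y <= d -> contAt g (a +i* y)) ->
  cts (fun y => g (a +i* y)) c d.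
Proof.
move=> cg x xab e e0; have [t t0 ht] := cg x xab e e0.
by exists t => // y yab yx; apply: ht; rewrite nm_ver.
Qed.

Definition hd g c d x := g (x +i* c) - g (x +i* d).
Definition vd g a b y := g (b +i* y) - g (a +i* y).

(* The integral of [g] along the boundary of [a, b] x [c, d]. *)
Definition rect_int g a b c d : C :=
  cint (hd g c d) a b + 'i * cint (vd g a b) c d.

Definition bdry_cts g a b c d :=
  (forall x, a <= x <= b -> contAt g (x +i* c) /\ contAt g (x +i* d)) /\
  (forall y, c <= y <= d -> contAt g (a +i* y) /\ contAt g (b +i* y)).

Lemma cts_hd g a b c d : bdry_cts g a b c d -> cts (hd g c d) a b.
Proof. by move=> [H _]; apply: ctsB; apply: cts_hor => x /H[]. Qed.

Lemma cts_vd g a b c d : bdry_cts g a b c d -> cts (vd g a b) c d.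
Proof. by move=> [_ H]; apply: ctsB; apply: cts_ver => x /H[]. Qed.

Lemma rect_int_splith g a b c d m : a <= m -> m <= b ->
  bdry_cts g a b c d -> (forall y, c <= y <= d -> contAt g (m +i* y)) ->
  rect_int g a b c d = rect_int g a m c d + rect_int g m b c d.
Proof.
move=> am mb [H V] M; rewrite /rect_int (cint_split am mb); last exact: cts_hd.
have c1 : cts (vd g a m) c d.
  by apply: ctsB; apply: cts_ver => y ycd; [exact: M|case: (V y ycd)].
have c2 : cts (vd g m b) c d.
  by apply: ctsB; apply: cts_ver => y ycd; [case: (V y ycd)|exact: M].
rewrite -[in RHS]addrACA -mulrDr -cintD//; congr (_ + _ * _).
by apply: eq_cint => y _; rewrite /vd; ring.
Qed.

Lemma rect_int_splitv g a b c d m : c <= m -> m <= d ->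
  bdry_cts g a b c d -> (forall x, a <= x <= b -> contAt g (x +i* m)) ->
  rect_int g a b c d = rect_int g a b c m + rect_int g a b m d.
Proof.
move=> cm md [H V] M; rewrite /rect_int (cint_split cm md); last exact: cts_vd.
have c1 : cts (hd g c m) a b.
  by apply: ctsB; apply: cts_hor => y ycd; [case: (H y ycd)|exact: M].
have c2 : cts (hd g m d) a b.
  by apply: ctsB; apply: cts_hor => y ycd; [exact: M|case: (H y ycd)].
rewrite -[in RHS]addrACA mulrDr -cintD//; congr (_ + _).
by apply: eq_cint => y _; rewrite /hd; ring.
Qed.

Lemma rect_intD g h a b c d : bdry_cts g a b c d -> bdry_cts h a b c d ->
  rect_int (fun z => g z + h z) a b c d = rect_int g a b c d + rect_int h a b c d.
Proof.
move=> cg ch; rewrite /rect_int -[in RHS]addrACA -mulrDr -!cintD//; try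
  first [exact: cts_vd|exact: cts_hd].
by congr (_ + _ * _); apply: eq_cint => x _; rewrite /hd /vd; ring.
Qed.

Lemma rect_intZ k g a b c d : bdry_cts g a b c d ->
  rect_int (fun z => k * g z) a b c d = k * rect_int g a b c d.
Proof.
move=> cg; rewrite /rect_int mulrDr mulrCA -!(cintZ k)//; try
  first [exact: cts_vd|exact: cts_hd].
by congr (_ + _ * _); apply: eq_cint => x _; rewrite /hd /vd mulrBr.
Qed.

Definition on_bdry (P : C -> Prop) a b c d :=
  (forall x, a <= x <= b -> P (x +i* c) /\ P (x +i* d)) /\
  (forall y, c <= y <= d -> P (a +i* y) /\ P (b +i* y)).

Lemma eq_rect_int g h a b c d : on_bdry (fun z => g z = h z) a b c d ->
  rect_int g a b c d = rect_int h a b c d.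
Proof.
move=> [H V]; congr (_ + _ * _); apply: eq_cint => x.
  by move=> /H[e1 e2]; rewrite /hd e1 e2.
by move=> /V[e1 e2]; rewrite /vd e1 e2.
Qed.

Lemma rect_int_bound g a b c d M : a <= b -> c <= d -> bdry_cts g a b c d ->
  on_bdry (fun z => nm (g z) <= M) a b c d ->
  nm (rect_int g a b c d) <= 4 * M * ((b - a) + (d - c)).
Proof.
move=> ab cd cg [H V]; rewrite (le_trans (nmD _ _))// nmM nm_i mul1r mulrDr.
have e : 4 * M = 2 * (M + M) by ring.
rewrite e; apply: lerD; apply: cint_bound => //; try first [exact: cts_vd|exact: cts_hd].
  by move=> x /H[h1 h2]; rewrite (le_trans (nmD _ _))// nmN lerD.
by move=> x /V[h1 h2]; rewrite (le_trans (nmD _ _))// nmN lerD.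
Qed.

Lemma rect_int_affine (l q : C) a b c d : a <= b -> c <= d ->
  rect_int (fun z => l + q * z) a b c d = 0.
Proof.
move=> ab cd; rewrite /rect_int.
rewrite (@eq_cint _ _ (fun=> q * 'i * (c - d)%:C)); last first.
  move=> x _; rewrite /hd (_ : _ - _ = q * ((x +i* c) - (x +i* d))); last by ring.
  rewrite -mulrA complexB subrr; congr (_ * _).
  by apply/eqP; rewrite eq_complex/= !(mul0r,mulr0,mul1r,subrr,addr0,add0r,oppr0) !eqxx.
rewrite (@eq_cint _ (vd _ _ _) (fun=> q * (b - a)%:C)); last first.
  move=> x _; rewrite /vd (_ : _ - _ = q * ((b +i* x) - (a +i* x))); last by ring.
  by rewrite complexB subrr.
rewrite !cint_cst// (_ : c - d = - (d - c)); last by ring.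
by rewrite rmorphN/=; ring.
Qed.

Definition in_rect a b c d z := a <= ReC z <= b /\ c <= ImC z <= d.

Lemma bdry_cts_in g a b c d : a <= b -> c <= d ->
  (forall z, in_rect a b c d z -> contAt g z) -> bdry_cts g a b c d.
Proof.
move=> ab cd H; split=> x xab; split; apply: H; split => //=; rewrite ?lexx ?ab ?cd//.
Qed.

(** The contributions of the inner sides cancel, so the four quarters add up, and one of them
    carries at least a quarter of the modulus. *)
Lemma quadrisect g a b c d : a <= b -> c <= d ->
  (forall z, in_rect a b c d z -> contAt g z) ->
  exists q : R * R, [/\ a <= q.1, q.1 + (b - a) / 2 <= b, c <= q.2,
    q.2 + (d - c) / 2 <= d &
    nm (rect_int g a b c d) <=
    4 * nm (rect_int g q.1 (q.1 + (b - a) / 2) q.2 (q.2 + (d - c) / 2))].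
Proof.
move=> ab cd H; set m := a + (b - a) / 2; set n := c + (d - c) / 2.
have [am mb cn nd] : [/\ a <= m, m <= b, c <= n & n <= d] by rewrite /m /n; split; lra.
have e1 : m + (b - a) / 2 = b by rewrite /m; field.
have e2 : n + (d - c) / 2 = d by rewrite /n; field.
have Hs a' b' c' d' : a <= a' -> b' <= b -> c <= c' -> d' <= d -> a' <= b' -> c' <= d' ->
    bdry_cts g a' b' c' d'.
  move=> aa bb cc dd ab' cd'; apply: bdry_cts_in => // z [/andP[z1 z2] /andP[z3 z4]].
  by apply: H; split; apply/andP; split; lra.
have -> : rect_int g a b c d = (rect_int g a m c n + rect_int g a m n d) +
    (rect_int g m b c n + rect_int g m b n d).
  rewrite (rect_int_splith am mb); [|exact: Hs|]; last first.
    by move=> y ycd; apply: H; split=> //=; rewrite am mb.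
  rewrite (rect_int_splitv cn nd); [|exact: Hs|]; last first.
    by move=> x /andP[x1 x2]; apply: H; split=> /=; rewrite ?cn ?nd ?x1//= (le_trans x2).
  rewrite (rect_int_splitv (a := m) cn nd); [by []|exact: Hs|].
  by move=> x /andP[x1 x2]; apply: H; split=> /=; rewrite ?cn ?nd ?x2//= ?andbT (le_trans am).
set i1 := rect_int g a m c n; set i2 := rect_int g a m n d.
set i3 := rect_int g m b c n; set i4 := rect_int g m b n d.
have tri : nm (i1 + i2 + (i3 + i4)) <= nm i1 + nm i2 + (nm i3 + nm i4).
  by rewrite (le_trans (nmD _ _))// lerD// nmD.
set N := nm _ in tri *.
have [h|h1] := leP N (4 * nm i1); first by exists (a, c); rewrite /= -/m -/n; split.
have [h|h2] := leP N (4 * nm i2); first by exists (a, n); rewrite /= -/m e2; split.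
have [h|h3] := leP N (4 * nm i3); first by exists (m, c); rewrite /= -/n e1; split.
have [h|h4] := leP N (4 * nm i4); first by exists (m, n); rewrite /= e1 e2; split.
by lra.
Qed.

Lemma exp2_large (x : R) : exists k, x < 2 ^+ k.
Proof.
have [k hk] : exists k : nat, x < k%:R.
  exists (Num.bound `|x|); apply: le_lt_trans (ler_norm x) _.
  exact: archi_boundP.
exists k; apply: lt_le_trans hk _.
by rewrite -natrX ler_nat ltnW// ltn_expl.
Qed.

(** Nested quartering closes in on a point near which [g] is affine up to an error small against the
    distance. The affine part integrates to zero, and the error contributes at most
    [4 P^2 e' / 4^k], which absorbs the factor [4^k] lost in [k] quarterings. *)
Lemma goursat g a b c d : a <= b -> c <= d ->
  (forall z, in_rect a b c d z -> hol g z) -> rect_int g a b c d = 0.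
Proof.
move=> ab cd H.
have Hc z : in_rect a b c d z -> contAt g z by move=> /H/hol_contAt.
pose w k := (b - a) / 2 ^+ k; pose t k := (d - c) / 2 ^+ k.
have w0 k : 0 <= w k by rewrite divr_ge0 ?exprn_ge0// subr_ge0.
have t0 k : 0 <= t k by rewrite divr_ge0 ?exprn_ge0// subr_ge0.
have wS k : w k / 2 = w k.+1 by rewrite /w exprSr invfM mulrA.
have tS k : t k / 2 = t k.+1 by rewrite /t exprSr invfM mulrA.
pose J k (q : R * R) := nm (rect_int g q.1 (q.1 + w k) q.2 (q.2 + t k)).
pose good (x : nat * (R * R)) := [/\ a <= x.2.1, x.2.1 + w x.1 <= b,
  c <= x.2.2 & x.2.2 + t x.1 <= d].
(* Conditional on [good x], so that every state has a successor, as dependent choice requires. *)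
pose rel (x y : nat * (R * R)) := good x ->
  [/\ good y, y.1 = x.1.+1, x.2.1 <= y.2.1 /\ x.2.2 <= y.2.2,
   y.2.1 + w y.1 <= x.2.1 + w x.1 /\ y.2.2 + t y.1 <= x.2.2 + t x.1 &
   J x.1 x.2 <= 4 * J y.1 y.2].
have step x : {y | rel x y}.
  apply: cid; have [gx|ngx] := pselect (good x); last by exists x.
  have [g1 g2 g3 g4] := gx.
  have [|||q] := @quadrisect g x.2.1 (x.2.1 + w x.1) x.2.2 (x.2.2 + t x.1).
  - by rewrite lerDl.
  - by rewrite lerDl.
  - by move=> z [/andP[z1 z2] /andP[z3 z4]]; apply: Hc; split; apply/andP; split; lra.
  rewrite ![_ + _ - _]addrAC !subrr !add0r wS tS => -[q1 q2 q3 q4 q5].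
  exists (x.1.+1, q) => _; split => //; split => /=; lra.
have [F [F0 Fs]] := dependent_choice step (0%N, (a, c)).
have good0 : good (0%N, (a, c)).
  by rewrite /good /= /w /t expr0 !divr1; split; lra.
have Fg k : good (F k) /\ (F k).1 = k.
  elim: k => [|k [gk ek]]; first by rewrite F0.
  by have [gS eS _ _ _] := Fs k gk; rewrite eS ek.
pose A k := (F k).2.1; pose B k := (F k).2.2.
have FS k : [/\ A k <= A k.+1, B k <= B k.+1, A k.+1 + w k.+1 <= A k + w k,
    B k.+1 + t k.+1 <= B k + t k & J k (F k).2 <= 4 * J k.+1 (F k.+1).2].
  have [gk ek] := Fg k; have [_ _ [h1 h2] [h3 h4] h5] := Fs k gk.
  by move: h3 h4 h5; rewrite (Fg k.+1).2 ek.
have mono (u : nat -> R) : (forall k, u k <= u k.+1) -> forall j k, (j <= k)%N -> u j <= u k.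
  by move=> hu j k jk; apply: (@nondecreasing_seqP _ _ u).1.
have limit (u v : nat -> R) : (forall k, u k <= u k.+1) -> (forall k, v k.+1 <= v k) ->
    (forall k, u k <= v k) -> exists x, forall k, u k <= x <= v k.
  move=> hu hv huv; have uv j k : u j <= v k.
    have [jk|kj] := leqP j k; first by rewrite (le_trans (mono _ hu _ _ jk)).
    rewrite (le_trans (huv j))// -lerN2.
    apply: (mono (fun k => - v k)); last exact: ltnW.
    by move=> i; rewrite lerN2.
  exists (sup (range u)) => k; apply/andP; split.
    apply: ub_le_sup; last by exists k.
    by exists (v 0%N) => _ [j _ <-].
  by apply: ge_sup; [exists (u 0%N), 0%N|move=> _ [j _ <-]].
have [x hx] : exists x, forall k, A k <= x <= A k + w k.
  by apply: limit => k; have [] := FS k; rewrite ?lerDl.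
have [y hy] : exists y, forall k, B k <= y <= B k + t k.
  by apply: limit => k; have [] := FS k; rewrite ?lerDl.
have Jk k : J 0%N (a, c) <= 4 ^+ k * J k (F k).2.
  elim: k => [|k IH]; first by rewrite expr0 mul1r F0.
  rewrite (le_trans IH)// exprSr -mulrA ler_wpM2l ?exprn_ge0//.
  by have [] := FS k.
have xy_in : in_rect a b c d (x +i* y).
  have := hx 0%N; have := hy 0%N; rewrite /A /B F0 /= /w /t expr0 !divr1.
  by rewrite ![_ + (_ - _)]addrC !subrK.
have [D hD] := hol_approx (H _ xy_in).
pose P := (b - a) + (d - c).
have P0 : 0 <= P by rewrite /P; lra.
apply/eqP; rewrite -nm_eq0 -(_ : J 0%N (a, c) = nm _); last first.
  by rewrite /J /= /w /t expr0 !divr1 ![_ + (_ - _)]addrC !subrK.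
rewrite eq_le (nm_ge0 _) andbT; apply/ler_addgt0Pr => e e0; rewrite add0r.
(* The final bound is [4 P^2 e']; the added [1] covers a degenerate rectangle. *)
have e'0 : 0 < e / (4 * P ^+ 2 + 1) by rewrite divr_gt0// ltr_wpDl// mulr_ge0// sqr_ge0.
have [s s0 hs] := hD _ e'0.
have [k hk] := exp2_large (P / s).
have hPk : P / 2 ^+ k < s.
  by rewrite ltr_pdivrMr ?exprn_gt0// mulrC -ltr_pdivrMr.
have [/= k1 k2 k3 k4] := (Fg k).1; rewrite (Fg k).2 in k2 k4.
have PE : w k + t k = P / 2 ^+ k by rewrite /P mulrDl.
set e' := e / _ in e'0 hs.
have near_z z : in_rect (A k) (A k + w k) (B k) (B k + t k) z ->
    nm (z - (x +i* y)) <= P / 2 ^+ k.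
  case: z => z1 z2 [/andP[/= z3 z4] /andP[/= z5 z6]].
  have /andP[x1 x2] := hx k; have /andP[y1 y2] := hy k.
  rewrite complexB (le_trans (nm_complex _ _))// -PE.
  by rewrite lerD// ler_norml; apply/andP; split; lra.
have key : J k (F k).2 <= 4 * (e' * (P / 2 ^+ k)) * (P / 2 ^+ k).
  have Ek : J k (F k).2 = nm (rect_int (fun z => g z +
      ((- g (x +i* y) + D * (x +i* y)) + (- D) * z)) (A k) (A k + w k) (B k) (B k + t k)).
    have Ak : A k <= A k + w k by rewrite lerDl.
    have Bk : B k <= B k + t k by rewrite lerDl.
    rewrite rect_intD ?rect_int_affine ?addr0//.
    - apply: bdry_cts_in => // z [/andP[z1 z2] /andP[z3 z4]].
      by apply: Hc; split; apply/andP; split; rewrite /A /B in z1 z2 z3 z4; lra.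
    - apply: bdry_cts_in => // z _; apply: hol_contAt.
      exact: hol_add (hol_cst _ _) (hol_mul (hol_cst _ _) (hol_id _)).
  rewrite Ek (_ : 4 * (e' * (P / 2 ^+ k)) * (P / 2 ^+ k) =
    4 * (e' * (P / 2 ^+ k)) * ((A k + w k - A k) + (B k + t k - B k))); last first.
    by rewrite -PE; ring.
  have zin z : in_rect (A k) (A k + w k) (B k) (B k + t k) z ->
      nm (g z + (- g (x +i* y) + D * (x +i* y) + - D * z)) <= e' * (P / 2 ^+ k).
    move=> zin; have h := near_z z zin.
    rewrite (_ : _ + _ = g z - g (x +i* y) - D * (z - (x +i* y))); last by ring.
    rewrite (le_trans (hs _ _))//; first exact: le_lt_trans h hPk.
    by rewrite ler_wpM2l// ltW.
  apply: rect_int_bound; rewrite ?lerDl//.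
    apply: bdry_cts_in; rewrite ?lerDl// => z [/andP[z1 z2] /andP[z3 z4]].
    apply: hol_contAt; apply: hol_add; last first.
      exact: hol_add (hol_cst _ _) (hol_mul (hol_cst _ _) (hol_id _)).
    by apply: H; split; apply/andP; split; rewrite /A /B in z1 z2 z3 z4; lra.
  by split=> u hu; split; apply: zin; split; rewrite /= ?lexx ?lerDl ?w0 ?t0.
apply: le_trans (Jk k) _; apply: le_trans (_ : 4 ^+ k * (4 * (e' * (P / 2 ^+ k)) * (P / 2 ^+ k)) <= _).
  by rewrite ler_wpM2l// exprn_ge0.
have -> : 4 ^+ k * (4 * (e' * (P / 2 ^+ k)) * (P / 2 ^+ k)) = e' * (4 * P ^+ 2).
  have -> : (4 : R) ^+ k = 2 ^+ k * 2 ^+ k by rewrite -exprMn; congr (_ ^+ _); ring.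
  by field; rewrite expf_neq0.
rewrite /e' mulrAC ler_pdivrMr; last by rewrite ltr_wpDl// mulr_ge0// sqr_ge0.
by rewrite ler_wpM2l ?lerDl// ltW.
Qed.

End Goursat.

(** * Deforming rectangles around a puncture *)

Section RectShrink.
Context {R : realType}.
Local Notation C := (complex_complex__canonical__Num_NumField (reals_Real__to__Num_RealClosedField R)).
Implicit Types (f g h : C -> C) (z w p : C) (a b c d m r s : R).

Lemma bdry_cts_off g p a b c d : (forall z, z != p -> hol g z) ->
  a < ReC p < b -> c < ImC p < d -> bdry_cts g a b c d.
Proof.
move=> H /andP[pa pb] /andP[pc pd].
by split=> x _; split; apply: hol_contAt; apply: H;
  rewrite eq_complex/= negb_and ?(lt_eqF pa) ?(gt_eqF pb) ?(lt_eqF pc) ?(gt_eqF pd) ?orbT.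
Qed.

(** The frame between the two rectangles is cut into four rectangles that avoid [p], each with zero
    integral by [goursat]. *)
Lemma rect_int_shrink g p a b c d a' b' c' d' : (forall z, z != p -> hol g z) ->
  a <= a' -> a' < ReC p < b' -> b' <= b -> c <= c' -> c' < ImC p < d' -> d' <= d ->
  rect_int g a b c d = rect_int g a' b' c' d'.
Proof.
move=> H aa /andP[pa pb] bb cc /andP[pc pd] dd.
have pab : a < ReC p < b by rewrite (le_lt_trans aa)//= (lt_le_trans pb).
have pa'b : a' < ReC p < b by rewrite pa/= (lt_le_trans pb).
have pa'b' : a' < ReC p < b' by rewrite pa.
have pcd : c < ImC p < d by rewrite (le_lt_trans cc)//= (lt_le_trans pd).
have pc'd : c' < ImC p < d by rewrite pc/= (lt_le_trans pd).
have bdry := bdry_cts_off H.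
have ver x : x != ReC p -> forall y, contAt g (x +i* y).
  by move=> xp y; apply: hol_contAt; apply: H; rewrite eq_complex negb_and/= xp.
have hor y : y != ImC p -> forall x, contAt g (x +i* y).
  by move=> yp x; apply: hol_contAt; apply: H; rewrite eq_complex negb_and/= yp orbT.
have Hh x y u v : x <= y -> u <= v -> [|| y < ReC p, ReC p < x, v < ImC p | ImC p < u] ->
    rect_int g x y u v = 0.
  move=> xy uv hp; apply: goursat => // z [/andP[z1 z2] /andP[z3 z4]].
  by apply: H; apply/eqP => zp; rewrite zp in z1 z2 z3 z4; move: hp;
    move=> /or4P[]; rewrite ltNge ?z1 ?z2 ?z3 ?z4.
have [a'b cd' c'd] : [/\ a' <= b, c <= d & c' <= d] by split; lra.
have [a'b' cc' c'd'] : [/\ a' <= b', c <= c' & c' <= d'] by split; lra.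
rewrite (rect_int_splith (m := a') aa a'b (bdry _ _ _ _ pab pcd)); last first.
  by move=> y _; apply: ver; rewrite lt_eqF.
rewrite (@Hh a a' c d) ?pa ?add0r//.
rewrite (rect_int_splith (m := b') a'b' bb (bdry _ _ _ _ pa'b pcd)); last first.
  by move=> y _; apply: ver; rewrite gt_eqF.
rewrite (@Hh b' b c d) ?pb ?orbT ?addr0//.
rewrite (rect_int_splitv (m := c') cc c'd (bdry _ _ _ _ pa'b' pcd)); last first.
  by move=> y _; apply: hor; rewrite lt_eqF.
rewrite (@Hh a' b' c c') ?pc ?orbT ?add0r//.
rewrite (rect_int_splitv (m := d') c'd' dd (bdry _ _ _ _ pa'b' pc'd)); last first.
  by move=> y _; apply: hor; rewrite gt_eqF.
by rewrite (@Hh a' b' d' d) ?pd ?orbT ?addr0.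
Qed.

Definition sq g r : C := rect_int g (- r) r (- r) r.

Lemma sq_bdry (P : C -> Prop) r : 0 < r -> (forall z, r <= nm z <= 2 * r -> P z) ->
  on_bdry P (- r) r (- r) r.
Proof.
move=> r0 H.
have H' u v : `|u| = r -> `|v| <= r -> P (u +i* v) /\ P (v +i* u).
  move=> ur vr; split; apply: H.
    rewrite (le_trans _ (Re_le_nm _)) ?ur//= (le_trans (nm_complex _ _))// ur.
    by rewrite mulr_natl mulr2n lerD2l.
  rewrite (le_trans _ (Im_le_nm _)) ?ur//= (le_trans (nm_complex _ _))// ur.
  by rewrite mulr_natl mulr2n lerD2r.
split => x; rewrite -ler_norml => xr.
  by split; [case: (H' (- r) x) => //; rewrite normrN|case: (H' r x) => //]; rewrite gtr0_norm.
by split; [case: (H' (- r) x) => //; rewrite normrN|case: (H' r x) => //]; rewrite gtr0_norm.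
Qed.

Lemma sq_bound g r M : 0 < r -> (forall z, r <= nm z <= 2 * r -> contAt g z) ->
  (forall z, r <= nm z <= 2 * r -> nm (g z) <= M) -> nm (sq g r) <= 16 * M * r.
Proof.
move=> r0 cg gM; have -> : 16 * M * r = 4 * M * ((r - - r) + (r - - r)) by ring.
by apply: rect_int_bound; rewrite ?ge0_cp ?ltW//; try exact: sq_bdry; rewrite ?gt0_cp.
Qed.

Lemma sq_cst g p r s : (forall z, z != p -> hol g z) -> nm p < r -> r <= s ->
  sq g s = sq g r.
Proof.
move=> H pr rs; apply: (rect_int_shrink (p := p)) => //; rewrite ?lerN2//.
  by rewrite -ltr_norml (le_lt_trans (Re_le_nm _)).
by rewrite -ltr_norml (le_lt_trans (Im_le_nm _)).
Qed.

(** A puncture near which [g] stays bounded is removable: the square shrinks to one of half-width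
    [s] about [p], where the integral is at most [16 (|L| + 1) s]. *)
Lemma sq_eq0_of_bound_near g p r L : nm p < r -> (forall z, z != p -> hol g z) ->
  (exists2 t, 0 < t & forall z, z != p -> nm (z - p) < t -> nm (g z) <= L) ->
  sq g r = 0.
Proof.
move=> pr H [t t0 gL].
have L1 : 0 < `|L| + 1 by rewrite ltr_wpDl.
apply/eqP; rewrite -nm_eq0 eq_le nm_ge0 andbT; apply/ler_addgt0Pr => e e0; rewrite add0r.
have [x y] : ((- r < ReC p < r) /\ (- r < ImC p < r)).
  by rewrite -!ltr_norml (le_lt_trans (Re_le_nm _))// (le_lt_trans (Im_le_nm _)).
pose s := Num.min (t / 3) (Num.min (e / (16 * (`|L| + 1)))
  (Num.min (Num.min (ReC p + r) (r - ReC p)) (Num.min (ImC p + r) (r - ImC p)))).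
have q1 : 0 < t / 3 by rewrite divr_gt0.
have q2 : 0 < e / (16 * (`|L| + 1)) by rewrite divr_gt0// mulr_gt0.
have s0 : 0 < s by rewrite /s !lt_min q1 q2 /=; apply/andP; split; apply/andP; split; lra.
have : s <= s by [].
rewrite {2}/s !le_min => /and3P[s1 s2 /andP[/andP[s3 s4] /andP[s5 s6]]].
rewrite (_ : sq g r = rect_int g (ReC p - s) (ReC p + s) (ImC p - s) (ImC p + s)); last first.
  by apply: (rect_int_shrink (p := p)) => //; lra.
have pE : p = ReC p +i* ImC p by case: (p).
have onb : on_bdry (fun z => z != p /\ nm (z - p) < t) (ReC p - s) (ReC p + s) (ImC p - s) (ImC p + s).
  have bnd u v : `|u| = s -> `|v| <= s ->
    ((ReC p + u) +i* (ImC p + v) != p /\ nm ((ReC p + u) +i* (ImC p + v) - p) < t) /\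
    ((ReC p + v) +i* (ImC p + u) != p /\ nm ((ReC p + v) +i* (ImC p + u) - p) < t).
    move=> us vs; have u0 : u != 0 by rewrite -normr_gt0 us.
    have nu x' : (x' + u == x') = false by rewrite -subr_eq0 addrAC subrr add0r (negbTE u0).
    rewrite !eq_complex/= !nu andbF.
    do 2 split => //.
      rewrite {3}pE complexB (le_lt_trans (nm_complex _ _))//.
      by rewrite ![_ + _ - _]addrAC !subrr !add0r us; lra.
    rewrite {3}pE complexB (le_lt_trans (nm_complex _ _))//.
    by rewrite ![_ + _ - _]addrAC !subrr !add0r us; lra.
  split=> u hu.
    have hv : `|u - ReC p| <= s by rewrite ler_norml; lra.
    have := bnd (- s) _ _ hv; rewrite normrN gtr0_norm// => /(_ erefl)[_].
    have := bnd s _ _ hv; rewrite gtr0_norm// => /(_ erefl)[_].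
    by rewrite [_ + (_ - _)]addrC subrK.
  have hv : `|u - ImC p| <= s by rewrite ler_norml; lra.
  have := bnd (- s) _ _ hv; rewrite normrN gtr0_norm// => /(_ erefl)[+ _].
  have := bnd s _ _ hv; rewrite gtr0_norm// => /(_ erefl)[+ _].
  by rewrite [_ + (_ - _)]addrC subrK.
have L16 : e = 16 * (`|L| + 1) * (e / (16 * (`|L| + 1))).
  by rewrite mulrC divfK// gt_eqF// mulr_gt0.
apply: le_trans (_ : 4 * (`|L| + 1) * (((ReC p + s) - (ReC p - s)) + ((ImC p + s) - (ImC p - s))) <= _).
  apply: rect_int_bound; try lra.
    by have [h1 h2] := onb; split=> u hu; [have := h1 u hu|have := h2 u hu];
      move=> [[n1 _] [n2 _]]; split; apply: hol_contAt; apply: H.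
  by have [h1 h2] := onb; split=> u hu; [have := h1 u hu|have := h2 u hu];
    move=> [[n1 m1] [n2 m2]]; split; rewrite (le_trans (gL _ _ _))//;
    rewrite (le_trans (ler_norm _))// lerDl.
rewrite [leRHS]L16 (_ : 4 * _ * _ = 16 * (`|L| + 1) * s); last by ring.
by rewrite ler_wpM2l// mulr_ge0// ltW.
Qed.

End RectShrink.

(** * Cauchy's formula and entire functions of polynomial growth *)

Section Liouville.
Context {R : realType}.
Local Notation C := (complex_complex__canonical__Num_NumField (reals_Real__to__Num_RealClosedField R)).
Implicit Types (f g h : C -> C) (z w p : C) (a b c d m r s : R).

(** Classically [2 pi i], the constant of Cauchy's formula. *)
Definition c0 : C := sq (fun z => z^-1) 1.

(** The imaginary part is the sum of two integrals of [2 / (x^2 + 1)] over [[-1, 1]], where the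
    integrand is at least [1]. *)
Lemma c0_neq0 : c0 != 0.
Proof.
have cb : bdry_cts (fun z : C => z^-1) (-1) 1 (-1) 1.
  apply: sq_bdry => // z /andP[z1 _]; apply: hol_contAt; apply: hol_inv (hol_id _) _.
  by rewrite -nm_gt0 (lt_le_trans _ z1).
have ge1 x : -1 <= x <= 1 -> 1 <= (2 : R) / (x ^+ 2 + 1).
  move=> /andP[x1 x2]; have xx : x ^+ 2 <= 1.
    by rewrite -subr_ge0 (_ : _ - _ = (1 - x) * (1 + x)); [apply: mulr_ge0; lra|ring].
  by rewrite ler_pdivlMr ?ltr_wpDl ?sqr_ge0// mul1r; lra.
suff : 0 < ImC c0 by apply: contraTneq => ->; rewrite ltxx.
rewrite /c0 /sq /rect_int.
have -> : ImC (cint (hd (fun z : C => z^-1) (-1) 1) (-1) 1 +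
   'i * cint (vd (fun z : C => z^-1) (-1) 1) (-1) 1) =
   rint (ImC \o hd (fun z : C => z^-1) (-1) 1) (-1) 1 +
   rint (ReC \o vd (fun z : C => z^-1) (-1) 1) (-1) 1.
  by rewrite /cint/= mul1r mul0r add0r.
have one : rint (fun=> 1 : R) (-1) 1 = 2 by rewrite rint_cst; [ring|lra].
have h1 : 2 <= rint (ImC \o hd (fun z : C => z^-1) (-1) 1) (-1) 1.
  rewrite -one; apply: le_rint; [exact: cts_cst|apply: cts_Im; exact: cts_hd|].
  move=> x x1 /=; rewrite (le_trans (ge1 x x1))// sqrrN expr1n.
  by rewrite le_eqVlt; apply/orP; left; apply/eqP; field; nra.
have h2 : 2 <= rint (ReC \o vd (fun z : C => z^-1) (-1) 1) (-1) 1.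
  rewrite -one; apply: le_rint; [exact: cts_cst|apply: cts_Re; exact: cts_vd|].
  move=> x x1 /=; rewrite (le_trans (ge1 x x1))// sqrrN expr1n.
  by rewrite le_eqVlt; apply/orP; left; apply/eqP; field; nra.
by lra.
Qed.

(** The coefficient integrals do not depend on the square, and the remainder [E K.+1] decays like
    [1 / s] by the growth of [f]; enlarging the square makes the finite expansion exact. *)
Lemma cauchy_expansion f (K : nat) (A : R) : 0 <= A ->
  (forall z, hol f z) -> (forall z, 1 <= nm z -> nm (f z) <= A * nm z ^+ K) ->
  forall p r, 2 * nm p + 1 < r ->
  sq (fun z => f z / (z - p)) r =
  \sum_(j < K.+1) p ^+ j * sq (fun z => f z / z ^+ j.+1) 1.
Proof.
move=> A0 hf gf p r pr.
have p0 : 0 <= nm p := nm_ge0 p.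
pose E N z := p ^+ N * (f z / (z ^+ N * (z - p))).
have zp s z : r <= s -> s <= nm z -> z - p != 0 /\ z != 0.
  move=> rs sz; split; last by rewrite -nm_gt0; lra.
  by rewrite subr_eq0; apply/eqP => zp; rewrite zp in sz; lra.
have hE N s z : r <= s -> s <= nm z -> hol (fun z => f z / (z ^+ N * (z - p))) z.
  move=> rs sz; have [z1 z2] := zp s z rs sz.
  apply: hol_div => //; last by rewrite mulf_neq0// expf_neq0.
  by apply: hol_mul; [exact: hol_exp|exact: hol_subC].
have hF N s z : r <= s -> s <= nm z -> hol (fun z => f z / z ^+ N) z.
  move=> rs sz; have [z1 z2] := zp s z rs sz.
  by apply: hol_div; [exact: hf|exact: hol_exp|rewrite expf_neq0].
have bd g s : r <= s -> (forall z, s <= nm z -> hol g z) -> bdry_cts g (-s) s (-s) s.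
  move=> rs H; apply: sq_bdry; first by lra.
  by move=> z /andP[z1 _]; apply: hol_contAt; apply: H.
have step N s : r <= s -> sq (E N) s =
    p ^+ N * sq (fun z => f z / z ^+ N.+1) 1 + sq (E N.+1) s.
  move=> rs.
  rewrite -(sq_cst (p := 0) (r := 1) (s := s)); [|move=> z z0|by rewrite nm0|lra]; last first.
    by apply: hol_div; [exact: hf|exact: hol_exp|rewrite expf_neq0].
  rewrite -rect_intZ; last by apply: bd => // z; exact: hF.
  rewrite -rect_intD; [|apply: bd => // z sz..]; last 2 first.
  - by apply: hol_mul; [exact: hol_cst|exact: hF sz].
  - by apply: hol_mul; [exact: hol_cst|exact: hE sz].
  apply: eq_rect_int; apply: sq_bdry; first by lra.
  move=> z /andP[sz _]; have [z1 z2] := zp s z rs sz.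
  by rewrite /E !exprS; field; rewrite z1 z2 expf_neq0.
have sumE N s : r <= s -> sq (E 0%N) s =
    \sum_(j < N) p ^+ j * sq (fun z => f z / z ^+ j.+1) 1 + sq (E N) s.
  move=> rs; elim: N => [|N IH]; first by rewrite big_ord0 add0r.
  by rewrite big_ord_recr/= IH step// addrA.
have E0 : (fun z => f z / (z - p)) = E 0%N.
  by apply/funext => z; rewrite /E !expr0 !mul1r.
have cst s : r <= s -> sq (E 0%N) s = sq (E 0%N) r.
  move=> rs; rewrite -E0; apply: (sq_cst (p := p)) => //; last by lra.
  move=> z zp'; apply: hol_div; [exact: hf|exact: hol_subC|].
  by rewrite subr_eq0.
rewrite E0.
apply/eqP; rewrite -subr_eq0 -nm_eq0 eq_le nm_ge0 andbT.
apply/ler_addgt0Pr => e e0; rewrite add0r.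
(* [M / s] bounds the remainder on the square of half-width [s], and [s = r + M / e] makes it at
   most [e]. The factor [32] is [16] times the [2] from [|z - p| >= s / 2]. *)
pose M := 32 * A * 2 ^+ K * nm p ^+ K.+1.
have M0 : 0 <= M by rewrite !mulr_ge0// exprn_ge0.
pose s := r + M / e.
have rs : r <= s by rewrite lerDl divr_ge0// ltW.
have s0 : 0 < s by lra.
rewrite -(cst s rs) (sumE K.+1 s rs) addrC addKr.
apply: le_trans (_ : 16 * (nm p ^+ K.+1 * (A * (2 * s) ^+ K / (s ^+ K.+1 * (s / 2)))) * s <= _).
  apply: sq_bound => // z /andP[z1 z2].
    by apply: hol_contAt; apply: hol_mul; [exact: hol_cst|exact: hE z1].
  rewrite nmM nmX ler_wpM2l ?exprn_ge0// nmM nmV ler_pM ?nm_ge0 ?invr_ge0 ?nm_ge0//.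
    rewrite (le_trans (gf _ _))//; first by lra.
    by rewrite ler_wpM2l// lerXn2r ?nnegrE ?nm_ge0//; lra.
  rewrite lef_pV2 ?posrE; last 2 first.
  - by rewrite nm_gt0; have [u1 u2] := zp s z rs z1; rewrite mulf_neq0// expf_neq0.
  - by rewrite mulr_gt0 ?exprn_gt0//; lra.
  rewrite nmM nmX ler_pM ?exprn_ge0//; [lra|lra|by rewrite lerXn2r ?nnegrE ?nm_ge0//; lra|].
  have := nmD (z - p) p; rewrite subrK; lra.
have -> : 16 * (nm p ^+ K.+1 * (A * (2 * s) ^+ K / (s ^+ K.+1 * (s / 2)))) * s = M / s.
  rewrite /M exprMn !exprS; field.
  by rewrite expf_neq0 ?gt_eqF.
rewrite ler_pdivrMr// /s mulrDr mulrCA divff ?gt_eqF// mulr1 lerDr mulr_ge0//; lra.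
Qed.

(* Cauchy's formula, with [1 / (z - p)] expanded in powers of [p / z]. *)
Theorem liouville f (K : nat) (A : R) : 0 <= A ->
  (forall z, hol f z) -> (forall z, 1 <= nm z -> nm (f z) <= A * nm z ^+ K) ->
  exists2 P : {poly C}, (size P <= K.+1)%N & forall z, f z = P.[z].
Proof.
move=> A0 hf gf.
exists (\poly_(j < K.+1) (sq (fun z => f z / z ^+ j.+1) 1 / c0)); first exact: size_poly.
move=> p; rewrite horner_poly; apply: (mulIf c0_neq0).
pose r := 2 * nm p + 2.
have pr : 2 * nm p + 1 < r by rewrite /r; lra.
have np := nm_ge0 p.
have r0 : 0 < r by rewrite /r; lra.
(* For the constant function [1] and [K = 0] the expansion reduces to the single term [c0]. *)
have one : sq (fun z => 1 / (z - p)) r = c0.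
  rewrite (@cauchy_expansion (fun=> 1) 0 1)//.
  - rewrite big_ord1 expr0 mul1r /c0; congr (sq _ 1); apply/funext => z.
    by rewrite expr1 div1r.
  - by move=> z _; rewrite nm1 expr0 mulr1.
have bd g : (forall z, r <= nm z -> hol g z) -> bdry_cts g (-r) r (-r) r.
  move=> H; apply: sq_bdry => //.
  by move=> z /andP[z1 _]; apply: hol_contAt; apply: H.
have zp z : r <= nm z -> z - p != 0.
  by move=> sz; rewrite subr_eq0; apply/eqP => zp; rewrite zp /r in sz; lra.
have -> : f p * c0 = sq (fun z => f z / (z - p)) r.
  apply/eqP; rewrite eq_sym -subr_eq0 -one; apply/eqP.
  rewrite -mulNr -rect_intZ; last first.
    by apply: bd => z /zp zp'; exact: hol_div (hol_cst _ _) (hol_subC _ _) zp'.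
  rewrite -rect_intD; last 2 first.
  - by apply: bd => z /zp zp'; exact: hol_div (hf _) (hol_subC _ _) zp'.
  - apply: bd => z /zp zp'; apply: hol_mul; first exact: hol_cst.
    exact: hol_div (hol_cst _ _) (hol_subC _ _) zp'.
  (* The difference quotient [(f z - f p) / (z - p)] is bounded near [p], so its integral
     vanishes. *)
  have [D hD] := hol_approx (hf p).
  have [t t0 ht] := hD 1 ltr01.
  apply: (sq_eq0_of_bound_near (p := p) (L := nm D + 1)); first by rewrite /r; lra.
    move=> z zp'; rewrite -subr_eq0 in zp'.
    apply: hol_add; first exact: hol_div (hf _) (hol_subC _ _) zp'.
    apply: hol_mul; first exact: hol_cst.
    exact: hol_div (hol_cst _ _) (hol_subC _ _) zp'.
  exists t => // z zp' zt; rewrite -subr_eq0 in zp'.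
  rewrite (_ : _ + _ = (f z - f p) / (z - p)); last by field.
  rewrite nmM nmV ler_pdivrMr ?nm_gt0//.
  rewrite (_ : f z - f p = (f z - f p - D * (z - p)) + D * (z - p)); last by ring.
  by rewrite (le_trans (nmD _ _))// nmM mulrDl addrC lerD2l ht.
rewrite (cauchy_expansion A0 hf gf pr) mulr_suml; apply: eq_bigr => j _.
by rewrite mulrAC divfK ?c0_neq0// mulrC.
Qed.

End Liouville.

(** * Algebraicity of foliations *)

Local Open Scope classical_set_scope.
Local Open Scope ring_scope.

(** Compactness as an induction principle; it gives both the boundedness on the annulus and the
    finiteness of singular orbits. *)
Lemma compact_induct (T : ptopologicalType) (A : set T) (P : set T -> Prop) :
  compact A -> P set0 -> (forall X Y, P X -> P Y -> P (X `|` Y)) ->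
  (forall X Y, X `<=` Y -> P Y -> P X) ->
  (forall p, A p -> exists2 U, nbhs p U & P U) -> P A.
Proof.
rewrite compact_cover => cA P0 PU PS loc.
have /choice[U HU] p : exists U, A p -> [/\ open U, U p & P U].
  have [/loc[U]|] := pselect (A p); last by exists set0.
  by rewrite nbhsE => -[V [oV Vp] VU] PV; exists V => _; split => //; exact: PS VU PV.
have [|p Ap|D DA cov] := cA _ A U; [by move=> p /HU[]|by exists p => //; case: (HU p Ap)|].
apply: (PS _ _ cov); have {}DA p : p \in finmap.enum_fset D -> A p by move=> /DA; rewrite inE.
suff: P [set x | exists2 i, i \in finmap.enum_fset D & U i x].
  by apply: (PS) => x [i Di Ux]; exists i.
elim: (finmap.enum_fset D) DA => [_|i s IH DA]; first by apply: (PS _ _ _ P0) => x [].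
apply: (PS _ (U i `|` [set x | exists2 i, i \in s & U i x])); last first.
  apply: (PU); first by have [] := HU i (DA i (mem_head _ _)).
  by apply: IH => p ps; apply: DA; rewrite inE ps orbT.
move=> x [j]; rewrite inE => /orP[/eqP -> Ux|js Ux]; [by left|right].
by exists j.
Qed.

Section Annulus.
Context {R : realType}.
Local Notation C := (complex_complex__canonical__Num_NumField (reals_Real__to__Num_RealClosedField R)).

Lemma nm_ball (p : C) (e : R) : 0 < e -> nbhs p [set z : C | nm (z - p) < e].
Proof.
move=> e0; apply/nbhs_ballP; exists e%:C; first by rewrite /= ltcR.
by move=> z; rewrite /ball/= -nmE ltcR nmB.
Qed.

Lemma nm_nbhs (p : C) (A : set C) : nbhs p A ->
  exists2 e : R, 0 < e & forall z, nm (z - p) < e -> A z.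
Proof.
move=> /nbhs_ballP[[t ti]]; rewrite /= ltcE/= => /andP[/eqP ti0 t0] H.
have {}ti0 : ti = 0 by [].
rewrite {}ti0 in H; exists t => // z zt; apply: H.
by rewrite /ball/= -nmE ltcR nmB.
Qed.

Lemma complex_pair_continuous : continuous (fun p : R * R => (p.1 +i* p.2 : C)).
Proof.
move=> p A /nm_nbhs[e e0 H].
have e2 : 0 < e / 2 by rewrite divr_gt0.
exists ([set x | `|p.1 - x| < e / 2], [set y | `|p.2 - y| < e / 2]).
  by split; apply/nbhs_ballP; exists (e / 2).
move=> [x y] [/= px py]; apply: H.
rewrite complexB (le_lt_trans (nm_complex _ _))// [ltRHS]splitr.
by rewrite ltrD// distrC.
Qed.

Lemma closed_nm_le (e : R) : closed [set z : C | nm z <= e].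
Proof.
rewrite -[X in closed X]setCK; apply: open_closedC.
rewrite openE => z /= /negP; rewrite -ltNge => ez.
have e0 : 0 < nm z - e by rewrite subr_gt0.
apply: filterS (nm_ball z e0) => y /= yz; apply/negP; rewrite -ltNge.
have := nmD (y - z) (z - y) ; have := nmD (z - y) y; rewrite subrK (nmB z y); lra.
Qed.

Lemma closed_nm_ge (e : R) : closed [set z : C | e <= nm z].
Proof.
rewrite -[X in closed X]setCK; apply: open_closedC.
rewrite openE => z /= /negP; rewrite -ltNge => ez.
have e0 : 0 < e - nm z by rewrite subr_gt0.
apply: filterS (nm_ball z e0) => y /= yz; apply/negP; rewrite -ltNge.
have := nmD (y - z) z; rewrite subrK; lra.
Qed.

Lemma compact_nm_annulus (e : R) : compact [set z : C | e <= nm z <= 1].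
Proof.
apply: (@subclosed_compact _ _ ((fun p : R * R => (p.1 +i* p.2 : C)) @` (`[-1, 1]%classic `*` `[-1, 1]%classic))).
- rewrite [X in closed X](_ : _ = [set z : C | e <= nm z] `&` [set z : C | nm z <= 1]).
    by apply: closedI; [exact: closed_nm_ge|exact: closed_nm_le].
  by apply/seteqP; split => z /=; [move=> /andP|move=> [-> ->]].
- apply: continuous_compact; last by apply: compact_setX; exact: segment_compact.
  exact/continuous_subspaceT/complex_pair_continuous.
- move=> [x y] /= /andP[_ z1]; exists (x, y) => //=; split; rewrite /= in_itv/= -ler_norml.
    exact: le_trans (Re_le_nm (x +i* y)) z1.
  exact: le_trans (Im_le_nm (x +i* y)) z1.
Qed.

Context (n : nat).

Lemma compact_annulus (e : R) : 0 <= e ->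
  compact [set z : 'rV[C]_n | (forall i, nm (z 0 i) <= 1) /\ exists i, e <= nm (z 0 i)].
Proof.
move=> e0.
pose K k (i : 'I_n) := [set z : C | (if i == k then e else 0) <= nm z <= 1].
pose KK k := [set z : 'rV[C]_n | forall i, K k i (z 0 i)].
have cK k : compact (KK k) by apply: rV_compact => i; exact: compact_nm_annulus.
rewrite (_ : [set _ | _] = \big[setU/set0]_(k <- enum 'I_n) KK k).
  by elim/big_ind : _ => //; [exact: compact0|exact: compactU].
  rewrite -bigcup_seq; apply/seteqP; split => [z /= [z1 [k zk]]|z [k _ /= zk]].
    exists k => [|i] /=; first by rewrite mem_enum.
    by apply/andP; split; [case: eqP => [->//|_]; exact: nm_ge0|exact: z1].
  split; first by move=> i; have /= /andP[] := zk i.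
  by exists k; have := zk k; rewrite /KK /K /= eqxx => /andP[].
Qed.

End Annulus.

Section WeightedAnnulus.
Context {R : realType} (n : nat) (w : 'I_n.+1 -> nat) (w_gt0 : forall i, (0 < w i)%N).
Local Notation C := (complex_complex__canonical__Num_NumField (reals_Real__to__Num_RealClosedField R)).

(** A compact set meeting every orbit off the origin. The exponent [sum w] dominates each [w i], the
    power of two by which a scaling by [2] can overshoot. *)
Definition weighted_annulus := [set z : 'rV[C]_n.+1 | (forall i, nm (z 0 i) <= 1) /\
  exists i, 2^-1 ^+ (\sum_i w i)%N <= nm (z 0 i)].
Local Notation K := weighted_annulus.

Let e0 : 0 < 2^-1 ^+ (\sum_i w i)%N :> R. Proof. by rewrite exprn_gt0// invr_gt0. Qed.

Lemma compact_weighted_annulus : compact K.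
Proof. exact/compact_annulus/ltW. Qed.

Lemma weighted_annulus_neq0 z : K z -> z != 0.
Proof.
move=> [_ [i ei]]; apply: contraTneq ei => ->.
by rewrite mxE nm0 -ltNge.
Qed.

(** Take [m] minimal with [|z_i| <= 2^(m w_i)] for all [i]. If [m > 0], minimality leaves a
    coordinate above [2^((m-1) w_i)], which keeps the rescaled point away from zero and bounds [2^m]
    by [2 M]. *)
Lemma wact_annulus (z : 'rV[C]_n.+1) (M : R) :
  (forall i, nm (z 0 i) <= M) -> (exists i, 1 <= nm (z 0 i)) ->
  exists m, 2 ^+ m <= 2 * M /\ K (wact w (2 ^+ m)%:C^-1 z).
Proof.
move=> zM [i0 zi0].
have M1 : 1 <= M := le_trans zi0 (zM i0).
have two1 : 1 < 2 :> R by lra.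
have exm : exists m : nat, [forall i, nm (z 0 i) <= 2 ^+ (m * w i)].
  have [m mM] : exists m : nat, M <= 2 ^+ m.
    exists (Num.trunc M).+1; rewrite ltW// (lt_trans (truncnS_gt _))//.
    by rewrite -natrX ltr_nat ltn_expl.
  exists m; apply/forallP => i; rewrite (le_trans (zM i))// (le_trans mM)//.
  by rewrite ler_eXn2l// leq_pmulr.
case: (ex_minnP exm) => m /forallP zm mmin.
pose l : R := 2 ^+ m.
have l0 : 0 < l by rewrite exprn_gt0.
have lC : l%:C != 0 :> C by rewrite -nm_eq0 nm_real ger0_norm ?ltW// gt_eqF.
pose y := wact w l%:C^-1 z.
have ym i : nm (y 0 i) = nm (z 0 i) / 2 ^+ (m * w i).
  by rewrite mxE nmM nmX nmV nm_real ger0_norm ?ltW// exprVn -exprM mulrC.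
exists m.
case: m zm mmin @l l0 lC @y ym => [|m] zm mmin l l0 lC y ym.
  split; first by rewrite /l expr0; lra.
  split; first by move=> i; rewrite ym divr1; have := zm i; rewrite mul0n expr0.
  exists i0; rewrite ym divr1 (le_trans _ zi0)// exprn_ile1// ?invr_ge0//.
  by rewrite invf_le1//; lra.
have [i zi] : exists i, 2 ^+ (m * w i) < nm (z 0 i).
  apply: contrapT => /forallNP zi; suff /mmin : [forall i, nm (z 0 i) <= 2 ^+ (m * w i)] by rewrite ltnn.
  by apply/forallP => i; rewrite leNgt; apply/negP/zi.
split.
  rewrite /l exprS ler_pM2l//; apply: le_trans (zM i); rewrite (le_trans _ (ltW zi))//.
  by rewrite ler_eXn2l// leq_pmulr.
split; first by move=> j; rewrite ym ler_pdivrMr ?exprn_gt0// mul1r.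
exists i; rewrite ym ler_pdivlMr ?exprn_gt0//; apply: le_trans (ltW zi).
rewrite mulSn exprD mulrA ler_piMl ?exprn_ge0//.
rewrite exprVn mulrC ler_pdivrMr ?exprn_gt0// mul1r ler_eXn2l//.
by rewrite (bigD1 i)//= leq_addr.
Qed.

End WeightedAnnulus.

(** * Quasi-homogeneous holomorphic functions are polynomials *)

Section Growth.
Context {R : realType} (n : nat) (w : 'I_n.+1 -> nat) (w_gt0 : forall i, (0 < w i)%N).
Local Notation C := (complex_complex__canonical__Num_NumField (reals_Real__to__Num_RealClosedField R)).
Local Notation K := (@weighted_annulus R n w).
Context (G : 'rV[C]_n.+1 -> C) (k : int).
Hypothesis cG : forall p, p != 0 -> {for p, continuous G}.
Hypothesis dG : forall p v, p != 0 -> derivable (G : 'rV[C]_n.+1 -> C^o) p v.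
Hypothesis GM : forall l z, l != 0 -> z != 0 -> G (wact w l z) = l ^ k * G z.

Lemma bounded_on_annulus : exists2 B : R, 0 <= B & forall z, K z -> nm (G z) <= B.
Proof.
pose P (X : set 'rV[C]_n.+1) := exists2 B : R, 0 <= B & forall z, X z -> nm (G z) <= B.
suff: P K by [].
apply: (@compact_induct _ K P); first exact: compact_weighted_annulus.
- by exists 0.
- move=> X Y [B B0 BX] [B' B'0 BY]; exists (B + B') => [|z [/BX|/BY]]; first exact: addr_ge0.
    by move=> h; rewrite (le_trans h)// lerDl.
  by move=> h; rewrite (le_trans h)// lerDr.
- by move=> X Y XY [B B0 BY]; exists B => // z /XY/BY.
move=> p Kp; have Gp := cG (weighted_annulus_neq0 Kp).
exists (G @^-1` [set y | nm (y - G p) < 1]); first exact: (Gp _ (nm_ball (G p) ltr01)).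
exists (1 + nm (G p)); first by rewrite addr_ge0 ?nm_ge0.
move=> z /= zp; rewrite -[G z](subrK (G p)) (le_trans (nmD _ _))//.
by rewrite lerD2r ltW.
Qed.

Lemma nm_expz (m : nat) : nm (((2 : R) ^+ m)%:C ^ k) <= (2 ^+ m) ^+ `|k|%N.
Proof.
have m0 : 0 <= 2 ^+ m :> R by rewrite exprn_ge0.
have h a : 1 <= (2 ^+ m) ^+ a :> R by apply: exprn_ege1; apply: exprn_ege1; lra.
case: k => a; first by rewrite -exprnP nmX nm_real ger0_norm.
rewrite NegzE -exprnN nmV nmX nm_real ger0_norm// abszN absz_nat.
apply: (@le_trans _ _ 1); last exact: h.
by rewrite invf_le1 ?h// (lt_le_trans ltr01 (h _)).
Qed.

Lemma growth : exists2 B : R, 0 <= B & forall (z : 'rV[C]_n.+1) (M : R),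
  (forall i, nm (z 0 i) <= M) -> (exists i, 1 <= nm (z 0 i)) ->
  nm (G z) <= B * (2 * M) ^+ `|k|%N.
Proof.
have [B B0 BK] := bounded_on_annulus; exists B => // z M zM [i0 zi0].
have [m [l2M Ky]] := wact_annulus w_gt0 zM (ex_intro _ i0 zi0).
pose l : R := 2 ^+ m; set y := wact _ _ z in Ky.
have l0 : 0 < l by rewrite exprn_gt0.
have lC : l%:C != 0 :> C by rewrite -nm_eq0 nm_real ger0_norm ?ltW// gt_eqF.
have M1 : 1 <= M := le_trans zi0 (zM i0).
have zE : z = wact w l%:C y by rewrite wactM divff// wact1.
rewrite {1}zE GM ?(weighted_annulus_neq0 Ky)// nmM mulrC ler_pM ?nm_ge0 ?BK//.
rewrite (le_trans (nm_expz m))//; apply: lerXn2r => //; rewrite nnegrE; first exact: ltW l0.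
by lra.
Qed.


Definition row_of (z : 'I_n.+1 -> C) : 'rV[C]_n.+1 := \row_i z i.

Lemma hol_line z j : (exists2 i, i != j & z i != 0) ->
  forall t, hol (fun t => G (row_of (set_coord z j t))) t.
Proof.
move=> [i ij zi] t; split.
pose p := row_of (set_coord z j t).
have p0 : p != 0.
  apply: contraNneq zi => /rowP/(_ i); rewrite !mxE /set_coord (negbTE ij) => ->.
  by [].
have := @dG p (delta_mx 0 j) p0.
rewrite /derivable.
set u := (X in cvg (X @ _) -> _); set v := (X in _ -> cvg (X @ _)).
suff -> : u = v by [].
apply/funext => h; rewrite /u /v /=; congr (_ *: (G _ - _)).
apply/rowP => i'; rewrite !mxE eqxx/= /set_coord /GRing.scale/= mulr1.
by case: eqP => _; rewrite ?mulr1 ?mulr0 ?add0r.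
Qed.

Theorem quasihomogeneous_mpoly : (0 < n)%N ->
  exists q : mpoly.mpoly n.+1 C, forall z, z != 0 -> G z = mpoly.meval (fun i => z 0 i) q.
Proof.
move=> n0; have [B B0 HB] := growth.
have [|z j [i ij zi]|q qE] := @mpoly_of_separately_poly C n.+1 (G \o row_of) `|k|%N.
- by [].
- have hl := hol_line (ex_intro2 _ _ i ij zi).
  pose M0 : R := 1 + \sum_i nm (z i).
  have M01 : 1 <= M0 by rewrite lerDl sumr_ge0// => *; exact: nm_ge0.
  have zM l : nm (z l) <= M0.
    rewrite /M0 (bigD1 l)//= addrCA lerDl addr_ge0// sumr_ge0// => *; exact: nm_ge0.
  have A0 : 0 <= B * (2 * M0) ^+ `|k|%N.
    by rewrite mulr_ge0// exprn_ge0// mulr_ge0//; lra.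
  have [|P sP PE] := liouville A0 hl (K := `|k|%N); last by exists P.
  move=> t t1; rewrite -mulrA -exprMn -mulrA; apply: HB.
    move=> l; rewrite mxE /set_coord; case: eqP => _; last first.
      by rewrite (le_trans (zM l))// ler_peMr// (le_trans ler01).
    by rewrite ler_peMl// nm_ge0.
  by exists j; rewrite mxE /set_coord eqxx.
exists q => z z0; rewrite -qE/=.
  by congr G; apply/rowP => i; rewrite mxE.
apply: contrapT => /forallNP zi; case/eqP: z0; apply/rowP => i; rewrite mxE.
by apply/eqP; apply: contraT => h; case: (zi i).
Qed.
End Growth.

(** * The exterior product of the radial field and the foliation *)

Section Wedge.
Context (C : numClosedFieldType) (n : nat) (w : 'I_n.+1 -> nat) (w_gt0 : forall i, (0 < w i)%N).
Context (d : int) (F : foliation C w d).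

(* The coefficients of [radial] /\ [fol_lift F], which do not depend on the lift. *)
Definition fol_wedge (i j : 'I_n.+1) (z : 'rV[C]_n.+1) : C :=
  radial w z 0 i * fol_lift F z 0 j - radial w z 0 j * fol_lift F z 0 i.

Lemma fol_wedge_lift (z u v : 'rV[C]_n.+1) i j : radial_eq w z u v ->
  radial w z 0 i * u 0 j - radial w z 0 j * u 0 i = radial w z 0 i * v 0 j - radial w z 0 j * v 0 i.
Proof.
move=> [c /rowP uv]; have E k : u 0 k = v 0 k + c * radial w z 0 k.
  by have := uv k; rewrite !mxE => h; rewrite -h; ring.
by rewrite !E; ring.
Qed.

Lemma radial_neq0 (z : 'rV[C]_n.+1) : z != 0 -> exists i, radial w z 0 i != 0.
Proof.
move=> z0; apply: contrapT => /forallNP H; case/eqP: z0; apply/rowP => i.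
have := H i; rewrite !mxE => /negP; rewrite negbK mulf_eq0 pnatr_eq0.
by rewrite gtn_eqF ?w_gt0//= => /eqP.
Qed.

Lemma sing_coneP z : z != 0 -> sing_cone F z <-> forall i j, fol_wedge i j z = 0.
Proof.
move=> z0; split => [[_ H] i j|H].
  by rewrite /fol_wedge (fol_wedge_lift _ _ H) !mxE !mulr0 subr0.
have [i ri] := radial_neq0 z0; split => //.
exists (fol_lift F z 0 i / radial w z 0 i); apply/rowP => j.
rewrite subr0 [in RHS]mxE; have /eqP := H i j; rewrite /fol_wedge subr_eq0 => /eqP E.
by rewrite mulrAC [fol_lift F z 0 i * _]mulrC -E [_ * fol_lift F z 0 j]mulrC mulfK.
Qed.

Lemma fol_wedge_wact l z i j : l != 0 -> z != 0 ->
  fol_wedge i j (wact w l z) = l ^ (d - 1 + (w i + w j)%N%:Z) * fol_wedge i j z.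
Proof.
move=> l0 z0; rewrite /fol_wedge (fol_wedge_lift _ _ (fol_equivariant F l0 z0)) !mxE.
by rewrite (expfzDr (d - 1))// -[l ^ (w i + w j)%N%:Z]exprnP exprD; ring.
Qed.

(** A holomorphic local lift has the same product with [radial] as [fol_lift], so holomorphy of the
    section becomes holomorphy of scalar functions. *)
Lemma fol_wedge_local p i j : p != 0 -> exists V : 'rV[C]_n.+1 -> C,
  differentiable (V : 'rV[C]_n.+1 -> C^o) p /\ (\forall z \near p, V z = fol_wedge i j z).
Proof.
move=> p0; have [Y HY] := fol_holomorphic F p0.
pose r k (z : 'rV[C]_n.+1) : C^o := (w k)%:R * z 0 k.
exists (fun z => r i z * Y z 0 j - r j z * Y z 0 i); split.
  have dY k : differentiable ((fun z => Y z 0 k) : 'rV[C]_n.+1 -> C^o) p.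
    have [dY _] := nbhs_singleton HY.
    apply: (@differentiable_comp _ _ _ _ Y (fun u : 'rV[C]_n.+1 => u 0 k : C^o)) => //.
    exact: differentiable_coord.
  have dr k : differentiable (r k : 'rV[C]_n.+1 -> C^o) p.
    apply: (@differentiableZ _ _ _ (fun u : 'rV[C]_n.+1 => u 0 k : C^o) (w k)%:R).
    exact: differentiable_coord.
  by apply: differentiableB; exact: differentiableM.
apply: filterS HY => z [_ zY]; rewrite /fol_wedge -(fol_wedge_lift _ _ zY) /r.
by rewrite !mxE.
Qed.

Lemma fol_wedge_continuous p i j : p != 0 -> {for p, continuous (fol_wedge i j)}.
Proof.
move=> p0; have [V [dV VW]] := fol_wedge_local i j p0.
have := differentiable_continuous dV.
move=> cV; have E : fol_wedge i j p = V p by rewrite (nbhs_singleton VW).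
have h : V z @[z --> p] --> fol_wedge i j p by rewrite E; exact: cV.
exact: cvg_trans (near_eq_cvg VW) h.
Qed.

Lemma fol_wedge_derivable p v i j : p != 0 -> derivable (fol_wedge i j : 'rV[C]_n.+1 -> C^o) p v.
Proof.
move=> p0; have [V [dV VW]] := fol_wedge_local i j p0.
exact: near_eq_derivable VW (diff_derivable dV).
Qed.

End Wedge.

Theorem fol_wedge_mpoly (R : realType) (n : nat) (w : 'I_n.+1 -> nat) (d : int) (F : foliation R[i] w d) i j :
  (0 < n)%N -> (forall i, (0 < w i)%N) ->
  exists q : mpoly.mpoly n.+1 R[i], forall z : 'rV[R[i]]_n.+1, z != 0 -> fol_wedge F i j z = mpoly.meval (fun k => z 0 k) q.
Proof.
move=> n0 w0.
apply: (@quasihomogeneous_mpoly R n w w0 (fol_wedge F i j) (d - 1 + (w i + w j)%N%:Z)) => //.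
- by move=> p p0; exact: (@fol_wedge_continuous _ _ _ _ F p i j p0).
- by move=> p v p0; exact: fol_wedge_derivable.
- by move=> l z l0 z0; exact: fol_wedge_wact.
Qed.

(** * Singular orbits *)

(** Isolation lives in the quotient: its neighbourhood is pulled back along the projection and
    extended to an open set of the whole space. Points with the same image lie in one orbit. *)
Lemma isolated_nbhs (C : numClosedFieldType) (n : nat) (w : 'I_n.+1 -> nat) (d : int)
    (F : foliation C w d) p : isolated_singularities F -> sing_cone F p ->
  exists2 U, nbhs p U & forall z, U z -> sing_cone F z -> exists2 l, l != 0 & wact w l p = z.
Proof.
move=> iso Fp; have [p0 _] := Fp.
pose x : @punctured C n := SigSub (mem_set (p0 : @punctured C n p)).
have Sx : sing F (orbit_pt w x) by exists x.
have [_ [V Vx VS]] := iso _ Sx.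
have : nbhs x [set y | V (orbit_pt w y)].
  exact: (@pi_continuous _ {eq_quot (same_orbit_rel C w)}%qT x _ Vx).
rewrite nbhsE => -[B [oB Bx] BV].
have [D oD DB] := oB.
exists D.
  by apply: open_nbhs_nbhs; split => //; move: Bx; rewrite -DB.
move=> z Dz Fz; have [z0 _] := Fz.
pose y : @punctured C n := SigSub (mem_set (z0 : @punctured C n z)).
have By : B y by rewrite -DB.
have : (V `&` sing F) (orbit_pt w y) by split; [exact: BV|exists y].
rewrite VS /= => /esym/eqmodP/asboolP[l l0 e].
by exists l.
Qed.

Section FiniteSingularOrbits.
Context {R : realType} (n : nat) (w : 'I_n.+1 -> nat) (w_gt0 : forall i, (0 < w i)%N).
Local Notation C := (complex_complex__canonical__Num_NumField (reals_Real__to__Num_RealClosedField R)).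
Context (d : int) (F : foliation R[i] w d).

Lemma sing_cone_wact l (z : 'rV[R[i]]_n.+1) : l != 0 -> sing_cone F z -> sing_cone F (wact w l z).
Proof.
move=> l0 Fz; have [z0 _] := Fz.
have lz : wact w l z != 0.
  apply: contraNneq z0 => lz; rewrite -(wact1 w z) -(mulVf l0) -wactM lz.
  by apply/eqP/rowP => i; rewrite !mxE mulr0.
apply/(sing_coneP w_gt0 _ lz) => i j; rewrite fol_wedge_wact//.
by have /(sing_coneP w_gt0 _ z0) -> := Fz; rewrite mulr0.
Qed.

Let represented (X : set 'rV[C]_n.+1) := exists s : seq 'rV[C]_n.+1,
  forall z, X z -> sing_cone F z -> exists2 y, y \in s & exists2 l, l != 0 & wact w l y = z.

Lemma sing_cone_local (p : 'rV[C]_n.+1) : isolated_singularities F -> p != 0 ->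
  exists2 U, nbhs p U & represented U.
Proof.
move=> iso p0; have [/(isolated_nbhs iso)[U pU UF]|pF] := pselect (sing_cone F p).
  by exists U => //; exists [:: p] => z Uz Fz; exists p; [rewrite inE|exact: UF].
have /existsNP[i /existsNP[j /eqP ij]] : ~ forall i j, fol_wedge F i j p = 0.
  by move/(sing_coneP w_gt0 _ p0).
have := @fol_wedge_continuous _ _ _ _ F p i j p0.
have n0 : 0 < nm (fol_wedge F i j p) by rewrite nm_gt0.
move=> /(_ _ (nm_ball _ n0)) H; exists (fol_wedge F i j @^-1` [set z | nm (z - fol_wedge F i j p) < nm (fol_wedge F i j p)]) => //.
exists [::] => z /= zp Fz; have [z0 _] := Fz.
by move: zp; have /(sing_coneP w_gt0 _ z0) -> := Fz; rewrite sub0r nmN ltxx.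
Qed.

Theorem finitely_many_singular_orbits : isolated_singularities F ->
  exists s : seq 'rV[C]_n.+1, (forall y, y \in s -> y != 0) /\
    forall z, sing_cone F z -> exists2 y, y \in s & exists2 l, l != 0 & wact w l y = z.
Proof.
move=> iso; have [s sP] : represented (@weighted_annulus R n w).
  apply: (@compact_induct _ (@weighted_annulus R n w) represented).
  - exact: compact_weighted_annulus.
  - by exists [::].
  - move=> X Y [s sX] [t tY]; exists (s ++ t) => z [Xz|Yz] Fz.
      by have [y ys yz] := sX z Xz Fz; exists y => //; rewrite mem_cat ys.
    by have [y yt yz] := tY z Yz Fz; exists y => //; rewrite mem_cat yt orbT.
  - by move=> X Y XY [s sY]; exists s => z /XY; exact: sY.
  - by move=> p /weighted_annulus_neq0; exact: sing_cone_local.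
exists [seq y <- s | y != 0]; split => [y|z Fz]; first by rewrite mem_filter => /andP[].
have [z0 _] := Fz.
have [i zi] : exists i, z 0 i != 0.
  apply: contrapT => /forallNP H; case/eqP: z0; apply/rowP => i; rewrite mxE.
  by apply/eqP; apply: contraT => zi; case: (H i).
have zi0 : 0 < nm (z 0 i) by rewrite nm_gt0.
(* Scaling by [a] gives coordinate [i] modulus at least [1], as [wact_annulus] requires. *)
pose a : R := 1 + (nm (z 0 i))^-1.
have a1 : 1 <= a by rewrite lerDl invr_ge0 ltW.
have aC : a%:C != 0 :> C by rewrite -nm_eq0 nm_real normr_eq0 gt_eqF// (lt_le_trans ltr01).
pose z' := wact w a%:C z.
have z'i : 1 <= nm (z' 0 i).
  rewrite mxE nmM nmX nm_real ger0_norm ?(le_trans ler01)//.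
  apply: (@le_trans _ _ (a * nm (z 0 i))).
    by rewrite mulrDl mul1r mulVf ?gt_eqF// lerDr ltW.
  by rewrite ler_pM2r// -{1}[a]expr1 ler_weXn2l.
have zj j : nm (z' 0 j) <= \sum_j nm (z' 0 j).
  by rewrite (bigD1 j)//= lerDl sumr_ge0// => *; exact: nm_ge0.
have [m [_ Km]] := wact_annulus w_gt0 zj (ex_intro _ i z'i).
have mC : (2 ^+ m : R)%:C^-1 != 0 :> C.
  by rewrite invr_eq0 -nm_eq0 nm_real normr_eq0 expf_neq0.
have [y ys [l l0 yl]] := sP _ Km (sing_cone_wact mC (sing_cone_wact aC Fz)).
have lc : (2 ^+ m : R)%:C^-1 * a%:C != 0 :> C by rewrite mulf_neq0.
have yE : wact w (((2 ^+ m : R)%:C^-1 * a%:C)^-1 * l) y = z.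
  by rewrite -wactM yl /z' !wactM -mulrA mulVf// wact1.
exists y; last by exists (((2 ^+ m : R)%:C^-1 * a%:C)^-1 * l); rewrite // mulf_neq0// invr_eq0.
rewrite mem_filter ys andbT; apply: contraNneq z0 => y0; rewrite -yE y0.
by apply/eqP/rowP => j; rewrite !mxE mulr0.
Qed.
End FiniteSingularOrbits.

(** * The constant alpha *)

(** Bernoulli's inequality for [(1 + 2 / a)^(j + 1)], cleared of denominators. *)
Lemma bernoulli2 a j : (a ^ j * (a + 2 * j.+1) <= (a + 2) ^ j.+1)%N.
Proof.
elim: j => [|j IH]; first by rewrite expn0 mul1n muln1 expn1.
rewrite [leqRHS]expnS; apply: leq_trans (leq_mul (leqnn (a + 2)%N) IH).
rewrite expnS; move: (a ^ j)%N => x; nia.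
Qed.

(** The induction step, with [k = j + 1], uses Bernoulli at [k (k + 3)], chosen because adding [2]
    gives [(k + 1) (k + 2)]. The base case is [6^3 < 4^4]. *)
Lemma exp_add2_lt j : (3 <= j)%N -> ((j + 3) ^ j < j.+1 ^ j.+1)%N.
Proof.
elim: j => // j IH; rewrite leq_eqVlt => /orP[/eqP [<-]|/IH {}IH]; first by vm_compute.
pose k := j.+1; rewrite -/k in IH *.
have B := bernoulli2 (k * (k + 3)) j.
have b : (k * (k + 3) + 2 = k.+1 * (j + 3))%N by rewrite /k; lia.
have key : ((k + 3) ^ k * k ^ k * (j + 3) <= k.+1 ^ k.+1 * (j + 3) ^ j * (j + 3))%N.
  rewrite -expnMn [(_ * k)%N]mulnC -mulnA -expnSr [leqRHS](_ : _ = k.+1 * (k * (k + 3) + 2) ^ k)%N; last first.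
    by rewrite b expnMn expnS mulnA.
  apply: leq_trans (leq_mul (leqnn k.+1) B).
  rewrite [X in (X * _ <= _)%N](expnS _ j); move: ((k * (k + 3)) ^ j)%N => x.
  rewrite /k; nia.
have k0 : (0 < k ^ k)%N by rewrite expn_gt0.
have j0 : (0 < j + 3)%N by rewrite addn3.
rewrite -(ltn_pmul2r k0); move: key; rewrite leq_pmul2r// => key.
by apply: leq_ltn_trans key _; rewrite ltn_pmul2l// expn_gt0.
Qed.

Section AlphaBound.
Context (R : realType).

(** [x (x + 1)^m] increases on positive [x], and at [2 / (m + 1)] it is below [2] by
    [exp_add2_lt]. *)
Lemma alpha_root_gt m : (3 <= m)%N -> 2 < alpha_root R m * m.+1%:R.
Proof.
move=> m3; have m0 : (0 < m)%N by exact: leq_trans m3.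
have [_ /(_ erefl)[a0]] := @alpha_rootP R m m0 (alpha_root R m).
rewrite /alpha_poly rootE !hornerE subr_eq0 => /eqP ra.
rewrite ltNge; apply/negP => am.
have m1 : 0 < m.+1%:R :> R by rewrite ltr0n.
have ax : alpha_root R m <= 2 / m.+1%:R by rewrite ler_pdivlMr.
have : 2 / m.+1%:R * (2 / m.+1%:R + 1) ^+ m < 2 :> R.
  rewrite mulrAC ltr_pdivrMr// ltr_pM2l//.
  rewrite (_ : 2 / m.+1%:R + 1 = (m + 3)%:R / m.+1%:R); last first.
    by rewrite -[X in _ + X](mulfV (lt0r_neq0 m1)) -mulrDl -natrD add2n addn3.
  rewrite expr_div_n ltr_pdivrMr ?exprn_gt0// -exprS -!natrX ltr_nat.
  exact: exp_add2_lt.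
apply/negP; rewrite -leNgt -{1}ra ler_pM ?exprn_ge0//; try lra.
have x0 : 0 <= 2 / m.+1%:R :> R by rewrite divr_ge0 ?ltW.
by apply: lerXn2r; rewrite ?nnegrE ?lerD2r// addr_ge0// ltW.
Qed.

Lemma alpha_gt0 n : (2 <= n)%N -> 0 < alpha R n.
Proof.
rewrite /alpha => n2; have p m : (0 < m)%N -> 0 < alpha_root R m.
  by move=> m0; have [_ /(_ erefl)[]] := @alpha_rootP R m m0 (alpha_root R m).
by case: ifP => _; apply: p; lia.
Qed.

Lemma alpha_bound n S e : (3 <= n)%N -> (0 < S)%N -> alpha R n * S%:R <= e%:R ->
  (2 * S < (if odd n then n.+1 else n) * e)%N.
Proof.
move=> n3 S0 Se; rewrite -(ltr_nat R) !natrM.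
set N := (if odd n then _ else _); have N2 : 2 < alpha R n * N%:R.
  rewrite /alpha /N; case: ifP => on; first exact: alpha_root_gt.
  (* An even [n >= 3] is at least [4], so [alpha_root_gt] applies to [n - 1]. *)
  have -> : n%:R = n.-1.+1%:R :> R by rewrite prednK// (leq_trans _ n3).
  apply: alpha_root_gt; case: n on n3 {Se N} => [|[|[|[|n]]]] //.
have S0' : 0 < S%:R :> R by rewrite ltr0n.
rewrite (@lt_le_trans _ _ (alpha R n * N%:R * S%:R))// ?ltr_pM2r//.
by rewrite mulrAC mulrC ler_wpM2l.
Qed.

End AlphaBound.

(** * The degree bounds *)

Lemma complex_uncountable (R : realType) : ~ countable [set: R[i]].
Proof.
move=> cC; have cR : countable (`[0, 1]%classic : set R).
  apply: (sub_countable _ cC); apply: card_le_trans (card_image_le (@complex.Re R) _).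
  by apply: subset_card_le => x _; exists (real_complex R x).
have := countable_lebesgue_measure0 cR.
rewrite lebesgue_measure_itv/= lte_fin ltr01 -EFinB subr0 => /eqP.
by rewrite eqe oner_eq0.
Qed.

(** Take [h = sum x^i X_i^(L / w_i)] with [L] the product of the weights. Its value at a given
    nonzero point is a nonzero polynomial in [x], so some [x] avoids the roots for all points of
    [s]. *)
Lemma separating_hypersurface (C : numFieldType) (n : nat) (w : 'I_n -> nat)
    (s : seq 'rV[C]_n) :
  (forall i, (0 < w i)%N) -> (forall y, y \in s -> y != 0) ->
  exists (h : mpoly n C) (dh : nat), [/\ (0 < dh)%N, whomog w dh h &
    forall y, y \in s -> meval (fun i => y 0 i) h != 0].
Proof.
move=> w0 s0; pose L := (\prod_i w i)%N; pose k i := (L %/ w i)%N.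
have wk i : (w i * k i)%N = L.
  by rewrite mulnC divnK// /L (bigD1 i)//= dvdn_mulr.
have [x xs] : exists x : C, forall y, y \in s -> \sum_(i < n) x ^+ i * y 0 i ^+ k i != 0.
  pose P (y : 'rV[C]_n) := \sum_(i < n) (y 0 i ^+ k i) *: 'X^i : {poly C}.
  have PE y x : (P y).[x] = \sum_(i < n) x ^+ i * y 0 i ^+ k i.
    by rewrite horner_sum; apply: eq_bigr => i _; rewrite hornerZ hornerXn mulrC.
  have Q0 : \prod_(y <- s) P y != 0.
    elim: s s0 => [_|y s IH s0]; first by rewrite big_nil oner_eq0.
    rewrite big_cons mulf_neq0//; last by apply: IH => z zs; rewrite s0// inE zs orbT.
    have /rV0Pn[i yi] := s0 y (mem_head _ _).
    apply/negP => /eqP/(congr1 (fun p : {poly C} => p`_i)).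
    rewrite coef0 coef_sum (bigD1 i)//= coefZ coefXn eqxx mulr1 big1 ?addr0 => [/eqP|j ji].
      by rewrite expf_eq0 (negbTE yi) andbF.
    rewrite coefZ coefXn; case: eqP => [e|]; rewrite ?mulr0//.
    by case/eqP: ji; apply: val_inj.
  have [x Qx] : exists x, (\prod_(y <- s) P y).[x] != 0.
    apply: contrapT => /forallNP H; case/eqP: Q0; apply: poly_eq0_of_vanish => x _.
    by apply/eqP; apply: contraT => h; case: (H x).
  exists x => y; rewrite -PE; elim: s Qx {s0 Q0} => // z s IH.
  by rewrite big_cons hornerM mulf_eq0 negb_or inE => /andP[zx sx] /orP[/eqP ->//|/IH]; exact.
exists (\sum_(i < n) (x ^+ i) *: (mX i : mpoly n C) ^+ k i), L; split.
- by rewrite /L prodn_gt0.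
- apply: whomog_sum => i _; apply: whomogZ; rewrite -(wk i).
  elim: (k i) => [|m IH]; first by rewrite muln0 expr0 -mpolyC1; exact: whomogC.
  by rewrite mulnS exprS; apply: whomogM => //; exact: whomogX1.
- move=> y ys; rewrite raddf_sum/=; have := xs y ys; congr (_ != 0).
  by apply: eq_bigr => i _; rewrite mevalZ rmorphXn/= mevalXU.
Qed.

(** A third weight exists because [n >= 2]. Strictness supplies one of the two units subtracted in
    (i), the other being [l = d - 1]. *)
Lemma pair_sum_lt (n : nat) (w : 'I_n.+1 -> nat) (i j : 'I_n.+1) : (2 <= n)%N ->
  (forall i, (0 < w i)%N) -> i != j -> (w i + w j < \sum_k w k)%N.
Proof.
move=> n2 w0 ij; rewrite (bigD1 i)//= (bigD1 j) 1?eq_sym//= addnA -[ltnLHS]addn0 ltn_add2l.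
have [k ki] : exists k, k \in ~: [set i; j]%SET.
  by apply/card_gt0P; rewrite cardsCs finset.setCK card_ord cards2 ij; lia.
move: ki; rewrite !inE negb_or => /andP[ki kj].
by rewrite (bigD1 k) ?ki//= ltn_addr.
Qed.

Theorem theorem1p3 (R : realType) (n : nat) (w : 'I_n.+1 -> nat)
    (w_gt0 : forall i, (0 < w i)%N)
    (d : int) (F : foliation R[i] w d)
    (F_isolated : isolated_singularities F)
    (d0 : nat) (f : mpoly n.+1 R[i])
    (f_neq0 : f != 0)
    (f_homog : quasi_homogeneous w d0 f)
    (f_quasi_smooth : quasi_smooth f)
    (f_invariant : invariant_hypersurface F f) :
  (n = 2%N -> d0%:Z <= d + (\sum_i w i)%N%:Z - 2) /\
  ((3 <= n)%N -> (\sum_i w i)%N%:Z + 1 <= d ->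
    d0%:R < d%:~R + alpha R n * (\sum_i w i)%N%:R - 1).
Proof.
have [n0|n_gt0] := posnP n; first by split=> [n2|n3]; exfalso; lia.
pose row (z : 'I_n.+1 -> R[i]) : 'rV[R[i]]_n.+1 := \row_i z i.
pose nz (z : 'I_n.+1 -> R[i]) := exists i, z i != 0.
have rowE z : (fun i => row z 0 i) = z by apply/funext => i; rewrite mxE.
have row0 z : nz z -> row z != 0.
  by move=> [i zi]; apply: contraNneq zi => /rowP/(_ i); rewrite !mxE => ->.
have row_eval p z : eval_at p (row z) = meval z p by rewrite /eval_at rowE.
have row_wact l z : row (fun i => l ^+ w i * z i) = wact w l (row z).
  by apply/rowP => i; rewrite !mxE.
have Wex i j : exists q : mpoly n.+1 R[i], forall z : 'rV[R[i]]_n.+1,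
    z != 0 -> fol_wedge F i j z = meval (fun k => z 0 k) q by exact: fol_wedge_mpoly.
pose W i := projT1 (choice (Wex i)).
have WE i j (z : 'rV[R[i]]_n.+1) : z != 0 -> fol_wedge F i j z = meval (fun k => z 0 k) (W i j).
  exact: (projT2 (choice (Wex i))).
have Wrow i j z : nz z -> meval z (W i j) = fol_wedge F i j (row z).
  by move=> z0; rewrite WE ?row0// rowE.
have sing_row z : nz z -> (forall i j, meval z (W i j) = 0) -> sing_cone F (row z).
  by move=> z0 H; apply/(sing_coneP w_gt0 _ (row0 z z0)) => i j; rewrite -Wrow.
have homf : whomog w d0 f by apply/whomogP.
have smoothf z : nz z -> meval z f = 0 -> exists i, meval z (mderiv i f) != 0.
  move=> z0 fz; apply: contrapT => /forallNP H.
  suff : cone_sing f (row z) by rewrite f_quasi_smooth.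
  split; first by split; [exact: row0|rewrite row_eval].
  by move=> i; rewrite row_eval; apply/eqP; apply: contraT => h; case: (H i).
have Weval z i j : nz z -> meval z (W i j) =
    (w i)%:R * z i * fol_lift F (row z) 0 j - (w j)%:R * z j * fol_lift F (row z) 0 i.
  by move=> z0; rewrite Wrow// /fol_wedge !mxE.
have Whom i j : whomogz w ((d - 1) + (w i + w j)%N%:Z) (W i j).
  apply: whomogz_of_wact => l z l0 z0; have nzz : nz z by exists ord0.
  rewrite !Wrow ?row_wact ?fol_wedge_wact ?row0//.
  by exists ord0; rewrite mulf_neq0// expf_neq0.
have Winv z : nz z -> meval z f = 0 -> (exists i j, meval z (W i j) != 0) ->
    \sum_i fol_lift F (row z) 0 i * meval z (mderiv i f) = 0.
  move=> z0 fz [i [j Wz]].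
  rewrite -[RHS](f_invariant (row z)).
  - by apply: eq_bigr => k _; rewrite row_eval.
  - by split; [exact: row0|rewrite row_eval].
  - by rewrite f_quasi_smooth.
  - move/(sing_coneP w_gt0 _ (row0 z z0)) => H.
    by move: Wz; rewrite Wrow// H eqxx.
have Wne : exists i j, W i j != 0.
  have [z z0 Fz] := fol_neq0 F; apply: contrapT => H; apply: Fz.
  suff [] : sing_cone F z by [].
  apply/(sing_coneP w_gt0 _ z0) => i j; rewrite WE//.
  have [->|Wij] := eqVneq (W i j) 0; first by rewrite meval0.
  by case: H; exists i, j.
split=> [n2|n3 Sd].
  have [i [j [ij le]]] := degree_le_pair (@complex_uncountable R) w_gt0 n_gt0 f_neq0 homf
    smoothf Weval Whom Winv Wne.
  have n2' : (2 <= n)%N by rewrite n2.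
  have := pair_sum_lt n2' w_gt0 ij; lia.
have [s [s0 sF]] := finitely_many_singular_orbits w_gt0 F_isolated.
have [h [dh [dh0 hh hs]]] := separating_hypersurface w_gt0 s0.
have hW z : nz z -> (forall i j, meval z (W i j) = 0) -> meval z h != 0.
  move=> z0 /(sing_row z z0)/sF[y ys [l l0 yz]].
  have -> : z = fun i => l ^+ w i * y 0 i.
    by rewrite -(rowE z) -yz; apply/funext => i; rewrite mxE.
  by rewrite (meval_whomog _ _ hh) mulf_neq0 ?expf_neq0// hs.
(* If the bound fails, [e = deg f - (d - 1)] is at least [alpha_n sum w], which is the hypothesis of
   [alpha_bound]. *)
rewrite ltNge; apply/negP => le.
have Sl : (\sum_i w i)%N%:Z <= d - 1 by lia.
have S0 : (0 < \sum_i w i)%N by rewrite (bigD1 ord0)//= ltn_addr.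
have aS : alpha R n * (\sum_i w i)%N%:R <= (d0%:Z - (d - 1))%:~R.
  by move: le; rewrite !rmorphB/= -pmulrn; lra.
have [e eE] : exists e : nat, d0%:Z - (d - 1) = e%:Z.
  have : 0 <= d0%:Z - (d - 1).
    rewrite -(ler0z R); apply: le_trans aS; rewrite mulr_ge0// ltW// alpha_gt0//.
    exact: ltnW.
  by case: (d0%:Z - (d - 1)) => // e _; exists e.
rewrite eE -pmulrn in aS.
have d0E : d0%:Z = d - 1 + e%:Z by rewrite -eE; lia.
exact: (degree_lt_of_isolated (@complex_uncountable R) w_gt0 n_gt0 f_neq0 homf
  smoothf Weval Whom Winv dh0 hh hW Sl d0E (alpha_bound n3 S0 aS)).
Qed.
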